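(* Let $X$ be an $E$-valued $\mathcal P$-polynomial process with action $T$, and suppose the standing assumption (A) in the context holds. Let $\mathcal C:=\overline{\mathcal D}\cap\overline{\mathcal L}$ be the domain of $\overline{\mathcal G}$ restricted to $\overline{\mathcal L}$, which is a dense subspace of $\overline{\mathcal L}$. There is a Banach space $(B^+,\|\cdot\|_+)$ which contains $B$ as a sub-vector space (with elements $p\in\mathcal C$ acting on $B^+$ by a pairing $p(\cdot)$ extending the pairing of $\mathcal C\subseteq\overline{\mathcal L}$ with $B$), and an element $b\in B^+$. Moreover, the dual semigroup of $\overline T^{(1)}$ (a semigroup on $B$) can be extended uniquely to a semigroup $U$ of bounded operators on $B^+$ such that $$ \tilde X_t = U_t\tilde X_0 + \int_0^t U_sb\,ds + R_t,\quad t\ge 0, $$ where $R:\Omega\times\mathbb R_+\rightarrow B^+$ with $\mathbb E[\ell(R_t)] = 0$ for any $\ell\in\overline{\mathcal L}$ and $t\ge0$. The integral is understood in a weak*-sense, i.e. $\int_0^t U_sb\, ds$ is the unique element $c_t\in B$ (which exists) with $p(c_t) = \int_0^t p(U_sb)\, ds$ for any $p\in \mathcal C$. If additionally $\overline{T}$ can be extended to a group of bounded operators, then $M_t := (\overline{T}^{(1)}_{-t})^*R_t$ is a weak*-martingale, i.e. for any $\ell\in\overline{\mathcal L}$ the process $\ell(M)$ is an $\mathbb F$-valued martingale. In particular, one then has $$ \tilde X_t = U_t\tilde X_0 + \int_0^t U_sb\,ds + U_tM_t,\quad t\geq 0. $$ If $\overline{\mathcal G}$ restricted to $\overline{\mathcal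 L}$ has domain $\overline{\mathcal{L}}$ (i.e. $\mathcal C=\overline{\mathcal L}$), then $\overline T$ can be extended to a group of bounded operators and $(B^+,\|\cdot\|_+)$ can be chosen to be equal to $(B,\|\cdot\|_B)$.
   Context: $\mathbb F$ is $\mathbb R$ or $\mathbb C$, $\mathbb N=\{0,1,2,\dots\}$, $\mathbb R_+=[0,\infty)$. $(\Omega,\mathfrak A,(\mathcal F_t)_{t\ge 0},P)$ is a filtered probability space and $E$ is a non-empty set. Polynomials: $\mathcal P$ is a vector space of functions $E\to\mathbb F$ containing all constant functions, together with a degree function $\deg:\mathcal P\to\mathbb N$ such that $\deg(p+q)\le\max\{\deg(p),\deg(q)\}$, $\deg(\lambda p)=\deg(p)$ for $p,q\in\mathcal P$, $\lambda\in\mathbb F\setminus\{0\}$, and $\deg(p)=0$ iff $p$ is constant. $\mathcal P_n:=\{p\in\mathcal P:\deg(p)\le n\}$. Polynomial action: a family $T=(T_h)_{h\ge0}$ of linear operators on $\mathcal P$ with $\deg(T_hp)\le\deg(p)$, $T_0p=p$, $T_hT_k=T_{h+k}$ for $h,k\ge0$, and $h\mapsto (T_hp)(x)$ right-continuous for all $p\in\mathcal P$, $x\in E$. Polynomial process: a function $X:\Omega\times\mathbb R_+\to E$ is an $E$-valued $\mathcal P$-polynomial process with action $T$ if for all $p\in\mathcal P$: $\mathbb E[|p(X_t)|]<\infty$ for $t\ge0$; $\mathbb E[p(X_{t+h})|\mathcal F_t]=T_hp(X_t)$ for $t,h\ge0$; $t\mapsto p(X_t)$ has càdlàg paths; $p(X_t)$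 is $\mathcal F_t$-measurable for $t\ge0$. (In particular $T_h$ is the identity on constant functions.) Standing assumption (A): there is a norm $\|\cdot\|$ on $\mathcal P_1$ such that (1) $(T_h|_{\mathcal P_1})_{h\ge0}$ has an extension $(\overline T_h)_{h\ge0}$ to the completion $\overline{\mathcal P}_1$ of $(\mathcal P_1,\|\cdot\|)$ which is a strongly continuous semigroup of bounded operators; (2) for each $x\in E$ the map $\delta_x:\mathcal L\to\mathbb F$, $f\mapsto f(x)$ is $\|\cdot\|$-continuous; (3) $\mathcal P_1$ separates the points of $E$. Here $\mathcal L$ is a fixed closed vector space complement of $\mathcal P_0$ in $\mathcal P_1$. $\overline{\mathcal L}$ is the completion of $\mathcal L$, so $\overline{\mathcal P}_1=\mathcal P_0\oplus\overline{\mathcal L}$, and $\Pi_0,\Pi_1$ are the corresponding projections onto $\mathcal P_0$ and $\overline{\mathcal L}$. $\overline T^{(1)}_h:=\Pi_1\overline T_h|_{\overline{\mathcal L}}$. $\overline{\mathcal G}$ is the generator of the strongly continuous semigroup $\overline T$, and $\overline{\mathcal D}$ is its domain. $(B,\|\cdot\|_B)$ is the topological dual of $(\mathcal L,\|\cdot\|)$ (equivalently of $\overline{\mathcal L}$). $\tilde X_t:=\delta_{X_t}\in B$. For $\ell\in\overline{\mathcal L}$ and $y\in B$, $\ell(y):=y(\ell)$. The dual semigroup of $\overline T^{(1)}$ is $((\overline T_h^{(1)})^* )_{h\ge0}$ on $B$.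
   Formalization: E[ℓ(R_t)]=0 is proved for all ℓ in L; for other ℓ in the completion of L, and for the martingale property of ℓ(M), it is assumed that E[ℓ(R_t)] exists for all ℓ in that completion (for every t in the martingale case), since the literal claim fails in general. *)

(* Defs.v *)
From HB Require Import structures.
From mathcomp Require Import all_boot all_order all_algebra.
From mathcomp Require Import all_classical all_reals all_analysis.
From mathcomp Require Import complex.

Set Implicit Arguments.
Unset Strict Implicit.
Unset Printing Implicit Defensive.

Import Order.TTheory GRing.Theory Num.Theory.
Import numFieldNormedType.Exports.

Local Open Scope classical_set_scope.
Local Open Scope ring_scope.

(* Time is modelled by the real type R; time-indexed families are functions of
   t : R of which only the values at t >= 0 matter, unless the family is a
   group. *)

(** * The scalar field, either R or C *)

Variant scalar_kind := RealScalars | ComplexScalars.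

Definition scalar_field (R : realType) (k : scalar_kind) : numFieldType :=
  match k with
  | RealScalars => (R : numFieldType)
  | ComplexScalars => (R[i] : numFieldType)
  end.

Definition sRe {R : realType} {k : scalar_kind} : scalar_field R k -> R :=
  match k with
  | RealScalars => fun x : R => x
  | ComplexScalars => fun x : R[i] => complex.Re x
  end.

Definition sIm {R : realType} {k : scalar_kind} : scalar_field R k -> R :=
  match k with
  | RealScalars => fun _ : R => 0
  | ComplexScalars => fun x : R[i] => complex.Im x
  end.

(* For real scalars the imaginary part b is dropped. *)
Definition mk_scalar {R : realType} (k : scalar_kind) (a b : R) : scalar_field R k :=
  match k with
  | RealScalars => a
  | ComplexScalars => (a +i* b)%C
  end.

(* The norms of the library take their values in the scalar field; this is the
   modulus as a real number. *)
Definition sabs {R : realType} {k : scalar_kind} (z : scalar_field R k) : R :=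
  sRe `|z|.

(** * Measurability and integration of scalar functions *)

(* G is the collection of events of a sigma-algebra on Omega. *)
Definition smeasurable {R : realType} {k : scalar_kind} {Omega : Type}
    (G : set (set Omega)) (f : Omega -> scalar_field R k) : Prop :=
  forall A : set R, measurable A ->
    G ((fun w => sRe (f w)) @^-1` A) /\ G ((fun w => sIm (f w)) @^-1` A).

Definition sintegrable {R : realType} {k : scalar_kind} {d : measure_display}
    {T : measurableType d} (mu : {measure set T -> \bar R}) (D : set T)
    (f : T -> scalar_field R k) : Prop :=
  [/\ measurable_fun D (fun x => sRe (f x)),
      measurable_fun D (fun x => sIm (f x)) &
      (\int[mu]_(x in D) (sabs (f x))%:E < +oo)%E].

Definition sintegral {R : realType} {k : scalar_kind} {d : measure_display}
    {T : measurableType d} (mu : {measure set T -> \bar R}) (D : set T)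
    (f : T -> scalar_field R k) : scalar_field R k :=
  mk_scalar k (\int[mu]_(x in D) sRe (f x))%R (\int[mu]_(x in D) sIm (f x))%R.

(** * Filtrations, conditional expectations, martingales *)

Definition filtration {R : realType} {d : measure_display}
    {Omega : measurableType d} (F : R -> set (set Omega)) : Prop :=
  [/\ forall t, 0 <= t -> sigma_algebra setT (F t),
      forall t, 0 <= t -> F t `<=` measurable &
      forall s t, 0 <= s -> s <= t -> F s `<=` F t].

(* g is a version of the conditional expectation of f given G. *)
Definition cond_expectation {R : realType} {k : scalar_kind}
    {d : measure_display} {Omega : measurableType d} (P : probability Omega R)
    (G : set (set Omega)) (f g : Omega -> scalar_field R k) : Prop :=
  [/\ sintegrable P setT f, sintegrable P setT g, smeasurable G g &
      forall A, G A -> sintegral P A g = sintegral P A f].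

Definition martingale {R : realType} {k : scalar_kind}
    {d : measure_display} {Omega : measurableType d} (P : probability Omega R)
    (F : R -> set (set Omega)) (N : Omega -> R -> scalar_field R k) : Prop :=
  [/\ forall t, 0 <= t -> smeasurable (F t) (fun w => N w t),
      forall t, 0 <= t -> sintegrable P setT (fun w => N w t) &
      forall s t, 0 <= s -> s <= t ->
        cond_expectation P (F s) (fun w => N w t) (fun w => N w s)].

(** * Polynomials, polynomial actions, polynomial processes *)

Definition is_subspace {K : numFieldType} {V : lmodType K} (A : set V) : Prop :=
  A 0 /\ forall (a : K) (u v : V), A u -> A v -> A (a *: u + v).

Definition is_polynomial_space {K : numFieldType} {E : Type}
    (Pol : set (E -> K)) (deg : (E -> K) -> nat) : Prop :=
  [/\ is_subspace Pol,
      forall c : K, Pol (fun=> c),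
      forall p q, Pol p -> Pol q -> (deg (p + q)%R <= maxn (deg p) (deg q))%N,
      forall (a : K) p, a != 0 -> Pol p -> deg (a *: p) = deg p &
      forall p, Pol p -> (deg p = 0%N <-> exists c : K, p = fun=> c)].

Definition polynomials_upto {K : numFieldType} {E : Type}
    (Pol : set (E -> K)) (deg : (E -> K) -> nat) (n : nat) : set (E -> K) :=
  [set p | Pol p /\ (deg p <= n)%N].

Record is_polynomial_action {R : realType} {k : scalar_kind} {E : Type}
    (Pol : set (E -> scalar_field R k)) (deg : (E -> scalar_field R k) -> nat)
    (T : R -> (E -> scalar_field R k) -> (E -> scalar_field R k)) : Prop := {
  action_stable : forall h p, 0 <= h -> Pol p -> Pol (T h p);
  action_linear : forall h (a : scalar_field R k) p q, 0 <= h -> Pol p -> Pol q ->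
    T h (a *: p + q) = a *: T h p + T h q;
  action_deg : forall h p, 0 <= h -> Pol p -> (deg (T h p) <= deg p)%N;
  action_0 : forall p, Pol p -> T 0 p = p;
  action_D : forall h l p, 0 <= h -> 0 <= l -> Pol p ->
    T h (T l p) = T (h + l) p;
  action_right_continuous : forall p x t, Pol p -> 0 <= t ->
    T h p x @[h --> t^'+] --> T t p x
}.

Definition cadlag {R : realType} {k : scalar_kind} (f : R -> scalar_field R k)
    : Prop :=
  (forall t, 0 <= t -> f s @[s --> t^'+] --> f t) /\
  (forall t, 0 < t -> cvg (f s @[s --> t^'-])).

Record is_polynomial_process {R : realType} {k : scalar_kind}
    {d : measure_display} {Omega : measurableType d} {E : Type}
    (P : probability Omega R) (F : R -> set (set Omega))
    (Pol : set (E -> scalar_field R k))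
    (T : R -> (E -> scalar_field R k) -> (E -> scalar_field R k))
    (X : Omega -> R -> E) : Prop := {
  process_integrable : forall p t, Pol p -> 0 <= t ->
    sintegrable P setT (fun w => p (X w t));
  process_conditional : forall p t h, Pol p -> 0 <= t -> 0 <= h ->
    cond_expectation P (F t)
      (fun w => p (X w (t + h))) (fun w => T h p (X w t));
  process_cadlag : forall p w, Pol p -> cadlag (fun t => p (X w t));
  process_adapted : forall p t, Pol p -> 0 <= t ->
    smeasurable (F t) (fun w => p (X w t))
}.

(** * Operators, semigroups, duals *)

Definition bounded_operator {K : numFieldType} {V W : normedModType K}
    (A : V -> W) : Prop :=
  linear A /\ exists M : K, forall v, `|A v| <= M * `|v|.

Definition bounded_semigroup {R : realType} {K : numFieldType}
    {V : normedModType K} (S : R -> V -> V) : Prop :=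
  [/\ forall h, 0 <= h -> bounded_operator (S h),
      forall v, S 0 v = v &
      forall h l v, 0 <= h -> 0 <= l -> S (h + l) v = S h (S l v)].

Definition C0_semigroup {R : realType} {K : numFieldType}
    {V : normedModType K} (S : R -> V -> V) : Prop :=
  bounded_semigroup S /\ forall v, S h v @[h --> 0^'+] --> v.

(* The family G, indexed by all of R, is a group of bounded operators which
   extends the semigroup S. *)
Definition group_extension {R : realType} {K : numFieldType}
    {V : normedModType K} (S G : R -> V -> V) : Prop :=
  [/\ forall t, bounded_operator (G t),
      forall v, G 0 v = v,
      forall s t v, G (s + t) v = G s (G t v) &
      forall t v, 0 <= t -> G t v = S t v].

(* The graph of the generator of S, and its domain. *)
Definition generator {R : realType} {k : scalar_kind}
    {V : normedModType (scalar_field R k)} (S : R -> V -> V) (v g : V) : Prop :=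
  (mk_scalar k h 0)^-1 *: (S h v - v) @[h --> 0^'+] --> g.

Definition generator_domain {R : realType} {k : scalar_kind}
    {V : normedModType (scalar_field R k)} (S : R -> V -> V) : set V :=
  [set v | exists g, generator S v g].

(* The Banach space V is, through iota, the completion of V0. *)
Definition is_completion {K : numFieldType} {V0 : normedModType K}
    {V : completeNormedModType K} (iota : V0 -> V) : Prop :=
  [/\ linear iota, forall v, `|iota v| = `|v| & dense (range iota)].

(* B is, through the pairing, the space of all continuous linear functionals
   on W, with the operator norm. *)
Record is_topological_dual {K : numFieldType} {W B : normedModType K}
    (pairing : B -> W -> K) : Prop := {
  dual_linear : forall w, linear (fun y => pairing y w : K^o);
  dual_functional : forall y, bounded_operator (pairing y : W -> K^o);
  dual_onto : forall f : W -> K^o, bounded_operator f ->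
    exists! y, forall w, pairing y w = f w;
  dual_norm_ub : forall y w, `|pairing y w| <= `|y| * `|w|;
  dual_norm_least : forall y (c : K), 0 <= c ->
    (forall w, `|pairing y w| <= c * `|w|) -> `|y| <= c
}.

(** * The standing assumption *)

(* P1 is a copy of the space of polynomials of degree at most one, carrying
   its norm; ev p is the function on E represented by p, and L is a closed
   complement of the constants. V is the completion of P1 and Tbar the
   extended semigroup. *)
Record assumption_A {R : realType} {k : scalar_kind} {E : Type}
    (Pol : set (E -> scalar_field R k)) (deg : (E -> scalar_field R k) -> nat)
    (T : R -> (E -> scalar_field R k) -> (E -> scalar_field R k))
    (P1 : normedModType (scalar_field R k)) (ev : P1 -> E -> scalar_field R k)
    (L : set P1) (V : completeNormedModType (scalar_field R k)) (iota : P1 -> V)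
    (Tbar : R -> V -> V) : Prop := {
  A_ev_linear : forall (a : scalar_field R k) p q, ev (a *: p + q) = a *: ev p + ev q;
  A_ev_inj : injective ev;
  A_ev_range : range ev = polynomials_upto Pol deg 1;
  A_L_subspace : is_subspace L;
  A_L_closed : closed L;
  A_L_complement : forall p, exists! l, L l /\
    exists c : scalar_field R k, ev p = (fun=> c) + ev l;
  A_completion : is_completion iota;
  A_semigroup : C0_semigroup Tbar;
  A_extends : forall h p q, 0 <= h -> ev q = T h (ev p) ->
    Tbar h (iota p) = iota q;
  A_delta : forall x, {within L, continuous (fun p => ev p x)};
  A_separates : forall x y, (forall p, ev p x = ev p y) -> x = y
}.

(* W is, through incl, the completion of L, seen as the closure of L in the
   completion V of P1, and Pi1 is the projection of V onto it along the
   constants. *)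
Record is_Lbar {R : realType} {k : scalar_kind} {E : Type}
    (P1 : normedModType (scalar_field R k)) (ev : P1 -> E -> scalar_field R k)
    (L : set P1) (V : completeNormedModType (scalar_field R k)) (iota : P1 -> V)
    (W : completeNormedModType (scalar_field R k)) (incl : W -> V) (Pi1 : V -> W)
    : Prop := {
  Lbar_linear : linear incl;
  Lbar_isometry : forall w, `|incl w| = `|w|;
  Lbar_range : range incl = closure (iota @` L);
  Lbar_proj_linear : linear Pi1;
  Lbar_proj_id : forall w, Pi1 (incl w) = w;
  Lbar_proj_const : forall p (c : scalar_field R k), ev p = (fun=> c) ->
    Pi1 (iota p) = 0
}.

(* The part of S in Lbar. For a semigroup or group S this is S^(1). *)
Definition compression {R : realType} {V W : Type} (incl : W -> V)
    (Pi1 : V -> W) (S : R -> V -> V) : R -> W -> W :=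
  fun h w => Pi1 (S h (incl w)).

(* For all x, delta x is the continuous extension to Lbar of the evaluation
   at x on L. *)
Definition is_delta {R : realType} {k : scalar_kind} {E : Type}
    (P1 : normedModType (scalar_field R k)) (ev : P1 -> E -> scalar_field R k)
    (L : set P1) (V W B : normedModType (scalar_field R k)) (iota : P1 -> V)
    (incl : W -> V) (pairing : B -> W -> scalar_field R k) (delta : E -> B) : Prop :=
  forall x p w, L p -> incl w = iota p -> pairing (delta x) w = ev p x.

(** * The extended space and the representation *)

(* Bp contains B, through j, and the elements of the subspace C of W act on Bp
   by the bilinear pairing pairp, which extends the one with B. *)
Record is_extended_space {K : numFieldType} {W B Bp : normedModType K}
    (pairing : B -> W -> K) (C : set W) (j : B -> Bp) (pairp : Bp -> W -> K)
    : Prop := {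
  ext_j_linear : linear j;
  ext_j_inj : injective j;
  ext_linear_l : forall w, C w -> linear (fun y => pairp y w : K^o);
  ext_linear_r : forall y (a : K) u v, C u -> C v ->
    pairp y (a *: u + v) = a * pairp y u + pairp y v;
  ext_pairing : forall y w, C w -> pairp (j y) w = pairing y w
}.

(* U is a semigroup of bounded operators on Bp which extends the dual
   semigroup of S: y' below is the image of y under the adjoint of S h. *)
Definition extends_dual_semigroup {R : realType} {K : numFieldType}
    {W B Bp : normedModType K} (pairing : B -> W -> K) (S : R -> W -> W)
    (j : B -> Bp) (U : R -> Bp -> Bp) : Prop :=
  bounded_semigroup U /\
  forall h y y', 0 <= h -> (forall w, pairing y' w = pairing y (S h w)) ->
    U h (j y) = j y'.

(* c is the integral of s |-> f s over [0, t] in the weak* sense. *)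
Definition weak_star_integral {R : realType} {k : scalar_kind}
    {W B Bp : normedModType (scalar_field R k)} (pairing : B -> W -> scalar_field R k)
    (C : set W) (pairp : Bp -> W -> scalar_field R k) (f : R -> Bp) (t : R) (c : B)
    : Prop :=
  forall p, C p ->
    sintegrable lebesgue_measure `[0, t] (fun s => pairp (f s) p) /\
    pairing c p = sintegral lebesgue_measure `[0, t] (fun s => pairp (f s) p).

(* All scalar random variables l(Y), for l in W, have an expectation. *)
Definition weakly_integrable {R : realType} {k : scalar_kind}
    {d : measure_display} {Omega : measurableType d} (P : probability Omega R)
    {W B : normedModType (scalar_field R k)} (pairing : B -> W -> scalar_field R k)
    (Y : Omega -> B) : Prop :=
  forall l, sintegrable P setT (fun w => pairing (Y w) l).

(* LW is the image of L in W, and Xt is the process of the evaluations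
   delta_(X_t). The integrals c t and the remainder Rm lie in the subspace B of
   Bp, so that all of W acts on them. For l in LW the random variable l(Rm_t)
   is integrable. For l in W outside LW it need not be, and having mean zero
   (or being a martingale, for M) for all l in W is asserted when l(Rm_t) has an
   expectation for all l. Some such proviso is needed: let X sit at 0 for an
   exponential time and then jump to a state n >= 1 chosen with law pi, take
   for L the functions on nat with finite support, with norm
   max_n (pi n * `|f n|) + `|\sum_(n >= 1) pi n * f n|, where pi 0 = 1. Then
   f |-> \sum_(n >= 1) pi n * f n extends to the completion W, but is not
   determined by the values of f: some l in W vanishes at all the delta_x and
   has T_t l equal to l + (1 - e^-t) times the indicator function of 0. *)
Definition weak_star_representation {R : realType} {k : scalar_kind}
    {d : measure_display} {Omega : measurableType d} (P : probability Omega R)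
    (F : R -> set (set Omega)) {V W B Bp : normedModType (scalar_field R k)}
    (Tbar : R -> V -> V) (incl : W -> V) (Pi1 : V -> W)
    (pairing : B -> W -> scalar_field R k) (LW C : set W) (Xt : Omega -> R -> B)
    (j : B -> Bp) (pairp : Bp -> W -> scalar_field R k) : Prop :=
  exists (b : Bp) (U : R -> Bp -> Bp) (c : R -> B) (Rm : Omega -> R -> B),
  let T1 := compression incl Pi1 Tbar in
  (extends_dual_semigroup pairing T1 j U /\
   forall U', extends_dual_semigroup pairing T1 j U' ->
     forall t y, 0 <= t -> U' t y = U t y) /\
  (forall t, 0 <= t ->
     unique (weak_star_integral pairing C pairp (fun s => U s b) t) (c t)) /\
  (forall w t, 0 <= t -> j (Xt w t) = U t (j (Xt w 0)) + j (c t) + j (Rm w t)) /\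
  (forall t l, 0 <= t ->
     LW l \/ weakly_integrable P pairing (fun w => Rm w t) ->
     sintegrable P setT (fun w => pairing (Rm w t) l) /\
     sintegral P setT (fun w => pairing (Rm w t) l) = 0) /\
  (forall G, group_extension Tbar G ->
     exists M : Omega -> R -> B,
     (forall w t l, 0 <= t ->
        pairing (M w t) l = pairing (Rm w t) (compression incl Pi1 G (- t) l)) /\
     ((forall t, 0 <= t -> weakly_integrable P pairing (fun w => Rm w t)) ->
        forall l, martingale P F (fun w t => pairing (M w t) l)) /\
     (forall w t, 0 <= t ->
        j (Xt w t) = U t (j (Xt w 0)) + j (c t) + U t (j (M w t)))).

(* Main.v *)
(* The polynomials of degree at most one split as constants plus Lbar. As the
   action fixes the constants, T_h l = T1_h l + kappa_h(l) for l in Lbar, where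
   kappa_h is in B, and kappa_t(p) is the integral of beta(T1_s p) over [0, t]
   for p in C, where beta(p) is the constant part of the generator at p. The
   functional beta plays the role of b, the weak* integral c_t is kappa_t, and
   R_t(l) = l(X_t) - (T1_t l)(X_0) - kappa_t(l) has mean zero for polynomials l
   by the defining property of the process. For all other l this follows by
   continuity: l |-> E |R_t(l)| is a lower semicontinuous seminorm on a Banach
   space when it is finite, hence bounded.

   In general beta is not in B. Let Q be the resolvent of the generator,
   compressed to Lbar. The space B^+ is the norm closure in B of the range of
   (Q^* )^2, into which B embeds by (Q^* )^2. This makes B dense in B^+, so that
   the extension U of the dual semigroup is unique, and puts beta in B^+, as
   kappa_h / h tends to beta uniformly on bounded sets of the domain of the
   squared generator. If the generator is defined everywhere, then beta is
   bounded by the uniform boundedness principle, and T_(1/n) is invertible for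
   large n by a Neumann series. *)

(* The obstacle is [b]. Write [Qs] for the adjoint of the compressed resolvent [Q]. Only [beta \o Q]
   is bounded; let [z] in [B] represent it. Formally [Qs beta = z], so the image of beta under the
   square of [Qs] is [Qs z], and this vector is [b]. With a single power of [Qs] the vector would be
   [z], but the functionals [kappa_h / h] composed with one [Q] need not converge to it in norm. The
   pairing has to be found separately. A vector [Qs y] acts on [w] in [C] as [y] acts on [l w] minus
   the compressed generator at [w]; this covers the image of [B] and all [U_s b], and the remaining
   vectors are reached by an algebraic projection. The resolvent is built without a growth bound or
   an improper integral. For [S'_h = exp (- l h) S_h] with [l] twice a bound of [S_1], the operator
   [1 - S'_1] has a Neumann inverse [Z]. The integral of [S'] over [[0, 1]], applied to [Z v], is
   the resolvent at [v]. Integrals of orbits are limits of Riemann sums, and become Lebesgue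
   integrals only after a functional is applied. *)
From HB Require Import structures.
Require Import Defs.
From mathcomp Require Import all_boot all_order all_algebra.
From mathcomp Require Import all_classical all_reals all_analysis.
From mathcomp Require Import complex measurable_realfun.
From mathcomp Require Import lra ring.

Set Implicit Arguments.
Unset Strict Implicit.
Unset Printing Implicit Defensive.

Import Order.TTheory GRing.Theory Num.Theory.
Import numFieldNormedType.Exports.

Local Open Scope classical_set_scope.
Local Open Scope ring_scope.

Local Notation sintegral := Defs.sintegral.

(** * Scalars and real-valued norms *)

Section Scalars.
Context {R : realType} {k : scalar_kind}.
Local Notation K := (scalar_field R k).

Definition rc (a : R) : K := mk_scalar k a 0.

Lemma sReD (x y : K) : sRe (x + y) = sRe x + sRe y.
Proof. by move: x y; case: k => // -[a b] [c e]. Qed.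

Lemma sReN (x : K) : sRe (- x) = - sRe x.
Proof. by move: x; case: k => // -[a b]. Qed.

Lemma sReB (x y : K) : sRe (x - y) = sRe x - sRe y.
Proof. by rewrite sReD sReN. Qed.

Lemma sImD (x y : K) : sIm (x + y) = sIm x + sIm y.
Proof. by move: x y; case: k => [x y|[a b] [c e]] //=; rewrite addr0. Qed.

Lemma sImN (x : K) : sIm (- x) = - sIm x.
Proof. by move: x; case: k => [x|[a b]] //=; rewrite oppr0. Qed.

Lemma sImB (x y : K) : sIm (x - y) = sIm x - sIm y.
Proof. by rewrite sImD sImN. Qed.

Lemma sRe_rc a : sRe (rc a) = a.
Proof. by rewrite /rc; case: k. Qed.

Lemma sIm_rc a : sIm (rc a) = 0.
Proof. by rewrite /rc; case: k. Qed.

Lemma scalar_ext (x y : K) : sRe x = sRe y -> sIm x = sIm y -> x = y.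
Proof. by move: x y; case: k => // -[a b] [c e] /= -> ->. Qed.

Lemma mk_scalarK (x : K) : mk_scalar k (sRe x) (sIm x) = x.
Proof. by move: x; case: k => // -[a b]. Qed.

Lemma rcD a b : rc (a + b) = rc a + rc b.
Proof. by apply: scalar_ext; rewrite ?sReD ?sImD ?sRe_rc ?sIm_rc ?addr0. Qed.

Lemma rcN a : rc (- a) = - rc a.
Proof. by apply: scalar_ext; rewrite ?sReN ?sImN ?sRe_rc ?sIm_rc ?oppr0. Qed.

Lemma rcB a b : rc (a - b) = rc a - rc b.
Proof. by rewrite rcD rcN. Qed.

Lemma rc0 : rc 0 = 0.
Proof. by rewrite /rc; case: k. Qed.

Lemma rc1 : rc 1 = 1.
Proof. by rewrite /rc; case: k. Qed.

Lemma rcM a b : rc (a * b) = rc a * rc b.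
Proof.
rewrite /rc; case: k => //=.
by apply/eqP; rewrite eq_complex /= !mul0r !mulr0 subr0 addr0 !eqxx.
Qed.

Lemma rc_eq0 a : (rc a == 0) = (a == 0).
Proof.
apply/eqP/eqP => [h|->]; last exact: rc0.
by rewrite -(sRe_rc a) h -rc0 sRe_rc.
Qed.

Lemma rcMn n : rc n%:R = n%:R.
Proof. by elim: n => [|n ih]; rewrite ?rc0 // -addn1 !natrD rcD ih rc1. Qed.

Lemma rc_le a b : (rc a <= rc b) = (a <= b).
Proof. by rewrite /rc; case: k => //=; rewrite lecE /= eqxx. Qed.

Lemma rc_lt a b : (rc a < rc b) = (a < b).
Proof. by rewrite /rc; case: k => //=; rewrite ltcE /= eqxx. Qed.

Lemma rc_ge0 a : (0 <= rc a) = (0 <= a).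
Proof. by rewrite -rc0 rc_le. Qed.

Lemma rc_gt0 a : (0 < rc a) = (0 < a).
Proof. by rewrite -rc0 rc_lt. Qed.

Lemma rc_real (x : K) : 0 <= x -> x = rc (sRe x).
Proof.
move: x; rewrite /rc; case: k => // -[a b]; rewrite lecE /= => /andP[/eqP -> _].
by [].
Qed.

Lemma normrc a : `|rc a| = rc `|a|.
Proof.
have [a0|a0] := leP 0 a; first by rewrite !ger0_norm // rc_ge0.
by rewrite ltr0_norm ?(ltr0_norm a0) ?rcN // -rc0 rc_lt.
Qed.

Lemma sabsE (z : K) : `|z| = rc (sabs z).
Proof. exact: rc_real. Qed.

Lemma sabs_ge0 (z : K) : 0 <= sabs z.
Proof. by rewrite -rc_ge0 -sabsE. Qed.

Lemma sabs_rc a : sabs (rc a) = `|a|.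
Proof. by rewrite /sabs normrc sRe_rc. Qed.

Lemma sabsM (x y : K) : sabs (x * y) = sabs x * sabs y.
Proof. by rewrite {1}/sabs normrM !sabsE -rcM sRe_rc. Qed.

Lemma sabsD (x y : K) : sabs (x + y) <= sabs x + sabs y.
Proof. by rewrite -rc_le rcD -!sabsE ler_normD. Qed.

Lemma sabsN (x : K) : sabs (- x) = sabs x.
Proof. by rewrite /sabs normrN. Qed.

Lemma sabs0 : sabs (0 : K) = 0.
Proof. by rewrite /sabs normr0 -rc0 sRe_rc. Qed.

Lemma sabs_eq0 (x : K) : sabs x = 0 -> x = 0.
Proof. by move=> h; apply/eqP; rewrite -normr_eq0 sabsE h rc0. Qed.

Lemma sRe_le_sabs (x : K) : `|sRe x| <= sabs x.
Proof.
rewrite /sabs; move: x; case: k => // -[a b] /=.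
by rewrite -sqrtr_sqr ler_wsqrtr // lerDl sqr_ge0.
Qed.

Lemma sIm_le_sabs (x : K) : `|sIm x| <= sabs x.
Proof.
rewrite /sabs; move: x; case: k => [x|[a b]] /=; first by rewrite normr0.
by rewrite -(sqrtr_sqr b) ler_wsqrtr // lerDr sqr_ge0.
Qed.

Lemma sabs_le_ReIm (x : K) : sabs x <= `|sRe x| + `|sIm x|.
Proof.
rewrite /sabs; move: x; case: k => [x|[a b]] /=; first by rewrite normr0 addr0.
rewrite -[leRHS]ger0_norm ?addr_ge0 // -sqrtr_sqr ler_wsqrtr //.
rewrite sqrrD !real_normK ?num_real // -addrA lerD2l lerDr.
by rewrite mulrn_wge0 // mulr_ge0.
Qed.

End Scalars.
Arguments rc {R} k a.

Section Norm.
Context {R : realType} {k : scalar_kind}.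
Local Notation K := (scalar_field R k).
Implicit Types V W : normedModType K.

(* Norms take values in K, which is only partially ordered when K is complex. *)
Definition nrm {V : normedModType K} (v : V) : R := sRe `|v|.

Lemma nrmE V (v : V) : `|v| = rc k (nrm v).
Proof. exact: rc_real. Qed.

Lemma nrm_ge0 V (v : V) : 0 <= nrm v.
Proof. by rewrite -(@rc_ge0 R k) -nrmE. Qed.

Lemma nrm0 V : nrm (0 : V) = 0.
Proof. by rewrite /nrm normr0 -rc0 sRe_rc. Qed.

Lemma nrmN V (v : V) : nrm (- v) = nrm v.
Proof. by rewrite /nrm normrN. Qed.

Lemma nrmD V (u v : V) : nrm (u + v) <= nrm u + nrm v.
Proof. by rewrite -(@rc_le R k) rcD -!nrmE ler_normD. Qed.

Lemma nrmB V (u v : V) : nrm (u - v) <= nrm u + nrm v.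
Proof. by rewrite (le_trans (nrmD _ _)) // nrmN. Qed.

Lemma nrmBC V (u v : V) : nrm (u - v) = nrm (v - u).
Proof. by rewrite -nrmN opprB. Qed.

Lemma nrm_dist V (w u v : V) : nrm (u - v) <= nrm (u - w) + nrm (w - v).
Proof. by rewrite -[u - v](subrKA w) nrmD. Qed.

Lemma nrmZ V (a : K) (v : V) : nrm (a *: v) = sabs a * nrm v.
Proof. by rewrite {1}/nrm normrZ sabsE nrmE -rcM sRe_rc. Qed.

Lemma nrm_eq0 V (v : V) : nrm v = 0 -> v = 0.
Proof. by move=> h; apply/eqP; rewrite -normr_eq0 nrmE h rc0. Qed.

Lemma nrm_sum V (I : Type) (r : seq I) (P : pred I) (F : I -> V) :
  nrm (\sum_(i <- r | P i) F i) <= \sum_(i <- r | P i) nrm (F i).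
Proof.
elim/big_ind2 : _ => [|u a v b ua vb|//]; first by rewrite nrm0.
by rewrite (le_trans (nrmD _ _)) // lerD.
Qed.

Lemma nrm_small V (v : V) : (forall e : R, 0 < e -> nrm v < e) -> v = 0.
Proof.
move=> h; apply: nrm_eq0; apply/eqP; rewrite eq_le nrm_ge0 andbT leNgt.
by apply/negP => /h; rewrite ltxx.
Qed.

Lemma nrm_small_le V (v : V) (c : R) :
  (forall e : R, 0 < e -> nrm v <= c * e) -> v = 0.
Proof.
move=> h; apply: nrm_small => e e0.
have c0 : 0 < `|c| + 1 by rewrite ltr_wpDl.
have := h (e / (`|c| + 1)) (divr_gt0 e0 c0); move/le_lt_trans; apply.
rewrite mulrA ltr_pdivrMr // mulrC ltr_pM2l //.
by rewrite (le_lt_trans (ler_norm c)) // ltrDl.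
Qed.

Lemma ballE V (v u : V) (e : R) : ball v (rc k e) u <-> nrm (v - u) < e.
Proof. by rewrite -ball_normE /ball_ /= nrmE rc_lt. Qed.

Lemma cvg_nrmP V {T : Type} {F : set_system T} {FF : Filter F} (f : T -> V) (v : V) :
  f @ F --> v <-> (forall e : R, 0 < e -> \forall x \near F, nrm (f x - v) < e).
Proof.
split=> [/cvgrPdistC_lt h e e0|h].
  have := h (rc k e); rewrite rc_gt0 => /(_ e0).
  by apply: filterS => x; rewrite nrmE rc_lt.
apply/cvgrPdistC_lt => e e0; have eE := rc_real (ltW e0).
rewrite eE; have /h : 0 < sRe e by rewrite -(@rc_gt0 R k) -eE.
by apply: filterS => x; rewrite nrmE rc_lt.
Qed.

Lemma cvg_nrm0P V {T : Type} {F : set_system T} {FF : Filter F} (f : T -> V) (v : V) :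
  f @ F --> v <-> (fun x => nrm (f x - v)) @ F --> (0 : R).
Proof.
rewrite cvg_nrmP; split=> [h|/cvgrPdistC_lt h e e0].
  apply/cvgrPdistC_lt => e /h; apply: filterS => x.
  by rewrite subr0 ger0_norm // nrm_ge0.
by apply: filterS (h e e0) => x; rewrite subr0 ger0_norm // nrm_ge0.
Qed.

Lemma cvg_nrm_le V {T : Type} {F : set_system T} {FF : Filter F} (f : T -> V) (v : V)
    (g : T -> R) :
  (\forall x \near F, nrm (f x - v) <= g x) -> g @ F --> (0 : R) -> f @ F --> v.
Proof.
move=> fg g0; apply/cvg_nrm0P; apply: (squeeze_cvgr (f := fun=> 0) _ _ g0).
  by near=> x; rewrite nrm_ge0 /=; near: x.
exact: cvg_cst.
Unshelve. all: by end_near. Qed.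

Lemma nrm_cvg_unique V {T : Type} {F : set_system T} {FF : ProperFilter F}
    (f : T -> V) (v w : V) : f @ F --> v -> f @ F --> w -> v = w.
Proof. exact: (@cvg_unique _ (@norm_hausdorff _ V) (f @ F) _). Qed.

Lemma eq_cvg_nrm V {T : Type} {F : set_system T} {FF : Filter F} (f g : T -> V) (v : V) :
  (\forall x \near F, f x = g x) -> g @ F --> v -> f @ F --> v.
Proof.
move=> fg; apply: cvg_trans; apply: near_eq_cvg.
by near=> x; apply/esym; near: x.
Unshelve. all: by end_near. Qed.

Lemma denseP V (A : set V) :
  dense A <-> forall v (e : R), 0 < e -> exists2 a, A a & nrm (a - v) < e.
Proof.
split=> [dA v e e0|h O [v Ov] oO].
  have e0' : 0 < rc k e by rewrite rc_gt0.
  have [|a [va Aa]] := dA (ball v (rc k e)) _ (ball_open _ _).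
    by exists v; exact: ballxx.
  by exists a => //; rewrite nrmBC; apply/ballE.
have /nbhs_ballP[e /= e0 veO] : nbhs v O by exact: open_nbhs_nbhs.
have eE := rc_real (ltW e0).
have /(h v)[a Aa av] : 0 < sRe e by rewrite -(@rc_gt0 R k) -eE.
by exists a; split=> //; apply: veO; rewrite /= eE; apply/ballE; rewrite nrmBC.
Qed.

Lemma closureP V (A : set V) v :
  closure A v <-> forall e : R, 0 < e -> exists2 a, A a & nrm (a - v) < e.
Proof.
split=> [cA e e0|h U /nbhs_ballP[e /= e0 veU]].
  have e0' : 0 < rc k e by rewrite rc_gt0.
  have [a [Aa va]] := cA _ (nbhsx_ballx v _ e0').
  by exists a => //; rewrite nrmBC; apply/ballE.
have eE := rc_real (ltW e0).
have /h[a Aa av] : 0 < sRe e by rewrite -(@rc_gt0 R k) -eE.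
by exists a; split=> //; apply: veU; rewrite /= eE; apply/ballE; rewrite nrmBC.
Qed.

Lemma cauchy_nrm_cvg (V : completeNormedModType K) (u : nat -> V) :
  (forall e : R, 0 < e -> exists N, forall m n, (N <= m)%N -> (N <= n)%N ->
     nrm (u m - u n) < e) -> exists v : V, u n @[n --> \oo] --> v.
Proof.
move=> h; suff /cauchy_cvg : cauchy (u @ \oo) by move/cvg_ex.
apply/cauchy_ballP => e e0; have eE := rc_real (ltW e0).
have /h[N hN] : 0 < sRe e by rewrite -(@rc_gt0 R k) -eE.
pose A := u @` [set n | (N <= n)%N].
have FA : (u @ \oo) A by exists N => // n /= Nn; exists n.
exists (A, A) => // -[_ _] [/= [m Nm <-] [n Nn <-]]; rewrite eE; apply/ballE; exact: hN.
Qed.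

End Norm.

(** * Linear and bounded operators, the uniform boundedness principle *)

Section LinearMaps.
Context {K : numFieldType} {V W : lmodType K} (A : V -> W) (hA : linear A).

Lemma lin0 : A 0 = 0.
Proof. by rewrite -[0](scaler0 _ (-1)) -[in LHS](addr0 (_ *: _)) hA scaleN1r addNr. Qed.

Lemma linD u v : A (u + v) = A u + A v.
Proof. by rewrite -[u]scale1r hA !scale1r. Qed.

Lemma linZ a v : A (a *: v) = a *: A v.
Proof. by rewrite -[a *: v]addr0 hA lin0 addr0. Qed.

Lemma linN v : A (- v) = - A v.
Proof. by rewrite -scaleN1r linZ scaleN1r. Qed.

Lemma linB u v : A (u - v) = A u - A v.
Proof. by rewrite linD linN. Qed.

Lemma lin_sum (I : Type) (r : seq I) (P : pred I) (f : I -> V) :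
  A (\sum_(i <- r | P i) f i) = \sum_(i <- r | P i) A (f i).
Proof. by apply: (big_morph A linD lin0). Qed.

End LinearMaps.

Section BoundedOperators.
Context {R : realType} {k : scalar_kind}.
Local Notation K := (scalar_field R k).
Implicit Types V W U : normedModType K.

Lemma bounded_operatorP V W (A : V -> W) :
  bounded_operator A <->
  linear A /\ exists2 M : R, 0 <= M & forall v, nrm (A v) <= M * nrm v.
Proof.
split=> -[lA [M]]; last first.
  move=> M0 hM; split => //; exists (rc k M) => v.
  by rewrite !nrmE -rcM rc_le.
(* [bounded_operator] allows a complex [M]. Its modulus serves as well, because [M * |v|] lies above
   a nonnegative scalar and so equals its own modulus. *)
move=> hM; split => //; exists (sabs M); first exact: sabs_ge0.
move=> v; rewrite -(@rc_le R k) rcM -sabsE -!nrmE -[leRHS]ger0_norm ?mulr_ge0 //.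
rewrite normrM !normr_id -{1}[`|v|]normr_id -normrM ger0_norm //.
exact: le_trans (hM v).
Qed.

Lemma bounded_operator_bound V W (A : V -> W) : bounded_operator A ->
  exists2 M : R, 0 < M & forall v, nrm (A v) <= M * nrm v.
Proof.
move=> /bounded_operatorP[_ [M M0 hM]]; exists (M + 1); first by rewrite ltr_wpDl.
by move=> v; rewrite (le_trans (hM v)) // ler_wpM2r ?nrm_ge0 // lerDl.
Qed.

Lemma bounded_operator_comp U V W (A : V -> W) (B : U -> V) :
  bounded_operator A -> bounded_operator B -> bounded_operator (A \o B).
Proof.
move=> /bounded_operatorP[lA [M M0 hM]] /bounded_operatorP[lB [N N0 hN]].
apply/bounded_operatorP; split=> [a u v|]; first by rewrite /= lB lA.
exists (M * N); first exact: mulr_ge0.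
by move=> v; rewrite (le_trans (hM _)) // -mulrA ler_wpM2l.
Qed.

Lemma bounded_operator_id V : bounded_operator (fun v : V => v).
Proof.
apply/bounded_operatorP; split=> //; exists 1 => // v; by rewrite mul1r.
Qed.

Lemma bounded_operatorD V W (A B : V -> W) :
  bounded_operator A -> bounded_operator B -> bounded_operator (fun v => A v + B v).
Proof.
move=> /bounded_operatorP[lA [M M0 hM]] /bounded_operatorP[lB [N N0 hN]].
apply/bounded_operatorP; split=> [a u v|].
  by rewrite lA lB scalerDr addrACA.
exists (M + N); first exact: addr_ge0.
by move=> v; rewrite (le_trans (nrmD _ _)) // mulrDl lerD.
Qed.

Lemma bounded_operatorZ V W (a : K) (A : V -> W) :
  bounded_operator A -> bounded_operator (fun v => a *: A v).
Proof.
move=> /bounded_operatorP[lA [M M0 hM]].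
apply/bounded_operatorP; split=> [b u v|].
  by rewrite lA scalerDr !scalerA mulrC.
exists (sabs a * M); first by rewrite mulr_ge0 // sabs_ge0.
by move=> v; rewrite nrmZ -mulrA ler_wpM2l // sabs_ge0.
Qed.

Lemma bounded_operatorB V W (A B : V -> W) :
  bounded_operator A -> bounded_operator B -> bounded_operator (fun v => A v - B v).
Proof.
move=> hA /(bounded_operatorZ (-1)) /(bounded_operatorD hA).
by under eq_fun do rewrite scaleN1r.
Qed.

Lemma bounded_operator_cvg V W (A : V -> W) {T : Type} {F : set_system T}
    {FF : Filter F} (f : T -> V) (v : V) :
  bounded_operator A -> f @ F --> v -> (fun x => A (f x)) @ F --> A v.
Proof.
move=> /bounded_operatorP[lA [M M0 hM]] /cvg_nrm0P fv.
apply: (@cvg_nrm_le _ _ _ _ _ _ _ _ (fun x => M * nrm (f x - v))).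
  by near=> x; rewrite -(linB lA).
by rewrite -[X in _ --> X](mulr0 M); apply: cvgM => //; exact: cvg_cst.
Unshelve. all: by end_near. Qed.

Lemma bounded_operator_eq_dense V W (A B : V -> W) (D : set V) :
  bounded_operator A -> bounded_operator B ->
  (forall v (e : R), 0 < e -> exists2 u, D u & nrm (u - v) < e) ->
  (forall v, D v -> A v = B v) -> forall v, A v = B v.
Proof.
move=> hA hB dD AB v; apply/eqP; rewrite -subr_eq0; apply/eqP.
have /bounded_operatorP[lC [M M0 hM]] := bounded_operatorB hA hB.
apply: (@nrm_small_le _ _ _ _ M) => e e0; have [u Du uv] := dD v e e0.
have -> : A v - B v = A (v - u) - B (v - u).
  have [lA _] := hA; have [lB _] := hB.
  by rewrite (linB lA) (linB lB) (AB u Du) opprB addrA subrK.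
by rewrite (le_trans (hM _)) // ler_wpM2l // ltW // nrmBC.
Qed.

(* Nested balls, as in the proof of Baire's theorem: an unbounded p exceeds n
   on some ball inside any given ball. *)
Lemma lsc_seminorm_bounded (V : completeNormedModType K) (p : V -> R) :
  (forall u v, p (u + v) <= p u + p v) ->
  (forall a v, p (rc k a *: v) = `|a| * p v) ->
  (forall v c, c < p v -> exists2 e, 0 < e & forall u, nrm (u - v) < e -> c < p u) ->
  exists2 M, 0 <= M & forall v, p v <= M * nrm v.
Proof.
move=> pD pZ lsc; apply: contrapT => unb.
have {}unb M : 0 <= M -> exists v, M * nrm v < p v.
  move=> M0; apply: contrapT => h; apply: unb; exists M => // v.
  by rewrite leNgt; apply/negP => hv; apply: h; exists v.
have p0 : p 0 = 0 by have := pZ 0 0; rewrite scaler0 normr0 mul0r.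
have pN v : p (- v) = p v.
  by rewrite -scaleN1r -rc1 -rcN pZ normrN normr1 mul1r.
have p_ge0 v : 0 <= p v.
  have := pD v (- v); rewrite subrr p0 pN => h; lra.
(* A pair is a centre and a radius. Positivity of the radius is a premise inside the existential, so
   that [choice] gives a total function. *)
have step (n : nat) (x : V * R) : exists y : V * R, 0 < x.2 ->
    [/\ 0 < y.2, y.2 <= x.2 / 2 & forall u, nrm (u - y.1) <= y.2 ->
        nrm (u - x.1) <= x.2 /\ n%:R < p u].
  case: x => x r; have [r0|/negP r0] := boolP (0 < r); last by exists (x, r).
  (* With this constant, [v] scaled to norm [r / 2] has [p] above [n%:R + p x], so moving [x] by it
     leaves [p] above [n%:R]. *)
  have c0 : 0 <= 2 * (n%:R + p x) / r.
    by rewrite divr_ge0 ?mulr_ge0 ?addr_ge0 // ltW.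
  have [v hv] := unb _ c0.
  have v0 : 0 < nrm v.
    rewrite lt_neqAle nrm_ge0 andbT eq_sym; apply/eqP => v0.
    by move: hv; rewrite (nrm_eq0 v0) nrm0 p0 mulr0 ltxx.
  pose a := r / 2 / nrm v; have a0 : 0 < a by rewrite !divr_gt0.
  pose y := x + rc k a *: v.
  have py : n%:R < p y.
    have : p (rc k a *: v) <= p y + p x.
      by rewrite -(pN x); apply: le_trans (pD _ _); rewrite /y addrAC subrr add0r.
    rewrite pZ gtr0_norm //.
    have : a * (2 * (n%:R + p x) / r * nrm v) < a * p v by rewrite ltr_pM2l.
    have -> : a * (2 * (n%:R + p x) / r * nrm v) = n%:R + p x.
      by rewrite /a; field; rewrite ?gt_eqF.
    lra.
  have [e e0 he] := lsc _ _ py.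
  (* [e / 2] turns the open ball of lower semicontinuity into a closed one; [r / 4] keeps the ball
     around [y], at distance [r / 2] from [x], inside the old one. *)
  exists (y, Num.min (e / 2) (r / 4)) => _ /=; split.
  - by rewrite lt_min !divr_gt0.
  - by rewrite ge_min; apply/orP; right; lra.
  move=> u; rewrite le_min => /andP[ue ur]; split; last by apply: he; lra.
  have : nrm (y - x) = r / 2.
    rewrite /y addrAC subrr add0r nrmZ sabs_rc gtr0_norm // /a.
    by rewrite divfK // gt_eqF.
  by have := nrm_dist y u x; lra.
have [f hf] := choice (fun nx : nat * (V * R) => step nx.1 nx.2).
pose s := fix s n := if n is m.+1 then f (m, s m) else (0, 1) : V * R.
have s0 n : 0 < (s n).2.
  by elim: n => [|n ih] //=; have [] := hf (n, s n) ih.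
have s2 n : (s n).2 <= 2^-1 ^+ n.
  elim: n => [|n ih]; rewrite ?expr0 // exprS.
  by have [_ h _] := hf (n, s n) (s0 n); rewrite /=; move: h => /= h; lra.
have s_in n m u : nrm (u - (s (n + m)%N).1) <= (s (n + m)%N).2 ->
    nrm (u - (s n).1) <= (s n).2.
  elim: m u => [|m ih] u; first by rewrite addn0.
  rewrite addnS => hu; apply: ih.
  by have [_ _ /(_ u hu)[]] := hf ((n + m)%N, s (n + m)%N) (s0 _).
have s_dist n m : (n <= m)%N -> nrm ((s m).1 - (s n).1) <= (s n).2.
  by move=> nm; apply: (s_in n (m - n)%N); rewrite subnKC // subrr nrm0 ltW.
have small (e : R) : 0 < e -> exists n, 2^-1 ^+ n < e.
  move=> e0; have : `|2^-1 : R| < 1 by rewrite ger0_norm; lra.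
  move=> /cvg_expr/cvgrPdistC_lt/(_ e e0)[n _ /(_ n (leqnn n))] /=.
  by rewrite subr0 ger0_norm ?exprn_ge0 // => h; exists n.
have [e e0|x sx] := @cauchy_nrm_cvg _ _ V (fun n => (s n).1).
  have e20 : 0 < e / 2 by lra.
  have [N hN] := small _ e20; exists N => m n Nm Nn.
  have := nrm_dist (s N).1 (s m).1 (s n).1.
  have := s_dist _ _ Nm; have := s_dist _ _ Nn; rewrite [nrm ((s n).1 - _)]nrmBC.
  by have := s2 N; lra.
have xs n : nrm (x - (s n).1) <= (s n).2.
  apply/ler_addgt0Pr => e e0; have [N _ hN] := (cvg_nrmP _ _).1 sx e e0.
  have := nrm_dist (s (n + N)%N).1 x (s n).1.
  have := s_dist n (n + N)%N (leq_addr _ _).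
  have := hN (n + N)%N (leq_addl _ _); rewrite /= nrmBC; lra.
have px n : n%:R < p x.
  by have [_ _ /(_ x (xs n.+1))[]] := hf (n, s n) (s0 n).
have := px (Num.truncn (p x)).+1; apply/negP; rewrite -leNgt ltW //.
exact: truncnS_gt.
Qed.

(** The supremum over [i] of [nrm (A i v)] is a lower semicontinuous seminorm of [v]. The value 0 is
    added to the set [S v] to cover an empty [I]. *)
Lemma uniform_boundedness (V : completeNormedModType K) W (I : Type) (A : I -> V -> W) :
  (forall i, bounded_operator (A i)) ->
  (forall v, exists M : R, forall i, nrm (A i v) <= M) ->
  exists2 M : R, 0 <= M & forall i v, nrm (A i v) <= M * nrm v.
Proof.
move=> bA hA; pose S v : set R := [set r | r = 0 \/ exists i, r = nrm (A i v)].
have S_sup v : has_sup (S v).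
  split; first by exists 0; left.
  have [M hM] := hA v; exists (Num.max 0 M) => _ [->|[i ->]]; rewrite le_max ?lexx //.
  by rewrite hM orbT.
have S_ub v r : S v r -> r <= sup (S v) by move=> h; exact: sup_upper_bound.
have [u v|a v|v c|M M0 hM] := @lsc_seminorm_bounded V (fun v => sup (S v)).
- apply: ge_sup; first by exists 0; left.
  move=> _ [->|[i ->]]; first by rewrite addr_ge0 // S_ub //; left.
  have [lA _] := bA i; rewrite (linD lA) (le_trans (nrmD _ _)) // lerD // S_ub //; right.
    by exists i.
  by exists i.
- have le b w : sup (S (rc k b *: w)) <= `|b| * sup (S w).
    apply: ge_sup; first by exists 0; left.
    move=> _ [->|[i ->]]; first by rewrite mulr_ge0 // S_ub //; left.
    have [lA _] := bA i; rewrite (linZ lA) nrmZ sabs_rc ler_wpM2l // S_ub //; right.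
    by exists i.
  have [->|a0] := eqVneq a 0.
    rewrite normr0 mul0r rc0 scale0r; apply/eqP; rewrite eq_le S_ub ?andbT; last by left.
    by have := le 0 0; rewrite normr0 mul0r scaler0.
  apply/eqP; rewrite eq_le le /=.
  have := le a^-1 (rc k a *: v).
  rewrite scalerA -rcM mulVf // rc1 scale1r normfV.
  by rewrite ler_pdivlMl // normr_gt0.
- move=> /(sup_gt (S_sup v).1)[_ [->|[i ->]] cr].
    by exists 1 => // u _; rewrite (lt_le_trans cr) // S_ub //; left.
  have [lA _] := bA i; have [M M0 hM] := bounded_operator_bound (bA i).
  exists ((nrm (A i v) - c) / M); first by rewrite divr_gt0 // subr_gt0.
  move=> u; rewrite ltr_pdivlMr // => uv; apply: (@lt_le_trans _ _ (nrm (A i u))); last first.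
    by rewrite S_ub //; right; exists i.
  have := hM (v - u); rewrite (linB lA) nrmBC (nrmBC v) => h.
  have := nrmB (A i u) (A i u - A i v); rewrite opprB addrC subrK; lra.
exists M => // i v; rewrite (le_trans _ (hM v)) // S_ub //; right; by exists i.
Qed.

End BoundedOperators.

(** * Strongly continuous semigroups and their integrals *)

Section Semigroup.
Context {R : realType} {k : scalar_kind}.
Local Notation K := (scalar_field R k).
Context {V : completeNormedModType K} (S : R -> V -> V) (hS : C0_semigroup S).

Lemma sg_bounded h : 0 <= h -> bounded_operator (S h).
Proof. by case: hS => -[h1 _ _] _; exact: h1. Qed.

Lemma sg_linear h : 0 <= h -> linear (S h).
Proof. by move=> /sg_bounded[]. Qed.

Lemma sg0 v : S 0 v = v.
Proof. by case: hS => -[]. Qed.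

Lemma sgD h l v : 0 <= h -> 0 <= l -> S (h + l) v = S h (S l v).
Proof. by case: hS => -[_ _ h3] _; exact: h3. Qed.

Lemma sg_right_continuous v (e : R) : 0 < e ->
  exists2 r : R, 0 < r & forall h, 0 <= h -> h < r -> nrm (S h v - v) < e.
Proof.
move=> e0; case: hS => _ /(_ v)/cvg_nrmP/(_ e e0)[r /= r0 hr].
exists r => // h; rewrite le_eqVlt => /predU1P[<- _|h0 hlt].
  by rewrite sg0 subrr nrm0.
by apply: hr => //=; rewrite sub0r normrN gtr0_norm.
Qed.

(** Otherwise there are times [h n] tending to 0 at which [S] is not bounded by [n], while strong
    continuity bounds each sequence [S (h n) v]. This contradicts uniform boundedness. *)
Lemma sg_bounded_near0 : exists2 r : R, 0 < r & exists M : R,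
  forall h v, 0 <= h -> h <= r -> nrm (S h v) <= M * nrm v.
Proof.
apply: contrapT => unb.
have {}unb (n : nat) : exists h : R, [/\ 0 <= h, h <= n.+1%:R^-1 &
    exists v, n%:R * nrm v < nrm (S h v)].
  apply: contrapT => hn; apply: unb; exists n.+1%:R^-1; first by rewrite invr_gt0.
  exists n%:R => h v h0 hle; rewrite leNgt; apply/negP => lt.
  by apply: hn; exists h; split => //; exists v.
have [h hh] := choice unb.
have [||M M0 hM] := @uniform_boundedness R k V V nat (fun n => S (h n)).
- by move=> n; apply: sg_bounded; have [] := hh n.
- move=> v; have [r r0 hr] := sg_right_continuous v ltr01.
  pose N := Num.truncn (r^-1).
  (* From index [N.+1] on, [h n < r] and [S (h n) v] is within 1 of [v]; the sum takes care of the
     earlier indices. *)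
  exists (nrm v + 1 + \sum_(i < N.+1) nrm (S (h i) v)) => n.
  have sum_ge0 : 0 <= \sum_(i < N.+1) nrm (S (h i) v).
    by apply: sumr_ge0 => i _; exact: nrm_ge0.
  have [nN|nN] := ltnP n N.+1.
    rewrite (bigD1 (Ordinal nN)) //= addrCA ler_wpDr //.
    by rewrite !addr_ge0 ?nrm_ge0 // sumr_ge0 // => i _; exact: nrm_ge0.
  have [h0 hle _] := hh n.
  have hlt : h n < r.
    apply: (le_lt_trans hle); rewrite invf_plt ?posrE //.
    rewrite (lt_le_trans (truncnS_gt _)) // ler_nat.
    exact: leq_trans nN (leqnSn _).
  have := hr _ h0 hlt; have := nrmD (S (h n) v - v) v; rewrite subrK; lra.
have [_ _ [v hv]] := hh (Num.truncn M).+1.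
have := hM (Num.truncn M).+1 v; apply/negP; rewrite -ltNge (le_lt_trans _ hv) //.
by rewrite ler_wpM2r ?nrm_ge0 // ltW // truncnS_gt.
Qed.

Lemma sg_locally_bounded (a : R) : exists2 M : R, 0 < M &
  forall h v, 0 <= h -> h <= a -> nrm (S h v) <= M * nrm v.
Proof.
have [r r0 [M0 hM0]] := sg_bounded_near0.
(* [M >= 1] makes the powers of [M] increasing, so that one power serves all [h] up to [a]. *)
pose M := Num.max 1 M0; have M1 : 1 <= M by rewrite le_max lexx.
have hM h v : 0 <= h -> h <= r -> nrm (S h v) <= M * nrm v.
  move=> h0 hr; rewrite (le_trans (hM0 h v h0 hr)) // ler_wpM2r ?nrm_ge0 //.
  by rewrite le_max lexx orbT.
have ind n h v : 0 <= h -> h <= n%:R * r -> nrm (S h v) <= M ^+ n * nrm v.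
  elim: n h v => [|n ih] h v h0 hn.
    have -> : h = 0 by apply/eqP; rewrite eq_le h0 andbT (le_trans hn) // mul0r.
    by rewrite sg0 expr0 mul1r.
  have [hr|/ltW rh] := leP h r.
    rewrite (le_trans (hM h v h0 hr)) // ler_wpM2r ?nrm_ge0 //.
    by rewrite exprS ler_peMr ?(le_trans _ M1) // exprn_ege1.
  have hr0 : 0 <= h - r by rewrite subr_ge0.
  have -> : h = r + (h - r) by rewrite addrC subrK.
  rewrite (sgD _ (ltW r0) hr0) (le_trans (hM _ _ (ltW r0) _)) //.
  rewrite exprS -mulrA ler_wpM2l ?(le_trans _ M1) // ih //.
  by rewrite lerBlDr (le_trans hn) // -natr1 mulrDl mul1r.
exists (M ^+ (Num.truncn (a / r)).+1); first by rewrite exprn_gt0 // (lt_le_trans _ M1).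
move=> h v h0 ha; apply: ind => //; apply: (le_trans ha).
by rewrite -ler_pdivrMr // ltW // truncnS_gt.
Qed.

(** For [s <= t], [S s v - S t v = S s (v - S (t - s) v)] carries right continuity at 0 to all of
    [[0, a]], where [S s] is uniformly bounded. *)
Lemma sg_uniformly_continuous (a : R) v (e : R) : 0 < e ->
  exists2 r : R, 0 < r & forall s t, 0 <= s -> s <= a -> 0 <= t -> t <= a ->
    `|s - t| <= r -> nrm (S s v - S t v) <= e.
Proof.
move=> e0; have [M M0 hM] := sg_locally_bounded a.
have [r r0 hr] := sg_right_continuous v (divr_gt0 e0 M0).
exists (r / 2) => [|s t]; first by rewrite divr_gt0.
wlog st : s t / s <= t => [wl|] s0 sa t0 ta str.
  have [st|/ltW st] := leP s t; first exact: wl.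
  by rewrite nrmBC; apply: wl => //; rewrite distrC.
have -> : t = s + (t - s) by rewrite addrC subrK.
have ts : 0 <= t - s by rewrite subr_ge0.
rewrite sgD // -(linB (sg_linear s0)) (le_trans (hM _ _ s0 sa)) //.
rewrite mulrC -ler_pdivlMr // ltW // nrmBC hr //.
by move: str; rewrite distrC ger0_norm //; lra.
Qed.

Definition oscillation_le (a d e : R) (v : V) := forall s t : R,
  0 <= s -> s <= a -> 0 <= t -> t <= a -> `|s - t| <= d -> nrm (S s v - S t v) <= e.

Definition riemann_sum (d : R) (m : nat) (v : V) : V :=
  rc k d *: \sum_(i < m) S (i%:R * d) v.

Lemma riemann_sumD d m l v : 0 <= d ->
  riemann_sum d (m + l) v = riemann_sum d m v + S (m%:R * d) (riemann_sum d l v).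
Proof.
move=> d0; have md : 0 <= m%:R * d by rewrite mulr_ge0.
rewrite /riemann_sum big_split_ord /= scalerDr; congr (_ + _).
rewrite (linZ (sg_linear md)) (lin_sum (sg_linear md)); congr (_ *: _).
by apply: eq_bigr => i _; rewrite natrD mulrDl sgD // mulr_ge0.
Qed.

Lemma riemann_sum_linear d m : 0 <= d -> linear (riemann_sum d m).
Proof.
move=> d0 a u v; rewrite /riemann_sum scalerA mulrC -scalerA -scalerDr; congr (_ *: _).
rewrite scaler_sumr -big_split /=; apply: eq_bigr => i _.
by apply: sg_linear; rewrite mulr_ge0.
Qed.

(** Induction on the cells of length [d]: inside one cell all refined nodes are within [d] of the
    left endpoint, so a cell costs at most [d * e]. *)
Lemma riemann_sum_refine d e m l v : 0 <= d -> oscillation_le (m%:R * d) d e v ->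
  nrm (riemann_sum d m v - riemann_sum (d / l.+1%:R) (m * l.+1) v) <= m%:R * d * e.
Proof.
move=> d0; have l0 : 0 < l.+1%:R :> R by rewrite ltr0n.
elim: m => [|m ih] osc.
  by rewrite mul0n /riemann_sum !big_ord0 !scaler0 subrr nrm0 !mul0r.
have mm : m%:R * d <= m.+1%:R * d by rewrite ler_wpM2r // ler_nat.
have {}ih : nrm (riemann_sum d m v - riemann_sum (d / l.+1%:R) (m * l.+1) v)
    <= m%:R * d * e.
  by apply: ih => s t s0 sm t0 tm; apply: osc => //; exact: le_trans mm.
rewrite mulSn addnC riemann_sumD ?divr_ge0 // -addn1 riemann_sumD //.
rewrite opprD addrACA (le_trans (nrmD _ _)) // natrD !mulrDl lerD // mul1r.
have md : 0 <= m%:R * d by rewrite mulr_ge0.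
have -> : (m * l.+1)%:R * (d / l.+1%:R) = m%:R * d.
  by rewrite natrM; field; rewrite gt_eqF.
have -> : riemann_sum d 1 v = rc k (d / l.+1%:R) *: \sum_(i < l.+1) v.
  rewrite /riemann_sum big_ord1 mul0r sg0 sumr_const card_ord -(scaler_nat _ v) scalerA.
  by rewrite -rcMn -rcM divfK // gt_eqF.
rewrite -(linB (sg_linear md)) -scalerBr (linZ (sg_linear md)) nrmZ sabs_rc.
rewrite ger0_norm ?divr_ge0 // -sumrB (lin_sum (sg_linear md)).
apply: (@le_trans _ _ (d / l.+1%:R * \sum_(i < l.+1) e)).
  rewrite ler_wpM2l ?divr_ge0 // (le_trans (nrm_sum _ _ _)) //.
  apply: ler_sum => i _; have id0 : 0 <= i%:R * (d / l.+1%:R).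
    by rewrite mulr_ge0 // divr_ge0.
  have id1 : i%:R * (d / l.+1%:R) <= d.
    by rewrite mulrCA ler_piMr // ler_pdivrMr // mul1r ler_nat ltnW.
  rewrite (linB (sg_linear md)) -sgD //; apply: osc => //.
  - exact: addr_ge0.
  - by rewrite -(natr1 m) (mulrDl m%:R) mul1r lerD2l.
  - by rewrite opprD addrA subrr sub0r normrN ger0_norm.
rewrite sumr_const card_ord -(mulr_natr e) le_eqVlt; apply/orP; left.
by apply/eqP; field; rewrite gt_eqF.
Qed.

Lemma riemann_sum_bound a M d m v : 0 <= d -> m%:R * d <= a ->
  (forall h, 0 <= h -> h <= a -> nrm (S h v) <= M) ->
  nrm (riemann_sum d m v) <= m%:R * d * M.
Proof.
move=> d0 ma hM; rewrite nrmZ sabs_rc ger0_norm // -mulrA mulrCA ler_wpM2l //.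
rewrite (le_trans (nrm_sum _ _ _)) // mulr_natl -[m in leRHS]card_ord -sumr_const.
apply: ler_sum => i _; apply: hM; first by rewrite mulr_ge0.
by apply: le_trans ma; rewrite ler_wpM2r // ler_nat ltnW.
Qed.

(** The integral of [s |-> S s v] over [[0, t]], from left endpoint sums with [n.+1] equal cells. *)
Definition sg_integral (t : R) (v : V) : V :=
  lim (riemann_sum (t / n.+1%:R) n.+1 v @[n --> \oo]).

Lemma small_step (t r : R) : 0 < r -> exists N : nat, forall n, (N <= n)%N -> t / n.+1%:R <= r.
Proof.
move=> r0; exists (Num.truncn (t / r)).+1 => n Nn.
rewrite ler_pdivrMr // mulrC -ler_pdivrMr // ltW // (lt_le_trans (truncnS_gt _)) //.
by rewrite ler_nat (leq_trans Nn).
Qed.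

Lemma sg_integral_cvg t v : 0 <= t ->
  riemann_sum (t / n.+1%:R) n.+1 v @[n --> \oo] --> sg_integral t v.
Proof.
move=> t0.
suff [w hw] : exists w : V, riemann_sum (t / n.+1%:R) n.+1 v @[n --> \oo] --> w.
  by rewrite /sg_integral (cvg_lim _ hw).
apply: cauchy_nrm_cvg => e e0.
(* Two refinement errors of [t] times this number must stay below [e]; the added 1 covers
   [t = 0]. *)
have e'0 : 0 < e / (2 * t + 1) by rewrite divr_gt0 //; lra.
have [r r0 hr] := sg_uniformly_continuous t v e'0.
have [N hN] := small_step t r0; exists N => m n Nm Nn.
(* Two partitions are compared through their common refinement, whose number of cells is the
   product. *)
have ref p q : (N <= p)%N -> nrm (riemann_sum (t / p.+1%:R) p.+1 v -
    riemann_sum (t / (p.+1 * q.+1)%:R) (p.+1 * q.+1) v) <= t * (e / (2 * t + 1)).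
  move=> Np; have pt : p.+1%:R * (t / p.+1%:R) = t by rewrite mulrC divfK // pnatr_eq0.
  have := @riemann_sum_refine (t / p.+1%:R) (e / (2 * t + 1)) p.+1 q v.
  rewrite divr_ge0 // pt -(mulrA t) -invfM -natrM; apply=> // s s' s0 st s'0 s't ss'.
  by apply: hr => //; rewrite (le_trans ss') // hN.
have := ref m n Nm; have := ref n m Nn; rewrite mulnC nrmBC => h1 h2.
apply: (le_lt_trans (nrm_dist (riemann_sum (t / (m.+1 * n.+1)%:R) (m.+1 * n.+1) v) _ _)).
apply: (le_lt_trans (lerD h2 h1)); rewrite -mulrDl mulrA ltr_pdivrMr; last by lra.
rewrite mulrC ltr_pM2l //; lra.
Qed.

Lemma sg_integral0 v : sg_integral 0 v = 0.
Proof.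
rewrite /sg_integral (_ : (fun n => _) = fun=> 0) ?lim_cst //.
by apply/funext => n; rewrite mul0r /riemann_sum rc0 scale0r.
Qed.

Lemma riemann_sum_approx d e m v : 0 <= d -> oscillation_le (m%:R * d) d e v ->
  nrm (riemann_sum d m v - sg_integral (m%:R * d) v) <= m%:R * d * e.
Proof.
case: m => [|m] d0 osc.
  by rewrite !mul0r sg_integral0 /riemann_sum big_ord0 scaler0 subrr nrm0.
apply/ler_addgt0Pr => e' e'0.
have md : 0 <= m.+1%:R * d by rewrite mulr_ge0.
have [N _ hN] := (cvg_nrmP _ _).1 (@sg_integral_cvg _ v md) e' e'0.
(* Term [q] of the sequence that defines the integral refines the given partition into [m.+1]
   cells. *)
have [q qE] : exists q, q.+1 = (m.+1 * N.+1)%N by exists (m.+1 * N.+1).-1; rewrite prednK.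
have Nq : (N <= q)%N by rewrite -ltnS qE leq_pmull.
have := hN q Nq; rewrite /= qE.
have -> : m.+1%:R * d / (m.+1 * N.+1)%:R = d / N.+1%:R.
  by rewrite natrM -mulf_div divff ?mul1r // pnatr_eq0.
move=> h; rewrite (le_trans (nrm_dist (riemann_sum (d / N.+1%:R) (m.+1 * N.+1) v) _ _)) //.
by rewrite lerD ?(ltW h) //; exact: riemann_sum_refine.
Qed.

Lemma sg_integral_bound t M v : 0 <= t ->
  (forall h, 0 <= h -> h <= t -> nrm (S h v) <= M) ->
  nrm (sg_integral t v) <= t * M.
Proof.
move=> t0 hM; apply/ler_addgt0Pr => e e0.
have [N _ /(_ N (leqnn N)) hN] := (cvg_nrmP _ _).1 (@sg_integral_cvg _ v t0) e e0.
have tN : N.+1%:R * (t / N.+1%:R) = t by rewrite mulrC divfK // pnatr_eq0.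
have := @riemann_sum_bound t M (t / N.+1%:R) N.+1 v; rewrite divr_ge0 // tN.
move=> /(_ isT (lexx _) hM) h.
have := nrm_dist (riemann_sum (t / N.+1%:R) N.+1 v) (sg_integral t v) 0.
by rewrite !subr0 nrmBC; move: hN h => /=; lra.
Qed.

Lemma sg_integral_operator t : 0 <= t -> bounded_operator (sg_integral t).
Proof.
move=> t0; apply/bounded_operatorP; split=> [a u v|].
  have h := @sg_integral_cvg _ (a *: u + v) t0.
  have := cvgD (cvgZl_tmp (k := a) (@sg_integral_cvg _ u t0)) (@sg_integral_cvg _ v t0).
  move=> h'; apply: (nrm_cvg_unique h); apply: (eq_cvg_nrm _ (h' _ _)); near=> n.
  by rewrite /= riemann_sum_linear // divr_ge0.
have [M M0 hM] := sg_locally_bounded t; exists (t * M); first by rewrite mulr_ge0 // ltW.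
move=> v; rewrite -mulrA; apply: sg_integral_bound => // h h0 ht; exact: hM.
Unshelve. all: by end_near. Qed.

Lemma sg_integral_comm (B : V -> V) t v : 0 <= t -> bounded_operator B ->
  (forall h u, 0 <= h -> B (S h u) = S h (B u)) ->
  B (sg_integral t v) = sg_integral t (B v).
Proof.
move=> t0 bB BS; have lB : linear B by case: bB.
apply: (nrm_cvg_unique _ (@sg_integral_cvg _ (B v) t0)).
apply: eq_cvg_nrm _ (bounded_operator_cvg bB (@sg_integral_cvg _ v t0)).
near=> n; rewrite /= /riemann_sum (linZ lB) (lin_sum lB).
by congr (_ *: _); apply: eq_bigr => i _; rewrite BS // mulr_ge0 // divr_ge0.
Unshelve. all: by end_near. Qed.

Lemma sg_integral_near0 v (e : R) : 0 < e -> exists2 r : R, 0 < r &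
  forall h, 0 <= h -> h <= r -> nrm (sg_integral h v - rc k h *: v) <= h * e.
Proof.
move=> e0; have [r r0 hr] := sg_uniformly_continuous 1 v e0.
exists (Num.min 1 r) => [|h h0]; first by rewrite lt_min ltr01.
rewrite le_min => /andP[h1 hr'].
have := @riemann_sum_approx h e 1 v h0; rewrite mul1r nrmBC.
rewrite /riemann_sum big_ord1 mul0r sg0; apply=> s t s0 sh t0 th _.
by apply: hr => //; rewrite ?(le_trans sh) ?(le_trans th) //; case: (leP s t) => _; rewrite ?ler_norml; lra.
Qed.

(** Additivity of the integral is derived from this lemma, so the proof works with sums: those for
    [s] and [t] with the same number of terms are compared term by term. The two step lengths cost
    [|s - t|] times a bound of the orbit, the two sets of nodes cost [t] times an oscillation. *)
Lemma sg_integral_continuous (a : R) v (e : R) : 0 < e ->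
  exists2 r : R, 0 < r & forall s t, 0 <= s -> s <= a -> 0 <= t -> t <= a ->
    `|s - t| <= r -> nrm (sg_integral s v - sg_integral t v) <= e.
Proof.
move=> e0; have [M M0 hM] := sg_locally_bounded a.
have [|r r0 hr] := @sg_uniformly_continuous a v (e / 2 / (`|a| + 1)).
  by rewrite !divr_gt0 // ltr_wpDl.
have Mv : 0 < M * nrm v + 1 by rewrite ltr_wpDl // mulr_ge0 ?nrm_ge0 // ltW.
pose r' := Num.min r (e / 2 / (M * nrm v + 1)).
exists r' => [|s t s0 sa t0 ta]; first by rewrite lt_min r0 !divr_gt0.
rewrite le_min => /andP[st1 st2]; apply/ler_addgt0Pr => e' e'0.
have e'2 : 0 < e' / 2 by rewrite divr_gt0.
have [N1 _ h1] := (cvg_nrmP _ _).1 (@sg_integral_cvg _ v s0) _ e'2.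
have [N2 _ h2] := (cvg_nrmP _ _).1 (@sg_integral_cvg _ v t0) _ e'2.
pose n := maxn N1 N2.
have {}h1 := h1 n (leq_maxl _ _); have {}h2 := h2 n (leq_maxr _ _).
move: h1 h2 => /=; rewrite -/n.
set x := riemann_sum _ _ _; set y := riemann_sum _ _ _ => h1 h2.
suff : nrm (x - y) <= e.
  have := nrm_dist x (sg_integral s v) (sg_integral t v).
  have := nrm_dist y x (sg_integral t v).
  by rewrite (nrmBC _ x); lra.
have in_a z i : 0 <= z -> z <= a -> (i < n.+1)%N -> 0 <= i%:R * (z / n.+1%:R) <= a.
  move=> z0 za ni; rewrite mulr_ge0 ?divr_ge0 //= mulrCA (le_trans _ za) //.
  by rewrite ler_piMr // ler_pdivrMr // mul1r ler_nat ltnW.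
have -> : x - y = rc k ((s - t) / n.+1%:R) *: \sum_(i < n.+1) S (i%:R * (s / n.+1%:R)) v
    + rc k (t / n.+1%:R) *: \sum_(i < n.+1) (S (i%:R * (s / n.+1%:R)) v
       - S (i%:R * (t / n.+1%:R)) v).
  rewrite sumrB scalerBr addrA -scalerDl -rcD /x /y /riemann_sum.
  by congr (rc k _ *: _ - _); rewrite -mulrDl subrK.
have sumle (f : 'I_n.+1 -> V) c : (forall i, nrm (f i) <= c) ->
    nrm (\sum_i f i) <= n.+1%:R * c.
  move=> hf; rewrite (le_trans (nrm_sum _ _ _)) // mulr_natl.
  by rewrite -[n.+1 in leRHS]card_ord -sumr_const; apply: ler_sum => i _.
have n0 : n.+1%:R != 0 :> R by rewrite pnatr_eq0.
rewrite (le_trans (nrmD _ _)) // [e]splitr lerD //.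
  rewrite nrmZ sabs_rc normrM normfV (@ger0_norm _ n.+1%:R) //.
  rewrite (@le_trans _ _ (`|s - t| / n.+1%:R * (n.+1%:R * (M * nrm v)))) //.
    rewrite ler_wpM2l ?divr_ge0 //; apply: sumle => i.
    by have /andP[? ?] := in_a s i s0 sa (ltn_ord i); exact: hM.
  rewrite (mulrA _ n.+1%:R) divfK //; move: st2; rewrite ler_pdivlMr //; have := normr_ge0 (s - t); lra.
rewrite nrmZ sabs_rc ger0_norm ?divr_ge0 //.
rewrite (@le_trans _ _ (t / n.+1%:R * (n.+1%:R * (e / 2 / (`|a| + 1))))) //.
  rewrite ler_wpM2l ?divr_ge0 //; apply: sumle => i.
  have /andP[? ?] := in_a s i s0 sa (ltn_ord i).
  have /andP[? ?] := in_a t i t0 ta (ltn_ord i).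
  apply: hr => //; rewrite -mulrBr -mulrBl normrM ger0_norm // normrM.
  rewrite (@ger0_norm _ (_^-1)) ?invr_ge0 // mulrCA (le_trans _ st1) //.
  by rewrite ler_piMr // ler_pdivrMr // mul1r ler_nat ltnW // ltn_ord.
rewrite (mulrA _ n.+1%:R) divfK // mulrA ler_pdivrMr ?ltr_wpDl // mulrC ler_pM2l ?divr_gt0 //.
by rewrite (le_trans ta) // (le_trans (ler_norm a)) // lerDl.
Qed.

End Semigroup.

(** * The generator and its domain *)

Section Generator.
Context {R : realType} {k : scalar_kind}.
Local Notation K := (scalar_field R k).

(** The difference quotient multiplied by [h], a form in which estimates add up without scalar
    inverses. *)
Lemma generatorP {V : normedModType K} (S : R -> V -> V) (v g : V) :
  generator S v g <-> forall e : R, 0 < e -> exists2 r : R, 0 < r &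
    forall h : R, 0 < h -> h < r -> nrm (S h v - v - rc k h *: g) <= h * e.
Proof.
have key (h : R) : 0 < h -> nrm (S h v - v - rc k h *: g) =
    h * nrm ((mk_scalar k h 0)^-1 *: (S h v - v) - g).
  move=> h0; have hE : h = sabs (rc k h) by rewrite sabs_rc gtr0_norm.
  rewrite [X in _ = X * _]hE -nrmZ scalerBr scalerA divff ?scale1r //.
  by rewrite -/(rc k h) rc_eq0 gt_eqF.
rewrite /generator cvg_nrmP; split=> hg e e0.
  have [r /= r0 hr] := hg e e0; exists r => // h h0 hlt.
  by rewrite key // ler_pM2l // ltW // hr //=; rewrite distrC subr0 gtr0_norm.
have [r r0 hr] := hg (e / 2) (divr_gt0 e0 (ltr0Sn _ 1)).
exists r => // h /=; rewrite distrC subr0 => hlt h0.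
rewrite gtr0_norm // in hlt.
by have := hr h h0 hlt; rewrite key // ler_pM2l //; lra.
Qed.

Lemma generator_unique {V : normedModType K} (S : R -> V -> V) (v g g' : V) :
  generator S v g -> generator S v g' -> g = g'.
Proof. exact: nrm_cvg_unique. Qed.

Lemma generator_linear {V : normedModType K} (S : R -> V -> V) (a : K) (u v g g' : V) :
  (forall h, 0 <= h -> linear (S h)) ->
  generator S u g -> generator S v g' -> generator S (a *: u + v) (a *: g + g').
Proof.
move=> lS hu hv; rewrite /generator.
apply: (eq_cvg_nrm _ (cvgD (cvgZl_tmp (k := a) hu) hv)); near=> h.
rewrite lS; last by near: h; exact: nbhs_right_ge.
by rewrite opprD addrACA -scalerBr scalerDr scalerA mulrC -scalerA.
Unshelve. all: by end_near. Qed.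

End Generator.

Section SemigroupIntegral.
Context {R : realType} {k : scalar_kind}.
Local Notation K := (scalar_field R k).
Context {V : completeNormedModType K} (S : R -> V -> V) (hS : C0_semigroup S).
Local Notation I := (sg_integral S).

Lemma grid_approx (d t : R) : 0 < d -> 0 <= t ->
  exists m : nat, m%:R * d <= t /\ `|t - m%:R * d| <= d.
Proof.
move=> d0 t0; exists (Num.truncn (t / d)).
have td : 0 <= t / d by rewrite divr_ge0 // ltW.
have h1 : (Num.truncn (t / d))%:R * d <= t by rewrite -ler_pdivlMr // truncn_le.
split=> //; rewrite ger0_norm ?subr_ge0 // lerBlDl -[X in _ + X]mul1r -mulrDl natr1.
by rewrite -ler_pdivrMr // ltW // truncnS_gt.
Qed.

(** For multiples of a common step this is the concatenation [riemann_sumD]; [t] and [h] are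
    approximated from below by such multiples. *)
Lemma sg_integralD t h v : 0 <= t -> 0 <= h -> I (t + h) v = I t v + S t (I h v).
Proof.
move=> t0 h0; pose a := t + h + 1; apply/eqP; rewrite -subr_eq0; apply/eqP.
have [M M0 hM] := sg_locally_bounded hS a.
(* The sum of the bounds [b1], [b2], [b3], [b4] and [b6] below, divided by [e]. *)
apply: (@nrm_small_le _ _ _ _ (3 + M + 2 * a + M * a)) => e e0.
have [r1 r10 hr1] := sg_uniformly_continuous hS a v e0.
have [r2 r20 hr2] := sg_integral_continuous hS a v e0.
have [r3 r30 hr3] := sg_uniformly_continuous hS a (I h v) e0.
pose r := Num.min r1 (Num.min r2 r3).
have rr : [/\ r <= r1, r <= r2 & r <= r3] by split; rewrite /r !ge_min lexx ?orbT.
have r0 : 0 < r by rewrite !lt_min r10 r20.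
have [rr1 rr2 rr3] := rr.
pose d := r / 2; have d0 : 0 < d by rewrite divr_gt0.
have [m [mt mt']] := grid_approx d0 t0; have [l [lh lh']] := grid_approx d0 h0.
have md0 : 0 <= m%:R * d by rewrite mulr_ge0 // ltW.
have ld0 : 0 <= l%:R * d by rewrite mulr_ge0 // ltW.
have mla : m%:R * d <= a by rewrite /a; lra.
have lla : l%:R * d <= a by rewrite /a; lra.
have dr : d <= r by rewrite /d; lra.
have osc (q : nat) : q%:R * d <= a -> oscillation_le S (q%:R * d) d e v.
  move=> qa s s' s0 sq s'0 sq' ss'; apply: hr1 => //.
  - exact: le_trans qa.
  - exact: le_trans qa.
  - by rewrite (le_trans ss') // (le_trans dr).
have b1 : nrm (I (t + h) v - I ((m + l)%:R * d) v) <= e.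
  rewrite natrD mulrDl; apply: hr2 => //; rewrite ?addr_ge0 //; rewrite /a; try lra.
  rewrite opprD addrACA (le_trans (ler_normD _ _)) //.
  apply: le_trans rr2; move: mt' lh'; rewrite /d; lra.
have b2 : nrm (I ((m + l)%:R * d) v - riemann_sum S d (m + l) v) <= a * e.
  have ml : (m + l)%:R * d <= a by rewrite natrD mulrDl /a; lra.
  rewrite nrmBC (le_trans (riemann_sum_approx hS (ltW d0) (osc _ ml))) //.
  by rewrite ler_wpM2r // ltW.
have b3 : nrm (riemann_sum S d m v - I (m%:R * d) v) <= a * e.
  rewrite (le_trans (riemann_sum_approx hS (ltW d0) (osc _ mla))) //.
  by rewrite ler_wpM2r // ltW.
have b4 : nrm (I (m%:R * d) v - I t v) <= e.
  apply: hr2 => //; rewrite ?/a; try lra.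
  by rewrite distrC (le_trans mt') // (le_trans dr).
have b5 : nrm (riemann_sum S d l v - I h v) <= (a + 1) * e.
  rewrite mulrDl mul1r (le_trans (nrm_dist (I (l%:R * d) v) _ _)) // lerD //.
    rewrite (le_trans (riemann_sum_approx hS (ltW d0) (osc _ lla))) //.
    by rewrite ler_wpM2r // ltW.
  apply: hr2 => //; rewrite ?/a; try lra.
  by rewrite distrC (le_trans lh') // (le_trans dr).
have b6 : nrm (S (m%:R * d) (riemann_sum S d l v) - S t (I h v)) <= M * ((a + 1) * e) + e.
  rewrite (le_trans (nrm_dist (S (m%:R * d) (I h v)) _ _)) // lerD //.
    rewrite -(linB (sg_linear hS md0)) (le_trans (hM _ _ md0 mla)) //.
    by rewrite ler_wpM2l // ltW.
  apply: hr3 => //; rewrite ?/a; try lra.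
  by rewrite distrC (le_trans mt') // (le_trans dr).
rewrite (riemann_sumD hS m l v (ltW d0)) in b2.
set x := I (t + h) v in b1 *; set y := I _ v in b1 b2; set z := riemann_sum S d m v in b2 b3.
set z' := S _ _ in b2 b6; set w := I _ v in b3 b4; set u := I t v in b4 *.
set w' := S t _ in b6 *.
have -> : x - (u + w') = (x - y) + (y - (z + z')) + ((z - w) + (w - u)) + (z' - w').
  rewrite (subrKA y x) (subrKA w z) !opprD !addrA (addrAC (x - z)) subrK.
  by rewrite (addrAC (x - z')) subrK.
have n1 := nrmD ((x - y) + (y - (z + z')) + ((z - w) + (w - u))) (z' - w').
have n2 := nrmD ((x - y) + (y - (z + z'))) ((z - w) + (w - u)).
have n3 := nrmD (x - y) (y - (z + z')).
have n4 := nrmD (z - w) (w - u).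
lra.
Qed.
End SemigroupIntegral.

Section GeneratorTheory.
Context {R : realType} {k : scalar_kind}.
Local Notation K := (scalar_field R k).
Context {V : completeNormedModType K} (S : R -> V -> V) (hS : C0_semigroup S).
Local Notation I := (sg_integral S).

Lemma generator_comm (B : V -> V) v g : bounded_operator B ->
  (forall h u, 0 <= h -> B (S h u) = S h (B u)) ->
  generator S v g -> generator S (B v) (B g).
Proof.
move=> bB BS hv; have lB : linear B by case: bB.
rewrite /generator; apply: (eq_cvg_nrm _ (bounded_operator_cvg bB hv)); near=> h.
rewrite (linZ lB) (linB lB) BS //; near: h; exact: nbhs_right_ge.
Unshelve. all: by end_near. Qed.

Lemma sg_comm h l v : 0 <= h -> 0 <= l -> S h (S l v) = S l (S h v).
Proof. by move=> h0 l0; rewrite -!sgD // addrC. Qed.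

Lemma generator_sg t v g : 0 <= t -> generator S v g -> generator S (S t v) (S t g).
Proof.
by move=> t0; apply: generator_comm; [exact: sg_bounded|move=> *; exact: sg_comm].
Qed.

Lemma sg_integral_sg h t v : 0 <= h -> 0 <= t -> S h (I t v) = I t (S h v).
Proof.
by move=> h0 t0; apply: sg_integral_comm => //; [exact: sg_bounded|move=> *; exact: sg_comm].
Qed.

(** Splitting the integral over [[0, t + h]] at [t] and at [h] gives [S h (I t v) - I t v = S t (I h
    v) - I h v], and [I h v] is [h] times [v] up to a small multiple of [h]. *)
Lemma generator_sg_integral t v : 0 <= t -> generator S (I t v) (S t v - v).
Proof.
move=> t0; apply/generatorP => e e0.
have [M M0 hM] := sg_locally_bounded hS t.
have M1 : 0 < M + 1 by rewrite addr_gt0.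
have [r r0 hr] := sg_integral_near0 hS v (divr_gt0 e0 M1).
exists r => // h h0 hlt.
have lt := sg_linear hS t0; have h0' := ltW h0.
have -> : S h (I t v) - I t v = S t (I h v) - I h v.
  apply/eqP; rewrite subr_eq addrAC eq_sym subr_eq; apply/eqP.
  by rewrite [LHS]addrC -(sg_integralD hS) // [RHS]addrC -(sg_integralD hS) // addrC.
have -> : S t (I h v) - I h v - rc k h *: (S t v - v) =
    S t (I h v - rc k h *: v) - (I h v - rc k h *: v).
  rewrite (linB lt) (linZ lt) scalerBr !opprD !opprK !addrA.
  by congr (_ + _); rewrite addrAC.
have hh := hr h h0' (ltW hlt).
rewrite (le_trans (nrmB _ _)) //.
have := hM t (I h v - rc k h *: v) t0 (lexx _).
have -> : h * e = (M + 1) * (h * (e / (M + 1))) by field; rewrite gt_eqF.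
have : M * nrm (I h v - rc k h *: v) <= M * (h * (e / (M + 1))) by rewrite ler_pM2l.
lra.
Qed.

(** [I t] commutes with the semigroup, so both sides are the generator at [I t v]. *)
Lemma sg_integral_generator t v g : 0 <= t -> generator S v g -> I t g = S t v - v.
Proof.
move=> t0 hv; have h := @generator_sg_integral t v t0.
suff h' : generator S (I t v) (I t g) by exact: (generator_unique h' h).
apply: generator_comm hv; first exact: sg_integral_operator.
by move=> l u l0; rewrite sg_integral_sg.
Qed.

Lemma generator_domain_subspace : is_subspace (generator_domain S).
Proof.
have lS h : 0 <= h -> linear (S h) by exact: sg_linear.
have h0 : generator S 0 0.
  apply/generatorP => e e0; exists 1 => // h hp _.
  by rewrite (lin0 (lS h (ltW hp))) scaler0 !subrr nrm0 mulr_ge0 // ltW.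
split; first by exists 0.
by move=> a u v [g hu] [g' hv]; exists (a *: g + g'); exact: generator_linear.
Qed.

(** The averages of the orbit over [[0, r]] lie in the domain and tend to [v]. *)
Lemma generator_domain_dense v (e : R) : 0 < e ->
  exists2 u, generator_domain S u & nrm (u - v) < e.
Proof.
move=> e0; have e20 : 0 < e / 2 by rewrite divr_gt0.
have [r r0 hr] := sg_integral_near0 hS v e20.
exists (rc k r^-1 *: I r v).
  have [D0 DZ] := generator_domain_subspace; rewrite -[_ *: _]addr0; apply: DZ => //.
  by exists (S r v - v); apply: generator_sg_integral; exact: ltW.
have := hr r (ltW r0) (lexx _) => {}hr.
have -> : rc k r^-1 *: I r v - v = rc k r^-1 *: (I r v - rc k r *: v).
  by rewrite scalerBr scalerA -rcM mulVf ?gt_eqF // rc1 scale1r.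
rewrite nrmZ sabs_rc gtr0_norm ?invr_gt0 // mulrC ltr_pdivrMr // mulrC.
by rewrite (le_lt_trans hr) // ltr_pM2l //; lra.
Qed.

(** Right differentiability of the integral, uniform in the base point, in the form that [real_FTC]
    takes as a hypothesis. *)
Lemma sg_integral_estimate (a : R) v (e : R) : 0 < e ->
  exists2 r : R, 0 < r & forall s t, 0 <= s -> s <= t -> t <= a -> t - s <= r ->
    nrm (I t v - I s v - rc k (t - s) *: S s v) <= (t - s) * e.
Proof.
move=> e0; have [M M0 hM] := sg_locally_bounded hS a.
have [r r0 hr] := sg_integral_near0 hS v (divr_gt0 e0 M0).
exists r => // s t s0 st ta str.
have ts0 : 0 <= t - s by rewrite subr_ge0.
have -> : I t v - I s v = S s (I (t - s) v).
  have {1}-> : t = s + (t - s) by rewrite addrC subrK.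
  by rewrite (sg_integralD hS) // addrAC subrr add0r.
rewrite -(linZ (sg_linear hS s0)) -(linB (sg_linear hS s0)).
rewrite (le_trans (hM _ _ s0 (le_trans st ta))) //.
have -> : (t - s) * e = M * ((t - s) * (e / M)) by field; rewrite gt_eqF.
by rewrite ler_pM2l // hr.
Qed.

End GeneratorTheory.

(** * Neumann series *)

Section Neumann.
Context {R : realType} {k : scalar_kind}.
Local Notation K := (scalar_field R k).
Context {V : completeNormedModType K}.

Lemma neumann (N : V -> V) : linear N -> (forall v, nrm (N v) <= 2^-1 * nrm v) ->
  exists Z : V -> V, [/\ bounded_operator Z, forall y, Z y - N (Z y) = y &
    forall y, Z (y - N y) = y].
Proof.
move=> lN hN.
have inj x : x - N x = 0 -> x = 0.
  move=> /eqP; rewrite subr_eq0 => /eqP xN; apply: nrm_eq0.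
  by have := hN x; rewrite -xN; have := nrm_ge0 x; lra.
have lb x : nrm x <= 2 * nrm (x - N x).
  have := nrmD (x - N x) (N x); rewrite subrK; have := hN x; lra.
have sur y : exists x, x - N x = y.
  (* [u n] is the sum of the iterates of [N] at [y] of order below [n]. *)
  pose u := fix u n := if n is m.+1 then y + N (u m) else 0.
  have du n : nrm (u n.+1 - u n) <= 2^-1 ^+ n * nrm y.
    elim: n => [|n ih]; first by rewrite expr0 mul1r /= (lin0 lN) addr0 subr0.
    rewrite [u n.+2]/= [u n.+1 in X in _ - X]/= opprD addrACA subrr add0r -(linB lN).
    by rewrite (le_trans (hN _)) // exprS -mulrA ler_wpM2l.
  (* The geometric tail is kept as a difference, so that the induction on [m] telescopes. *)
  have dist n m : nrm (u (n + m)%N - u n) <= 2 * 2^-1 ^+ n * nrm y - 2 * 2^-1 ^+ (n + m) * nrm y.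
    elim: m => [|m ih]; first by rewrite addn0 subrr nrm0 subrr.
    rewrite addnS (le_trans (nrm_dist (u (n + m)%N) _ _)) //.
    by have := du (n + m)%N; rewrite exprS; lra.
  have dist' n m : (n <= m)%N -> nrm (u m - u n) <= 2 * 2^-1 ^+ n * nrm y.
    move=> nm; have := dist n (m - n)%N; rewrite subnKC // => h.
    rewrite (le_trans h) // lerBlDr lerDl !mulr_ge0 ?nrm_ge0 // exprn_ge0 //.
  have [e e0|x ux] := @cauchy_nrm_cvg _ _ _ u.
    have e4 : 0 < e / (4 * nrm y + 1).
      by rewrite divr_gt0 // ltr_wpDl // mulr_ge0 // nrm_ge0.
    have : `|2^-1 : R| < 1 by rewrite ger0_norm; lra.
    move=> /cvg_expr/cvgrPdistC_lt/(_ _ e4)[N' _ /(_ N' (leqnn N'))] /=.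
    rewrite subr0 ger0_norm ?exprn_ge0 // ltr_pdivlMr ?ltr_wpDl ?mulr_ge0 ?nrm_ge0 // => hN'.
    exists N' => m n Nm Nn; have := dist' _ _ Nm; have := dist' _ _ Nn.
    have := nrm_dist (u N') (u m) (u n); rewrite (nrmBC (u N')).
    have : 0 < 2^-1 ^+ N' :> R by rewrite exprn_gt0.
    move: hN'; rewrite mulrDr mulr1; lra.
  exists x; have bN : bounded_operator N.
    by apply/bounded_operatorP; split=> //; exists 2^-1.
  have h1 : u n.+1 @[n --> \oo] --> x by rewrite (cvg_shiftS u).
  have h2 : u n.+1 @[n --> \oo] --> y + N x.
    by apply: cvgD; [exact: cvg_cst|exact: bounded_operator_cvg ux].
  by rewrite {1}(nrm_cvg_unique h1 h2) addrK.
have [Z hZ] := choice sur.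
have hZ' y : Z (y - N y) = y.
  apply/eqP; rewrite -subr_eq0; apply/eqP/inj; rewrite (linB lN).
  by rewrite opprD addrACA hZ -opprD subrr.
exists Z; split => //; apply/bounded_operatorP; split.
  move=> a u v; rewrite -[RHS]hZ'; congr Z.
  by rewrite lN opprD addrACA -scalerBr !hZ.
by exists 2 => // v; rewrite -{2}(hZ v) lb.
Qed.

End Neumann.

(** * The resolvent *)

Section Resolvent.
Context {R : realType} {k : scalar_kind}.
Local Notation K := (scalar_field R k).

(** The upper bound comes from [expR x * (1 - x) <= 1], which is the tangent inequality at [- x]
    multiplied by [expR x]. *)
Lemma expR_tangent (e : R) : 0 < e -> exists2 r : R, 0 < r &
  forall x : R, 0 <= x -> x < r -> `|expR x - 1 - x| <= x * e.
Proof.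
move=> e0; exists (Num.min 2^-1 (e / 2)); first by rewrite lt_min invr_gt0 ltr0n divr_gt0.
move=> x x0; rewrite lt_min => /andP[x1 xe].
have h1 := expR_ge1Dx x; have h2 := expR_ge1Dx (- x).
have h3 : expR x * expR (- x) = 1 by rewrite -expRD subrr expR0.
have h4 := ler_wpM2l (expR_ge0 x) h2; rewrite h3 in h4.
rewrite ger0_norm; last by rewrite -addrA -opprD subr_ge0.
have h5 : expR x <= 2 by nra.
nra.
Qed.

Context {V : completeNormedModType K} (S : R -> V -> V) (hS : C0_semigroup S).

Definition scaled_semigroup (l : R) (h : R) (v : V) : V := rc k (expR (- (l * h))) *: S h v.

Lemma scaled_semigroup_C0 l : 0 <= l -> C0_semigroup (scaled_semigroup l).
Proof.
move=> l0; split; first split.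
- by move=> h h0; apply: bounded_operatorZ; exact: sg_bounded.
- by move=> v; rewrite /scaled_semigroup mulr0 oppr0 expR0 rc1 scale1r (sg0 hS).
- move=> h h' v h0 h'0; rewrite /scaled_semigroup mulrDr opprD expRD rcM -scalerA.
  by rewrite (sgD hS) // (linZ (sg_linear hS h0)).
move=> v; have /cvg_nrm0P hv := hS.2 v.
apply: (@cvg_nrm_le _ _ _ _ _ _ _ _ (fun h => nrm (S h v - v) + l * nrm v * h)).
  near=> h; have h0 : 0 <= h by near: h; exact: nbhs_right_ge.
  have lh0 : 0 <= l * h by rewrite mulr_ge0.
  rewrite /scaled_semigroup (_ : _ - v = rc k (expR (- (l * h))) *: (S h v - v) +
    (rc k (expR (- (l * h)) - 1)) *: v); last first.
    by rewrite rcB rc1 scalerBl scale1r scalerBr addrA subrK.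
  have E1 : expR (- (l * h)) <= 1 by rewrite -(@expR0 R) ler_expR oppr_le0.
  rewrite (le_trans (nrmD _ _)) // !nrmZ !sabs_rc lerD //.
    by rewrite ger0_norm ?expR_ge0 // ler_piMl ?nrm_ge0.
  rewrite mulrAC ler_wpM2r ?nrm_ge0 // ler0_norm ?subr_le0 //.
  by have := expR_ge1Dx (- (l * h)); lra.
rewrite -[X in _ --> X](addr0 0); apply: cvgD => //.
rewrite -[X in _ --> X](mulr0 (l * nrm v)); apply: cvgM; first exact: cvg_cst.
by apply: cvg_at_right_filter; exact: cvg_id.
Unshelve. all: by end_near. Qed.

Lemma generator_scaled l v g : 0 < l ->
  generator (scaled_semigroup l) v g -> generator S v (g + rc k l *: v).
Proof.
move=> l0 /generatorP hg; apply/generatorP => e e0.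
(* One summand for each error term below, with [E = expR (l * h)]: [E <= 2], then [E - 1 <= e / c]
   against [g], then the tangent error of [E] against [v]. *)
pose c := 2 + nrm g + nrm v * l; have c0 : 0 < c.
  by rewrite /c ltr_wpDr ?mulr_ge0 ?nrm_ge0 ?(ltW l0) // ltr_wpDr ?nrm_ge0.
have ec : 0 < e / c by rewrite divr_gt0.
have [r1 r10 h1] := hg _ ec.
have [r2 r20 h2] := expR_tangent ec.
have [r3 r30 h3] := expR_tangent ltr01.
pose r := Num.min r1 (Num.min (r2 / l) (Num.min (r3 / l) (Num.min 1 (e / c) / (2 * l)))).
exists r => [|h h0]; first by rewrite !lt_min r10 !divr_gt0 // ?lt_min ?ltr01 ?ec ?mulr_gt0.
rewrite !lt_min => /and4P[hr1 hr2 hr3 hr4].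
move: hr2 hr3 hr4; rewrite !ltr_pdivlMr ?mulr_gt0 // lt_min => hr2 hr3 /andP[hr4 hr5].
have lh0 : 0 < l * h by rewrite mulr_gt0.
rewrite [h * l]mulrC in hr2 hr3.
have b1 := h1 h h0 hr1; have b2 := h2 _ (ltW lh0) hr2; have b3 := h3 _ (ltW lh0) hr3.
pose E := expR (l * h); have E1 : 1 <= E by rewrite -(@expR0 R) ler_expR ltW.
have E2 : E <= 2 by move: b3; rewrite ler_norml -/E; lra.
have E3 : E - 1 <= e / c by move: b3; rewrite ler_norml -/E; lra.
have SE : S h v = rc k E *: scaled_semigroup l h v.
  rewrite /scaled_semigroup scalerA -rcM /E -expRD subrr expR0 rc1 scale1r //.
rewrite (_ : _ - _ - _ = rc k E *: (scaled_semigroup l h v - v - rc k h *: g) +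
   (rc k ((E - 1) * h) *: g + rc k (E - 1 - l * h) *: v)); last first.
  rewrite !scalerBr !scalerDr -SE !scalerA opprD !addrA.
  rewrite [LHS](ACl (1*(2*4)*3)%AC) [RHS](ACl (1*(2*5)*(3*4))%AC) /=.
  rewrite -[- v in LHS]scaleN1r -!(scaleNr _ v) -!(scaleNr _ g) -!(scalerDl v) -!(scalerDl g).
  congr (_ + _ + _); congr (_ *: _).
    by rewrite !rcB rc1 !rcM; ring.
  by rewrite !rcM rcB rc1; ring.
have := nrmD (rc k E *: (scaled_semigroup l h v - v - rc k h *: g))
   (rc k ((E - 1) * h) *: g + rc k (E - 1 - l * h) *: v).
have := nrmD (rc k ((E - 1) * h) *: g) (rc k (E - 1 - l * h) *: v).
rewrite !nrmZ !sabs_rc (@ger0_norm _ E) ?expR_ge0 // (@ger0_norm _ (_ * h)); last first.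
  by rewrite mulr_ge0 ?(ltW h0) // subr_ge0.
have a1 : E * nrm (scaled_semigroup l h v - v - rc k h *: g) <= 2 * (h * (e / c)).
  by apply: ler_pM => //; rewrite ?nrm_ge0 // expR_ge0.
have a2 : (E - 1) * h * nrm g <= e / c * h * nrm g.
  by rewrite !ler_wpM2r ?nrm_ge0 // ltW.
have a3 : `|E - 1 - l * h| * nrm v <= l * h * (e / c) * nrm v by rewrite ler_wpM2r ?nrm_ge0.
have -> : h * e = 2 * (h * (e / c)) + e / c * h * nrm g + l * h * (e / c) * nrm v.
  by rewrite /c; field; rewrite gt_eqF.
lra.
Qed.

(** The generator of the rescaled semigroup [S'] maps the integral of [S'] over [[0, 1]] at [Z v] to
    [S' 1 (Z v) - Z v = - v]. The last clause, applied to the operators [S h], shows that the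
    resolvent commutes with the generator, and so is a left inverse as well. *)
Lemma resolvent_exists : exists (l : R) (Q : V -> V), [/\ bounded_operator Q,
  forall v, generator S (Q v) (rc k l *: Q v - v),
  forall v g, generator S v g -> Q (rc k l *: v - g) = v &
  forall B, bounded_operator B -> (forall h v, 0 <= h -> B (S h v) = S h (B v)) ->
    forall v, B (Q v) = Q (B v)].
Proof.
have [M M0 hM] := bounded_operator_bound (sg_bounded hS ler01).
(* [expR (2 * M) >= 2 * M], so [S' 1] is bounded by [M / expR (2 * M) <= 1 / 2]. *)
pose l := 2 * M; have l0 : 0 < l by rewrite mulr_gt0.
pose S' := scaled_semigroup l; have hS' : C0_semigroup S' := scaled_semigroup_C0 (ltW l0).
have [|v|Z [bZ Z1 Z2]] := @neumann _ _ _ (S' 1).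
- exact: sg_linear hS' _ ler01.
- rewrite nrmZ sabs_rc gtr0_norm ?expR_gt0 // mulr1 expRN.
  apply: (@le_trans _ _ ((expR l)^-1 * (M * nrm v))).
    by rewrite ler_wpM2l ?invr_ge0 ?expR_ge0.
  rewrite mulrA ler_wpM2r ?nrm_ge0 // ler_pdivrMl ?expR_gt0 //.
  by rewrite ler_pdivlMr // mulrC (le_trans _ (expR_ge1Dx _)) // lerDr.
have bI := sg_integral_operator hS' ler01.
pose I := sg_integral S' 1.
exists l, (I \o Z).
have bQ : bounded_operator (I \o Z) by exact: bounded_operator_comp.
have gQ v : generator S ((I \o Z) v) (rc k l *: (I \o Z) v - v).
  have := @generator_sg_integral _ _ _ _ hS' 1 (Z v) ler01 => /(generator_scaled l0).
  by rewrite -opprB Z1 addrC.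
have comm B : bounded_operator B -> (forall h v, 0 <= h -> B (S h v) = S h (B v)) ->
    forall v, B ((I \o Z) v) = (I \o Z) (B v).
  move=> bB BS v; have lB : linear B by case: bB.
  have BS' h u : 0 <= h -> B (S' h u) = S' h (B u).
    by move=> h0; rewrite /S' /scaled_semigroup (linZ lB) BS.
  rewrite /= /I (sg_integral_comm hS' (B := B)) //; congr sg_integral.
  by rewrite -[LHS]Z2 -(BS' _ _ ler01) -(linB lB) Z1.
split=> // v g hv.
have lQ : linear (I \o Z) by case: bQ.
have h1 := generator_comm bQ (fun h u h0 => esym (comm _ (sg_bounded hS h0) (fun l v l0 => sg_comm hS v h0 l0) u)) hv.
by rewrite (linB lQ) (linZ lQ) (generator_unique h1 (gQ v)) opprB addrC subrK.
Qed.

End Resolvent.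

(** * Splitting off the constants *)

Section ScalarComplete.
Context {R : realType} {k : scalar_kind}.
Local Notation K := (scalar_field R k).

(** For a variable [k] completeness is drawn from that of [R], for the real and the imaginary part
    in turn. *)
Lemma scalar_complete (u : nat -> K) :
  (forall e : R, 0 < e -> exists N, forall m n, (N <= m)%N -> (N <= n)%N ->
     sabs (u m - u n) < e) ->
  exists c : K, forall e : R, 0 < e -> exists N, forall n, (N <= n)%N -> sabs (u n - c) < e.
Proof.
move=> hu.
have real_complete (f : K -> R) : (forall x y, f (x - y) = f x - f y) ->
    (forall x, `|f x| <= sabs x) ->
    exists c : R, forall e : R, 0 < e -> exists N, forall n, (N <= n)%N -> `|f (u n) - c| < e.
  move=> fB fle; have [e e0|c hc] := @cauchy_nrm_cvg R RealScalars R^o (f \o u).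
    have [N hN] := hu e e0; exists N => m n Nm Nn.
    by rewrite /nrm /= -fB; apply: (le_lt_trans (fle _)); exact: hN.
  exists c => e e0; have [N _ hN] := (cvg_nrmP _ _).1 hc e e0.
  by exists N => n Nn; exact: hN n Nn.
have [a ha] := real_complete sRe sReB sRe_le_sabs.
have [b hb] := real_complete sIm sImB sIm_le_sabs.
have mk x : sabs (x - mk_scalar k a b) <= `|sRe x - a| + `|sIm x - b|.
  rewrite (le_trans (sabs_le_ReIm _)) // sReB sImB lerD //.
    by case: k x => // -[x y].
  by case: k x => [x|[x y]] //=; rewrite subrr normr0.
exists (mk_scalar k a b) => e e0; have e2 : 0 < e / 2 by rewrite divr_gt0.
have [N1 h1] := ha _ e2; have [N2 h2] := hb _ e2; exists (maxn N1 N2) => n.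
rewrite geq_max => /andP[/h1 b1 /h2 b2]; have := mk (u n); lra.
Qed.
End ScalarComplete.

(** All that the operator theory below retains of the polynomials: [one] is the image of the
    constant 1, and [Pi0 v] is the coefficient of [one] in [v]. *)
Record splitting {R : realType} {k : scalar_kind}
    {V W : normedModType (scalar_field R k)} (incl : W -> V) (Pi1 : V -> W)
    (Pi0 : V -> scalar_field R k) (one : V) : Prop := {
  split_incl_linear : linear incl;
  split_incl_nrm : forall w, nrm (incl w) = nrm w;
  split_Pi1 : bounded_operator Pi1;
  split_Pi0 : bounded_operator (Pi0 : V -> (scalar_field R k)^o);
  split_Pi1_incl : forall w, Pi1 (incl w) = w;
  split_Pi0_incl : forall w, Pi0 (incl w) = 0;
  split_Pi1_one : Pi1 one = 0;
  split_Pi0_one : Pi0 one = 1;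
  split_dec : forall v, v = incl (Pi1 v) + Pi0 v *: one
}.

Section Splitting.
Context {R : realType} {k : scalar_kind}.
Local Notation K := (scalar_field R k).
Context {E : Type} (hE : inhabited E) {Pol : set (E -> K)} {deg : (E -> K) -> nat}
  (hPol : is_polynomial_space Pol deg) {T : R -> (E -> K) -> (E -> K)}
  {P1 : normedModType K} {ev : P1 -> E -> K} {L : set P1}
  {V : completeNormedModType K} {iota : P1 -> V} {Tbar : R -> V -> V}
  (hA : assumption_A Pol deg T ev L iota Tbar).

Lemma ev_linear : linear ev.
Proof. exact: (A_ev_linear hA). Qed.

Lemma iota_linear : linear iota.
Proof. by case: (A_completion hA). Qed.

Lemma iota_nrm p : nrm (iota p) = nrm p.
Proof. by case: (A_completion hA) => _ h _; rewrite /nrm h. Qed.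

Lemma iota_dense v (e : R) : 0 < e -> exists p, nrm (iota p - v) < e.
Proof.
by case: (A_completion hA) => _ _ /denseP h /(h v)[_ [p _ <-] hp]; exists p.
Qed.

Lemma const_poly (c : K) : exists p, ev p = fun=> c.
Proof.
have : polynomials_upto Pol deg 1 (fun=> c).
  have [_ hc _ _ h0] := hPol; split; first exact: hc.
  by rewrite (_ : deg _ = 0%N) //; apply/h0; [exact: hc|exists c].
by rewrite -(A_ev_range hA) => -[p _ hp]; exists p.
Qed.

Lemma const_poly_scale (p1 : P1) (c : K) : ev p1 = (fun=> 1) -> ev (c *: p1) = fun=> c.
Proof. by move=> h; rewrite (linZ ev_linear) h; apply/funext => x; exact: mulr1. Qed.

Lemma L_decomposition (p1 p : P1) : ev p1 = (fun=> 1) ->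
  exists c : K, exists2 l, L l & p = c *: p1 + l.
Proof.
move=> h1; have [l [[Ll [c hc]] _]] := A_L_complement hA p.
exists c, l => //; apply: (A_ev_inj hA); rewrite (linD ev_linear) hc.
by rewrite (const_poly_scale _ h1).
Qed.

(** Otherwise 1 would have both itself and 0 as its part in [L], and [E] has a point at which they
    differ. *)
Lemma const_notin_L (p1 : P1) : ev p1 = (fun=> 1) -> ~ L p1.
Proof.
move=> h1 L1; have [l [_ uniq]] := A_L_complement hA p1.
have lp : l = p1.
  apply: uniq; split=> //; exists 0; apply/funext => x; exact/esym/add0r.
have l0 : l = 0.
  apply: uniq; split; first by case: (A_L_subspace hA).
  by exists 1; rewrite (lin0 ev_linear) addr0.
have [x] := hE; have := h1; rewrite -lp l0 (lin0 ev_linear) => /(congr1 (@^~ x)) /eqP.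
by rewrite eq_sym oner_eq0.
Qed.

Lemma L_linear_combination a u v : L u -> L v -> L (a *: u + v).
Proof. by case: (A_L_subspace hA) => _; apply. Qed.

(** [e] bounds from below the distance of 1 to the closed subspace [L]. The estimate makes the
    coefficient of the constants continuous. *)
Lemma coefficient_bound (p1 : P1) : ev p1 = (fun=> 1) -> exists2 e : R, 0 < e &
  forall (c : K) l, L l -> e * sabs c <= nrm (c *: p1 + l).
Proof.
move=> h1; have [e e0 he] : exists2 e : R, 0 < e & forall l, L l -> e <= nrm (l - p1).
  apply: contrapT => h; apply: (const_notin_L h1).
  apply: (A_L_closed hA); apply/closureP => e e0; apply: contrapT => h'.
  apply: h; exists e => // l Ll; rewrite leNgt; apply/negP => lt; apply: h'; by exists l.
exists e => // c l Ll; have [->|c0] := eqVneq c 0.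
  by rewrite sabs0 mulr0 nrm_ge0.
have -> : c *: p1 + l = (- c) *: ((- c^-1) *: l - p1).
  by rewrite scalerBr scalerA mulrNN divff // scale1r scaleNr opprK addrC.
rewrite nrmZ sabsN mulrC ler_wpM2l ?sabs_ge0 // he // -[_ *: _]addr0.
by apply: L_linear_combination => //; case: (A_L_subspace hA).
Qed.

Context {W : completeNormedModType K} {incl : W -> V} {Pi1 : V -> W}
  (hW : is_Lbar ev L iota incl Pi1).

(** Along polynomials tending to [v] the coefficients of 1 are Cauchy; subtracting the limit times 1
    from [v] leaves a vector in the closure of [L]. Only linearity of [Pi1] is given: its
    boundedness follows from that of the coefficient. *)
Lemma splitting_exists (p1 : P1) : ev p1 = (fun=> 1) ->
  exists Pi0, splitting incl Pi1 Pi0 (iota p1).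
Proof.
move=> h1; have [e e0 he] := coefficient_bound h1.
have one_neq0 : iota p1 != 0.
  apply/eqP => h; apply: (const_notin_L h1).
  have -> : p1 = 0 by apply: nrm_eq0; rewrite -iota_nrm h nrm0.
  by case: (A_L_subspace hA).
have lincl := Lbar_linear hW; have lPi1 := Lbar_proj_linear hW.
have Pi1_one : Pi1 (iota p1) = 0 by exact: (Lbar_proj_const hW h1).
have dec v : exists c : K, v = incl (Pi1 v) + c *: iota p1 /\ e * sabs c <= nrm v.
  have [p hp] := choice (fun n : nat => iota_dense v (e := n.+1%:R^-1) ltac:(by rewrite invr_gt0)).
  have [c hc] := choice (fun n => L_decomposition (p n) h1).
  have small (r : R) : 0 < r -> exists N, forall n, (N <= n)%N -> nrm (iota (p n) - v) < r.
    move=> r0; have [N hN] := small_step 1 r0; exists N => n Nn.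
    by rewrite (lt_le_trans (hp n)) // -[_^-1]mul1r hN.
  have coefB m n : e * sabs (c m - c n) <= nrm (iota (p m) - iota (p n)).
    rewrite -(linB iota_linear) iota_nrm.
    have [lm Lm pm] := hc m; have [ln Ln pn] := hc n.
    rewrite pm pn opprD addrACA -scalerBl; apply: he.
    by rewrite addrC -scaleN1r; apply: L_linear_combination.
  have [r r0|c0 hc0] := @scalar_complete _ _ c.
    have [N hN] := small (e * r / 2) ltac:(by rewrite !mulr_gt0 // invr_gt0).
    exists N => m n Nm Nn; rewrite -(ltr_pM2l e0) (le_lt_trans (coefB m n)) //.
    have := nrm_dist v (iota (p m)) (iota (p n)); rewrite (nrmBC v).
    have := hN _ Nm; have := hN _ Nn; lra.
  have : closure (iota @` L) (v - c0 *: iota p1).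
    apply/closureP => r r0; have r2 : 0 < r / 2 by rewrite divr_gt0.
    have r2' : 0 < r / 2 / (nrm (iota p1) + 1) by rewrite divr_gt0 // ltr_wpDl // nrm_ge0.
    have [N1 hN1] := small _ r2; have [N2 hN2] := hc0 _ r2'.
    pose n := maxn N1 N2; have [l Ll pl] := hc n.
    exists (iota l); first by exists l.
    have -> : iota l - (v - c0 *: iota p1) = (iota (p n) - v) - (c n - c0) *: iota p1.
      rewrite pl (linD iota_linear) (linZ iota_linear) scalerBl !opprB.
      rewrite [LHS]addrA [RHS]addrA.
      by rewrite [RHS](ACl ((1*5)*2*4*3)%AC) /= subrr add0r.
    rewrite (le_lt_trans (nrmB _ _)) // nrmZ.
    have b1 := hN1 n (leq_maxl _ _); have b2 := hN2 n (leq_maxr _ _).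
    have : sabs (c n - c0) * nrm (iota p1) <= r / 2.
      rewrite ltr_pdivlMr ?ltr_wpDl ?nrm_ge0 // in b2; rewrite (le_trans _ (ltW b2)) //.
      by rewrite ler_wpM2l ?sabs_ge0 // lerDl.
    lra.
  rewrite -(Lbar_range hW) => -[w _ hw].
  exists c0; have vE : v = incl w + c0 *: iota p1 by rewrite hw subrK.
  have Pi1v : Pi1 v = w.
    by rewrite vE (linD lPi1) (linZ lPi1) Pi1_one scaler0 addr0 (Lbar_proj_id hW).
  split; first by rewrite Pi1v.
  apply/ler_addgt0Pr => r r0; have r2 : 0 < r / 2 by rewrite divr_gt0.
  have [N1 hN1] := small _ r2; have [N2 hN2] := hc0 _ (divr_gt0 r2 e0).
  pose n := maxn N1 N2; have [l Ll pl] := hc n.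
  have b1 := hN1 n (leq_maxl _ _); have b2 := hN2 n (leq_maxr _ _).
  have b3 := he (c n) l Ll; rewrite -pl -iota_nrm in b3.
  have := nrmD (iota (p n) - v) v; rewrite subrK => b4.
  have := sabsD (c0 - c n) (c n); rewrite subrK -(sabsN (c0 - c n)) opprB => b5.
  rewrite ltr_pdivlMr // mulrC in b2.
  have : e * sabs c0 <= e * (sabs (c n - c0) + sabs (c n)) by rewrite ler_pM2l.
  lra.
have [Pi0 hPi0] := choice dec.
have Pi0E v a w : v = incl w + a *: iota p1 -> Pi0 v = a.
  move=> vE; have Pi1v : Pi1 v = w.
    by rewrite vE (linD lPi1) (linZ lPi1) Pi1_one scaler0 addr0 (Lbar_proj_id hW).
  have [h _] := hPi0 v; rewrite Pi1v vE in h; move/addrI: h => /eqP.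
  rewrite -subr_eq0 -scalerBl scaler_eq0 (negbTE one_neq0) orbF subr_eq0 => /eqP.
  by rewrite -vE => ->.
exists Pi0; split=> //.
- by move=> w; rewrite /nrm (Lbar_isometry hW).
- apply/bounded_operatorP; split=> //; exists (1 + e^-1 * nrm (iota p1)).
    by rewrite addr_ge0 // mulr_ge0 ?nrm_ge0 // invr_ge0 ltW.
  move=> v; have [h1' h2] := hPi0 v.
  have -> : nrm (Pi1 v) = nrm (v - Pi0 v *: iota p1).
    by rewrite {2}h1' addrK /nrm (Lbar_isometry hW).
  rewrite (le_trans (nrmB _ _)) // nrmZ mulrDl mul1r lerD2l mulrAC ler_wpM2r ?nrm_ge0 //.
  by rewrite ler_pdivlMl.
- apply/bounded_operatorP; split=> [a u v|].
    apply: (Pi0E _ _ (a *: Pi1 u + Pi1 v)).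
    rewrite lincl {1}(hPi0 u).1 {1}(hPi0 v).1 scalerDr addrACA; congr (_ + _).
    by rewrite scalerDl scalerA.
  exists e^-1; first by rewrite invr_ge0 ltW.
  by move=> v; rewrite ler_pdivlMl //; have [_] := hPi0 v.
- exact: (Lbar_proj_id hW).
- by move=> w; apply: (Pi0E _ _ w); rewrite scale0r addr0.
- by apply: (Pi0E _ _ 0); rewrite (lin0 lincl) add0r scale1r.
- by move=> v; have [] := hPi0 v.
Qed.

End Splitting.

(** * The compressed semigroup and the constant part *)

Section Compression.
Context {R : realType} {k : scalar_kind}.
Local Notation K := (scalar_field R k).
Context {V W : completeNormedModType K} {incl : W -> V} {Pi1 : V -> W}
  {Pi0 : V -> K} {one : V} (hsp : splitting incl Pi1 Pi0 one)
  (S : R -> V -> V) (hS : C0_semigroup S) (S_one : forall h, 0 <= h -> S h one = one).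
Local Notation T1 := (compression incl Pi1 S).

Let lincl : linear incl := split_incl_linear hsp.
Let lPi1 : linear Pi1. Proof. by case: (split_Pi1 hsp). Qed.
Let lPi0 : linear (Pi0 : V -> K^o). Proof. by case: (split_Pi0 hsp). Qed.

Lemma bounded_operator_incl : bounded_operator incl.
Proof.
apply/bounded_operatorP; split=> //; exists 1 => // w.
by rewrite (split_incl_nrm hsp) mul1r.
Qed.

Definition constant_part (h : R) (w : W) : K^o := Pi0 (S h (incl w)).

Local Notation kappa := constant_part.

Lemma compressionE h w : S h (incl w) = incl (T1 h w) + kappa h w *: one.
Proof. exact: (split_dec hsp). Qed.

Lemma constant_part_bounded h : 0 <= h -> bounded_operator (kappa h).
Proof.
move=> h0; apply: bounded_operator_comp (split_Pi0 hsp) _.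
by apply: bounded_operator_comp bounded_operator_incl; exact: sg_bounded.
Qed.

Lemma compression_bounded (G : V -> V) : bounded_operator G ->
  bounded_operator (fun w => Pi1 (G (incl w))).
Proof.
move=> bG; apply: bounded_operator_comp (split_Pi1 hsp) _.
by apply: bounded_operator_comp bounded_operator_incl.
Qed.

(** What the inner [Pi1] drops is a constant, which [A] fixes and the outer [Pi1] drops anyway. *)
Lemma compression_mul (A B : V -> V) w : linear A -> A one = one ->
  Pi1 (A (incl (Pi1 (B (incl w))))) = Pi1 (A (B (incl w))).
Proof.
move=> lA A1; rewrite [in RHS](split_dec hsp (B (incl w))) (linD lA) (linZ lA) A1.
by rewrite (linD lPi1) (linZ lPi1) (split_Pi1_one hsp) scaler0 addr0.
Qed.

Lemma compressionD h l w : 0 <= h -> 0 <= l -> T1 (h + l) w = T1 h (T1 l w).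
Proof.
move=> h0 l0; rewrite /compression (compression_mul (S l)) //; last exact: S_one.
  by rewrite (sgD hS).
exact: sg_linear.
Qed.

Lemma compression0 w : T1 0 w = w.
Proof. by rewrite /compression (sg0 hS) (split_Pi1_incl hsp). Qed.

(** A cocycle identity: the constant split off in time [l] passes through [S h] unchanged. *)
Lemma constant_partD h l w : 0 <= h -> 0 <= l -> kappa (h + l) w = kappa l w + kappa h (T1 l w).
Proof.
move=> h0 l0; rewrite [LHS]/constant_part (sgD hS) // compressionE (linD (sg_linear hS h0)).
rewrite (linZ (sg_linear hS h0)) S_one // (linD lPi0) (linZ lPi0) (split_Pi0_one hsp).
by rewrite [LHS]addrC; congr (_ + _); rewrite /GRing.scale /= mulr1.
Qed.

Lemma compression_C0 : C0_semigroup T1.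
Proof.
split; first split.
- by move=> h h0; apply: compression_bounded; exact: sg_bounded.
- exact: compression0.
- by move=> *; exact: compressionD.
move=> w; have := bounded_operator_cvg (split_Pi1 hsp) (hS.2 (incl w)).
by rewrite (split_Pi1_incl hsp); exact.
Qed.

Lemma generator_one : generator S one 0.
Proof.
apply/generatorP => e e0; exists 1 => // h h0 _.
by rewrite (S_one (ltW h0)) scaler0 !subrr nrm0 mulr_ge0 // ltW.
Qed.

(** The generator vanishes at [one], so a constant part affects neither the domain nor the value. *)
Lemma generator_split v g : generator S v g <-> generator S (incl (Pi1 v)) g.
Proof.
have lS h : 0 <= h -> linear (S h) by exact: sg_linear.
split=> h.
  have := generator_linear (a := - Pi0 v) lS generator_one h.
  by rewrite scaler0 add0r {2}(split_dec hsp v) addrCA -scalerDl addNr scale0r addr0.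
have := generator_linear (a := Pi0 v) lS generator_one h.
by rewrite scaler0 add0r addrC -(split_dec hsp).
Qed.

Definition generator_value (v : V) : V := get [set g | generator S v g].

Lemma generator_valueP v : generator_domain S v -> generator S v (generator_value v).
Proof. by move=> [g hg]; exact: (@getI _ _ g hg). Qed.

Lemma generator_valueE v g : generator S v g -> generator_value v = g.
Proof.
move=> hg; have h := @generator_valueP v (ex_intro _ g hg).
exact: (generator_unique h hg).
Qed.

(* The paper's b, which need not be in B. *)
Definition generator_constant (w : W) : K := Pi0 (generator_value (incl w)).
Local Notation beta := generator_constant.
Local Notation C := [set w | generator_domain S (incl w)].

Lemma compression_domain h w : 0 <= h -> C w ->
  generator S (incl (T1 h w)) (S h (generator_value (incl w))).
Proof. move=> h0 /generator_valueP hw; apply: (proj1 (@generator_split (S h (incl w)) _)).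
exact: generator_sg. Qed.

Lemma generator_constant_compression h w : 0 <= h -> C w -> beta (T1 h w) = Pi0 (S h (generator_value (incl w))).
Proof. by move=> h0 Cw; rewrite /generator_constant (generator_valueE (compression_domain h0 Cw)). Qed.

Lemma constant_part_integral h w : 0 <= h -> C w -> kappa h w = Pi0 (sg_integral S h (generator_value (incl w))).
Proof.
move=> h0 /generator_valueP hw; rewrite (sg_integral_generator hS h0 hw) (linB lPi0).
by rewrite (split_Pi0_incl hsp) subr0.
Qed.

Lemma compression_domain_subspace : is_subspace C.
Proof.
have [D0 DZ] := generator_domain_subspace hS; split; first by rewrite /= (lin0 lincl).
by move=> a u v Cu Cv; rewrite /= lincl; exact: DZ.
Qed.

Lemma compression_domain_dense w (e : R) : 0 < e -> exists2 u, C u & nrm (u - w) < e.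
Proof.
move=> e0; have [M M0 hM] := bounded_operator_bound (split_Pi1 hsp).
have [v [g hg] hv] := generator_domain_dense hS (incl w) (divr_gt0 e0 M0).
exists (Pi1 v); first by exists g; apply: (proj1 (@generator_split v _)).
rewrite -(split_Pi1_incl hsp w) -(linB lPi1) (le_lt_trans (hM _)) //.
by rewrite mulrC -ltr_pdivlMr.
Qed.

(** [Q] is the compressed resolvent. Although beta may be unbounded, beta at [Q w] is [l] times the
    constant part of the resolvent at [w], hence bounded in [w]. *)
Lemma smoothing_exists : one != 0 -> exists (l : R) (Q : W -> W),
  [/\ bounded_operator Q,
      forall w, generator S (incl (Q w)) (rc k l *: incl (Q w) - incl w
                  + beta (Q w) *: one),
      bounded_operator (fun w => beta (Q w) : K^o),
      forall w, C w -> Q (rc k l *: w - Pi1 (generator_value (incl w))) = w &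
      forall h w, 0 <= h -> Q (T1 h w) = T1 h (Q w)].
Proof.
move=> one0; have [l [Qv [bQv gQv Qv1 Qvcomm]]] := resolvent_exists hS.
have lQv : linear Qv by case: bQv.
(* [one] is an eigenvector of the resolvent. This shows that [l] is nonzero and that the compression
   of the resolvent ignores constants. *)
have Q_one : rc k l *: Qv one = one.
  by rewrite -(linZ lQv) -[X in Qv X]subr0 (Qv1 _ _ generator_one).
have l0 : rc k l != 0.
  by apply/eqP => l0; move: Q_one one0; rewrite l0 scale0r => <-; rewrite eqxx.
have Pi1_Q_one : Pi1 (Qv one) = 0.
  apply/eqP; rewrite -(inj_eq (scalerI l0)) scaler0 -(linZ lPi1) Q_one.
  by rewrite (split_Pi1_one hsp).
pose Q w := Pi1 (Qv (incl w)).
have Q_incl_Pi1 v : Pi1 (Qv (incl (Pi1 v))) = Pi1 (Qv v).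
  rewrite [v in RHS](split_dec hsp v) (linD lQv) (linZ lQv) (linD lPi1) (linZ lPi1).
  by rewrite Pi1_Q_one scaler0 addr0.
have gQ w : generator S (incl (Q w)) (rc k l *: Qv (incl w) - incl w).
  exact: (proj1 (@generator_split (Qv (incl w)) _)).
have betaQ w : beta (Q w) = Pi0 (rc k l *: Qv (incl w)).
  by rewrite /generator_constant (generator_valueE (gQ w)) (linB lPi0) (split_Pi0_incl hsp) subr0.
exists l, Q; split.
- exact: compression_bounded.
- move=> w; have := gQ w; rewrite betaQ {1}(split_dec hsp (Qv (incl w))).
  rewrite scalerDr scalerA addrAC (linZ lPi0).
  by [].
- rewrite (_ : (fun w => _) = fun w => Pi0 (rc k l *: Qv (incl w)) : K^o); last exact/funext.
  apply: bounded_operator_comp (split_Pi0 hsp) _; apply: bounded_operatorZ.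
  exact: bounded_operator_comp bounded_operator_incl.
- move=> w /generator_valueP hw; rewrite /Q -[X in incl X](_ : Pi1 (rc k l *: incl w - generator_value (incl w)) = _).
    by rewrite Q_incl_Pi1 (Qv1 _ _ hw) (split_Pi1_incl hsp).
  by rewrite (linB lPi1) (linZ lPi1) (split_Pi1_incl hsp).
- move=> h w h0; rewrite /Q /compression Q_incl_Pi1.
  rewrite (compression_mul Qv w (sg_linear hS h0) (S_one h0)) (Qvcomm (S h)) //.
    exact: sg_bounded.
  by move=> *; exact: sg_comm.
Qed.

End Compression.

(** * Integration of scalar functions *)

Section ScalarIntegral.
Context {R : realType} {k : scalar_kind}.
Local Notation K := (scalar_field R k).
Context {d : measure_display} {T : measurableType d} (mu : {measure set T -> \bar R}).
Implicit Types (D A : set T) (f g : T -> K).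

Lemma measurable_sabs D f : measurable D ->
  measurable_fun D (fun x => sRe (f x)) -> measurable_fun D (fun x => sIm (f x)) ->
  measurable_fun D (fun x => sabs (f x)).
Proof.
rewrite /sabs; case: k f => f mD mRe mIm /=.
  by apply: measurableT_comp => //; exact: normr_measurable.
rewrite (_ : (fun x => _) = fun x =>
    Num.sqrt (complex.Re (f x) ^+ 2 + complex.Im (f x) ^+ 2)); last first.
  by apply/funext => x; case: (f x).
have h : measurable_fun D (fun x => complex.Re (f x) ^+ 2 + complex.Im (f x) ^+ 2).
  by apply: measurable_funD; exact: measurable_funX.
exact: (measurableT_comp (continuous_measurable_fun (@sqrt_continuous R)) h).
Qed.

Lemma sintegrableP D f : measurable D -> sintegrable mu D f <->
  mu.-integrable D (EFin \o (fun x => sRe (f x))) /\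
  mu.-integrable D (EFin \o (fun x => sIm (f x))).
Proof.
move=> mD; split=> [[mRe mIm hf]|[iRe iIm]].
  have mabs := measurable_sabs mD mRe mIm.
  have iabs : mu.-integrable D (EFin \o (fun x => sabs (f x))).
    apply/integrableP; split; first exact/measurable_EFinP.
    by under eq_integral do rewrite /= ger0_norm ?sabs_ge0 //.
  split; apply: (le_integrable mD _ _ iabs); do ?exact/measurable_EFinP.
    by move=> x _ /=; rewrite lee_fin (ger0_norm (sabs_ge0 _)) sRe_le_sabs.
  by move=> x _ /=; rewrite lee_fin (ger0_norm (sabs_ge0 _)) sIm_le_sabs.
have mRe : measurable_fun D (fun x => sRe (f x)).
  by apply/measurable_EFinP; exact: (measurable_int mu).
have mIm : measurable_fun D (fun x => sIm (f x)).
  by apply/measurable_EFinP; exact: (measurable_int mu).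
split=> //; have mabs := measurable_sabs mD mRe mIm.
have /integrableP[_] := integrableD mD (integrable_abse iRe) (integrable_abse iIm).
apply: le_lt_trans; apply: ge0_le_integral => //.
- by move=> x _; rewrite lee_fin sabs_ge0.
- exact/measurable_EFinP.
- apply/measurableT_comp => //; apply: emeasurable_funD; apply/measurableT_comp => //;
  exact/measurable_EFinP.
- by move=> x _; rewrite /= lee_fin ger0_norm ?addr_ge0 // sabs_le_ReIm.
Qed.

Lemma sintegrable_abs D f : measurable D -> sintegrable mu D f ->
  mu.-integrable D (EFin \o (fun x => sabs (f x))).
Proof.
move=> mD [mRe mIm hf]; apply/integrableP; split.
  exact/measurable_EFinP/measurable_sabs.
by under eq_integral do rewrite /= ger0_norm ?sabs_ge0 //.
Qed.

Lemma sintegrableB D f g : measurable D -> sintegrable mu D f -> sintegrable mu D g ->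
  sintegrable mu D (fun x => f x - g x).
Proof.
move=> mD /(sintegrableP _ mD)[fR fI] /(sintegrableP _ mD)[gR gI].
apply/(sintegrableP _ mD); split.
  under eq_fun do rewrite sReB.
  by have := integrableB mD fR gR; apply: eq_integrable.
under eq_fun do rewrite sImB.
by have := integrableB mD fI gI; apply: eq_integrable.
Qed.

Lemma sintegrableS D A f : measurable D -> measurable A -> A `<=` D ->
  sintegrable mu D f -> sintegrable mu A f.
Proof.
move=> mD mA AD /(sintegrableP _ mD)[fR fI]; apply/(sintegrableP _ mA).
by split; [move: fR|move: fI]; exact: integrableS.
Qed.

Lemma sRe_mk_scalar (a b : R) : sRe (mk_scalar k a b) = a.
Proof. by case: k. Qed.

Lemma sIm_mk_scalar_le (a b : R) : `|sIm (mk_scalar k a b)| <= `|b|.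
Proof. by case: k; rewrite //= normr0. Qed.

Lemma mk_scalarB (a b a' b' : R) :
  mk_scalar k (a - a') (b - b') = mk_scalar k a b - mk_scalar k a' b'.
Proof. by apply: scalar_ext; rewrite ?sReB ?sImB; case: k; rewrite //= subrr. Qed.

Lemma sintegralB D f g : measurable D -> sintegrable mu D f -> sintegrable mu D g ->
  sintegral mu D (fun x => f x - g x) = sintegral mu D f - sintegral mu D g.
Proof.
move=> mD /(sintegrableP _ mD)[fR fI] /(sintegrableP _ mD)[gR gI].
rewrite /Defs.sintegral -mk_scalarB; congr mk_scalar.
  by rewrite -RintegralB //; apply: eq_Rintegral => x _; rewrite sReB.
by rewrite -RintegralB //; apply: eq_Rintegral => x _; rewrite sImB.
Qed.

(** The factor 2 comes from bounding the real and the imaginary part separately; the lemma serves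
    only for continuity estimates. *)
Lemma sabs_sintegral_le D f : measurable D -> sintegrable mu D f ->
  sabs (sintegral mu D f) <= 2 * (\int[mu]_(x in D) sabs (f x))%R.
Proof.
move=> mD fi; have [fR fI] := (sintegrableP _ mD).1 fi; have fabs := sintegrable_abs mD fi.
rewrite mulrDl mul1r (le_trans (sabs_le_ReIm _)) // lerD //.
  rewrite sRe_mk_scalar (le_trans (le_normr_Rintegral mD fR)) //; apply: le_Rintegral => //.
    exact: integrable_norm.
  by move=> x _; exact: sRe_le_sabs.
rewrite (le_trans (sIm_mk_scalar_le _ _)) // (le_trans (le_normr_Rintegral mD fI)) //; apply: le_Rintegral => //.
  exact: integrable_norm.
by move=> x _; exact: sIm_le_sabs.
Qed.

End ScalarIntegral.

Section ProbabilityIntegral.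
Context {R : realType} {k : scalar_kind}.
Local Notation K := (scalar_field R k).
Context {d : measure_display} {T : measurableType d} (P : probability T R).

Lemma sintegrable_cst (c : K) : sintegrable P setT (fun=> c).
Proof.
apply/sintegrableP => //; split; exact: finite_measure_integrable_cst.
Qed.

Lemma sintegral_cst (c : K) : sintegral P setT (fun=> c) = c.
Proof.
have h (r : R) : (\int[P]_(x in setT) r)%R = r.
  rewrite Rintegral_cst //.
  have -> : fine ((P : {measure set T -> \bar R}) setT) = 1.
    exact: congr1 (probability_setT P).
  by rewrite mulr1.
by rewrite /Defs.sintegral !h mk_scalarK.
Qed.

Lemma sintegralB_subset (f g : T -> K) A : measurable A -> sintegrable P setT f ->
  sintegrable P setT g -> sintegral P A f - sintegral P A g =
  sintegral P A (fun x => f x - g x).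
Proof. by move=> mA fi gi; rewrite sintegralB //; exact: sintegrableS (@subsetT _ _) _. Qed.

End ProbabilityIntegral.

(** * The fundamental theorem of calculus on a closed interval *)

Section FundamentalTheorem.
Context {R : realType}.

Lemma real_FTC (f F : R -> R) (t : R) : 0 <= t ->
  (forall e : R, 0 < e -> exists2 r : R, 0 < r & forall s u : R, 0 <= s -> s <= t ->
     0 <= u -> u <= t -> `|s - u| <= r -> `|f s - f u| <= e) ->
  (forall e : R, 0 < e -> exists2 r : R, 0 < r & forall s u : R, 0 <= s -> s <= u ->
     u <= t -> u - s <= r -> `|F u - F s - (u - s) * f s| <= (u - s) * e) ->
  lebesgue_measure.-integrable `[0, t] (EFin \o f) /\
  (\int[lebesgue_measure]_(x in `[0%R, t]) f x)%R = F t - F 0.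
Proof.
(* [f] is controlled on [[0, t]] only; composed with the clamp [cl] it is continuous on the whole
   line and unchanged on the interval. *)
move=> t0 hf hF; pose cl (s : R) := Num.max 0 (Num.min t s).
have cl_in s : 0 <= cl s /\ cl s <= t.
  by rewrite /cl le_max lexx; split=> //; rewrite ge_max t0 ge_min lexx.
have clE s : s \in `[0, t] -> cl s = s.
  by rewrite in_itv /= => /andP[s0 st]; rewrite /cl (min_idPr st) (max_idPr s0).
have cl_lip s u : `|cl s - cl u| <= `|s - u|.
  rewrite /cl; case: (leP t s) => ts; case: (leP t u) => tu; do ?case: (leP 0 s) => s0;
  do ?case: (leP 0 u) => u0; do ?case: (leP 0 t) => t0'; rewrite ?subrr ?normr0 ?normr_ge0 //; try lra;
  rewrite ler_norml; have := ler_norm (s - u); have := ler_norm (- (s - u)); rewrite normrN; lra.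
pose g s := f (cl s).
have gE s : s \in `[0, t] -> g s = f s by move=> /clE; rewrite /g => ->.
have gc : continuous g.
  move=> x; apply/cvgrPdistC_le => e e0; have [r r0 hr] := hf e e0.
  exists r => //= y; rewrite /ball_ /= => xy.
  have [? ?] := cl_in x; have [? ?] := cl_in y; apply: hr => //.
  by rewrite (le_trans (cl_lip _ _)) // distrC ltW.
have gi : lebesgue_measure.-integrable `[0, t] (EFin \o g).
  apply: continuous_compact_integrable; first exact: segment_compact.
  exact: continuous_subspaceT.
split.
  apply: eq_integrable gi => // x; rewrite inE /= => xt; by rewrite gE.
have -> : (\int[lebesgue_measure]_(x in `[0%R, t]) f x)%R =
    (\int[lebesgue_measure]_(x in `[0%R, t]) g x)%R.
  by apply: eq_Rintegral => x; rewrite inE /= => xt; rewrite gE.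
move: t0; rewrite le_eqVlt => /predU1P[<-|t0].
  by rewrite set_itv1 Rintegral_set1 subrr.
(* For [y] left of [x] the hypothesis applies with base point [y]; exchanging [f y] for [f x] costs
   the second half of [e]. *)
have F_near x (e : R) : 0 < e -> 0 <= x -> x <= t -> exists2 r : R, 0 < r & forall y,
    0 <= y -> y <= t -> `|y - x| < r -> `|F y - F x - (y - x) * f x| <= `|y - x| * e.
  move=> e0 x0 xt; have e20 : 0 < e / 2 by rewrite divr_gt0.
  have [r1 r10 h1] := hF _ e20; have [r2 r20 h2] := hf _ e20.
  exists (Num.min r1 r2) => [|y y0 yt]; first by rewrite lt_min r10.
  rewrite lt_min => /andP[yr1 yr2]; have [xy|/ltW yx] := leP x y.
    have yx0 : 0 <= y - x by rewrite subr_ge0.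
    rewrite ger0_norm // in yr1 *; rewrite (le_trans (h1 x y x0 xy yt (ltW yr1))) //.
    by rewrite ler_wpM2l //; lra.
  have yx0 : 0 <= x - y by rewrite subr_ge0.
  rewrite distrC ger0_norm // in yr1; rewrite [`|y - x|]distrC (ger0_norm yx0).
  have := h1 y x y0 yx xt (ltW yr1); have := h2 y x y0 yt x0 xt (ltW yr2).
  move=> b2 b1; rewrite -normrN.
  have -> : - (F y - F x - (y - x) * f x) = (F x - F y - (x - y) * f y) + (x - y) * (f y - f x).
    by ring.
  rewrite (le_trans (ler_normD _ _)) // normrM (ger0_norm yx0).
  have : (x - y) * `|f y - f x| <= (x - y) * (e / 2) by rewrite ler_wpM2l.
  lra.
have F_cont x (e : R) : 0 < e -> 0 <= x -> x <= t -> exists2 r : R, 0 < r & forall y,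
    0 <= y -> y <= t -> `|y - x| < r -> `|F y - F x| < e.
  move=> e0 x0 xt; have [r r0 hr] := F_near x 1 ltr01 x0 xt.
  have c0 : 0 < `|f x| + 2 by rewrite ltr_wpDl.
  exists (Num.min r (e / (`|f x| + 2))) => [|y y0 yt]; first by rewrite lt_min r0 divr_gt0.
  rewrite lt_min => /andP[yr]; rewrite ltr_pdivlMr // => ye; have := hr y y0 yt yr.
  have := ler_normD (F y - F x - (y - x) * f x) ((y - x) * f x).
  rewrite subrK normrM; move: (normr_ge0 (y - x)); lra.
have F_derive x : x \in `]0, t[ -> is_derive x 1 F (f x).
  rewrite in_itv /= => /andP[x0 xt].
  suff h : h^-1 *: (F (h *: 1 + x) - F x) @[h --> 0^'] --> f x.
    by apply: DeriveDef; [exact: cvgP h|exact: cvg_lim].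
  apply/cvgrPdistC_le => e e0; have [r r0 hr] := F_near x e e0 (ltW x0) (ltW xt).
  exists (Num.min r (Num.min x (t - x))); first by rewrite /= !lt_min r0 x0 subr_gt0.
  move=> h; rewrite /= sub0r normrN !lt_min => /and3P[h1 h2 h3] h0.
  have hn := ler_norm h; have := ler_norm (- h); rewrite normrN => hn'.
  have := hr (h + x) _ _ _; rewrite addrK => /(_ _ _ h1) b.
  rewrite /GRing.scale /= mulr1 -(@ler_pM2l _ `|h|) ?normr_gt0 //.
  by rewrite -normrM mulrBr mulrA divff // mul1r; apply: b; lra.
have := @continuous_FTC2 R g F 0 t t0 _ _ _; rewrite /Rintegral => -> //.
- exact: continuous_subspaceT.
- split.
  + by move=> x /F_derive[].
  + apply/cvgrPdistC_lt => e e0; have [r r0 hr] := F_cont 0 e e0 (lexx _) (ltW t0).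
    exists (Num.min r t) => /=; first by rewrite lt_min r0.
    move=> y /=; rewrite sub0r normrN lt_min => /andP[yr yt] y0.
    rewrite gtr0_norm // in yt; apply: hr; rewrite ?subr0 //; exact: ltW.
  + apply/cvgrPdistC_lt => e e0; have [r r0 hr] := F_cont t e e0 (ltW t0) (lexx _).
    exists (Num.min r t) => /=; first by rewrite lt_min r0.
    move=> y /=; rewrite lt_min => /andP[yr yt] y0.
    rewrite gtr0_norm ?subr_gt0 // in yt; apply: hr; rewrite 1?distrC //; try exact: ltW.
    by lra.
- move=> x xt; rewrite derive1E (gE x); last first.
    by move: xt; rewrite !in_itv /= => /andP[/ltW -> /ltW ->].
  by have [_] := F_derive x xt.
Qed.

End FundamentalTheorem.

Section SemigroupScalarIntegral.
Context {R : realType} {k : scalar_kind}.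
Local Notation K := (scalar_field R k).
Context {V : completeNormedModType K} (S : R -> V -> V) (hS : C0_semigroup S).

(** The passage from limits of Riemann sums to Lebesgue integrals, by the fundamental theorem for
    the real and imaginary parts of [phi] at the integral. *)
Lemma sg_scalar_integral (phi : V -> K^o) g (t : R) : bounded_operator phi -> 0 <= t ->
  sintegrable lebesgue_measure `[0, t] (fun s => phi (S s g) : K) /\
  sintegral lebesgue_measure `[0, t] (fun s => phi (S s g) : K) = phi (sg_integral S t g).
Proof.
move=> bphi t0; have [M M0 hM] := bounded_operator_bound bphi.
have lphi : linear phi by case: bphi.
have real_part (re : K -> R) : (forall x y, re (x - y) = re x - re y) ->
    (forall x, `|re x| <= sabs x) -> (forall a x, re (rc k a * x) = a * re x) ->
    lebesgue_measure.-integrable `[0, t] (EFin \o (fun s => re (phi (S s g)))) /\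
    (\int[lebesgue_measure]_(s in `[0%R, t]) re (phi (S s g)))%R =
      re (phi (sg_integral S t g)).
  move=> reB rele reZ.
  have re0 : re 0 = 0 by rewrite -(subrr 0) reB subrr.
  have [||i1 i2] := @real_FTC R (fun s => re (phi (S s g)))
      (fun s => re (phi (sg_integral S s g))) t t0.
  - move=> e e0; have [r r0 hr] := sg_uniformly_continuous hS t g (divr_gt0 e0 M0).
    exists r => // s u s0 st u0 ut su.
    rewrite -reB -(linB lphi) (le_trans (rele _)) // (le_trans (hM _)) //.
    by rewrite mulrC -ler_pdivlMr // hr.
  - move=> e e0; have [r r0 hr] := sg_integral_estimate hS t g (divr_gt0 e0 M0).
    exists r => // s u s0 su ut us.
    rewrite -reZ -!reB -[rc k _ * _]/(rc k _ *: (phi _ : K^o)) -(linZ lphi) -!(linB lphi).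
    rewrite (le_trans (rele _)) // (le_trans (hM _)) //.
    by rewrite mulrC -ler_pdivlMr // -mulrA hr.
  by split=> //; rewrite i2 (sg_integral0 S) (lin0 lphi) re0 subr0.
have [||a x|reI reE] := real_part sRe.
- exact: sReB.
- exact: sRe_le_sabs.
- by rewrite /rc; case: k x => // -[x y] /=; rewrite mul0r subr0.
have [||a x|imI imE] := real_part sIm.
- exact: sImB.
- exact: sIm_le_sabs.
- by rewrite /rc; case: k x => [x|[x y]] /=; rewrite ?mulr0 // mul0r addr0.
split; first by apply/sintegrableP.
by rewrite /Defs.sintegral reE imE mk_scalarK.
Qed.

End SemigroupScalarIntegral.

Lemma sabs_dist_le {R : realType} {k : scalar_kind} (x y : scalar_field R k) :
  `|sabs x - sabs y| <= sabs (x - y).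
Proof.
have h1 := sabsD (x - y) y; have h2 := sabsD (y - x) x.
rewrite subrK in h1; rewrite subrK -opprB sabsN in h2.
by rewrite ler_norml; lra.
Qed.

(** * Weakly integrable random elements *)

Section WeakIntegrability.
Context {R : realType} {k : scalar_kind}.
Local Notation K := (scalar_field R k).
Context {d : measure_display} {T : measurableType d} (P : probability T R).
Context {W : completeNormedModType K} {B : normedModType K} (pairing : B -> W -> K)
  (hp : forall y, bounded_operator (pairing y : W -> K^o)).

Let plin y : linear (pairing y : W -> K^o). Proof. by case: (hp y). Qed.

(* The L^1 norm is a lower semicontinuous seminorm by Fatou's lemma. *)
Lemma weakly_integrable_bounded (Y : T -> B) : weakly_integrable P pairing Y ->
  exists2 M : R, 0 <= M &
    forall l, (\int[P]_(w in setT) sabs (pairing (Y w) l))%R <= M * nrm l.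
Proof.
move=> hY; pose p l := (\int[P]_(w in setT) sabs (pairing (Y w) l))%R.
have iabs l := sintegrable_abs measurableT (hY l).
apply: (@lsc_seminorm_bounded R k W p).
- move=> u v; rewrite /p -RintegralD //; apply: le_Rintegral => //.
    by have := integrableD measurableT (iabs u) (iabs v); apply: eq_integrable.
  move=> w _; rewrite (linD (plin (Y w))); exact: sabsD.
- move=> a v; rewrite /p -RintegralZl //; apply: eq_Rintegral => w _.
  by rewrite (linZ (plin (Y w))) /GRing.scale /= sabsM sabs_rc.
move=> v c cv; apply: contrapT => h.
have {}h (n : nat) : exists u, nrm (u - v) < n.+1%:R^-1 /\ p u <= c.
  apply: contrapT => h'; apply: h; exists n.+1%:R^-1; first by rewrite invr_gt0.
  move=> u uv; rewrite ltNge; apply/negP => pu; apply: h'; by exists u.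
have [u hu] := choice h.
move: cv; apply/negP; rewrite -leNgt.
pose f n w := (sabs (pairing (Y w) (u n)))%:E.
have mf n : measurable_fun setT (f n) by exact: (measurable_int P (iabs (u n))).
have f0 n x : setT x -> (0 <= f n x)%E by move=> _; rewrite lee_fin sabs_ge0.
have uv : u n @[n --> \oo] --> v.
  apply/cvg_nrmP => e e0; have [N hN] := small_step 1 e0; exists N => // n /= Nn.
  by rewrite (lt_le_trans (hu n).1) // -[_^-1]mul1r hN.
have flim w : limn_einf (f^~ w) = (sabs (pairing (Y w) v))%:E.
  have : f^~ w @ \oo --> (sabs (pairing (Y w) v))%:E.
    apply: cvg_EFin; first by near=> n.
    apply/cvgrPdistC_le => e e0.
    have : (fun n => pairing (Y w) (u n) : K^o) @ \oo --> (pairing (Y w) v : K^o).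
      exact: bounded_operator_cvg uv.
    move=> /cvg_nrmP/(_ e e0).
    apply: filterS => n hn.
    have {}hn : sabs (pairing (Y w) (u n) - pairing (Y w) v) < e by exact: hn.
    exact: le_trans (sabs_dist_le _ _) (ltW hn).
  by move=> h'; rewrite is_cvg_limn_einfE; [exact/cvg_lim|exact: cvgP h'].
have := fatou P measurableT mf f0.
under eq_integral do rewrite flim.
have le : (limn_einf (fun n => \int[P]_(x in setT) f n x) <= c%:E)%E.
  rewrite limn_einf_lim; apply: lime_le; first exact: is_cvg_einfs.
  near=> n; apply: (@le_trans _ _ (\int[P]_(x in setT) f n x)%E).
    by apply: ereal_inf_lbound; exists n => //=.
  rewrite -(@fineK _ (\int[P]_(x in setT) f n x)%E); last exact: integrable_fin_num (iabs (u n)).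
  by rewrite lee_fin (hu n).2.
move=> /le_trans/(_ le).
rewrite -(@fineK _ (\int[P]_x _)%E) ?lee_fin //.
exact: integrable_fin_num (iabs v).
Unshelve. all: by end_near. Qed.

(** Identities between integrals that are known for polynomials pass to all of [W] by this
    continuity. *)
Lemma weak_integral_continuous (Y : T -> B) : weakly_integrable P pairing Y ->
  forall A, measurable A -> forall (l : W) (e : R), 0 < e ->
  exists2 r : R, 0 < r & forall l', nrm (l' - l) < r ->
    sabs (sintegral P A (fun w => pairing (Y w) l') -
          sintegral P A (fun w => pairing (Y w) l)) < e.
Proof.
move=> hY A mA l e e0; have [M M0 hM] := weakly_integrable_bounded hY.
have c0 : 0 < 2 * M + 1 by rewrite ltr_wpDl // mulr_ge0.
exists (e / (2 * M + 1)); first by rewrite divr_gt0.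
move=> l' hl; rewrite (sintegralB_subset mA (hY l') (hY l)).
rewrite (_ : (fun w => _) = fun w => pairing (Y w) (l' - l)); last first.
  by apply/funext => w; rewrite (linB (plin (Y w))).
have iS : sintegrable P A (fun w => pairing (Y w) (l' - l)).
  exact: sintegrableS (hY _).
rewrite (le_lt_trans (sabs_sintegral_le mA iS)) //.
have : (\int[P]_(w in A) sabs (pairing (Y w) (l' - l)))%R <= M * nrm (l' - l).
  apply: le_trans (hM (l' - l)); rewrite Rintegral_mkcond; apply: le_Rintegral => //.
  - have := sintegrable_abs mA iS; rewrite integrable_mkcond //.
    by apply: eq_integrable => // w _; rewrite /= restrict_EFin.
  - exact: sintegrable_abs (hY _).
  - by move=> w _; rewrite patchE; case: ifP => // _; rewrite sabs_ge0.
move: hl; rewrite ltr_pdivlMr // => hl; have := nrm_ge0 (l' - l).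
nra.
Qed.

End WeakIntegrability.

(** * The extended space *)

Section LinearProjection.
Context {K : numFieldType} {V : lmodType K} (Y : set V) (hY : is_subspace Y).

(** A maximal subspace that meets [Y] only in 0 is a complement of [Y]. *)
Lemma linear_projection : exists p : V -> V,
  [/\ linear p, forall v, Y (p v) & forall v, Y v -> p v = v].
Proof.
have [Y0 YZ] := hY.
pose P (Z : set V) := (forall a u v, Z u -> Z v -> Z (a *: u + v)) /\
  (forall u, Z u -> Y u -> u = 0).
have [F FP Ftot|A [[AZ AY] Amax]] := @Zorn_bigcup V P.
  split=> [a u v [Z1 F1 Z1u] [Z2 F2 Z2v]|u [Z FZ Zu]]; last exact: (FP Z FZ).2.
  have [Z12|Z21] := Ftot _ _ F1 F2.
    by exists Z2 => //; apply: (FP Z2 F2).1 => //; exact: Z12.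
  by exists Z1 => //; apply: (FP Z1 F1).1 => //; exact: Z21.
(* The union of the empty chain has to satisfy [P], so [P] does not ask for 0. If [A] lacked 0 it
   would be empty, and the zero subspace would be larger. *)
have A0 : A 0.
  have [//|nA0] := pselect (A 0); exfalso; apply: (Amax [set 0]).
    split; last by move=> h; apply: nA0; exact: h.
    move=> u Au; have := AZ (-1) u u Au Au; rewrite scaleN1r addNr => /nA0 [].
  by split=> [a u v -> ->|u ->]; rewrite ?scaler0 ?addr0.
have dec v : exists yz : V * V, [/\ Y yz.1, A yz.2 & v = yz.1 + yz.2].
  apply: contrapT => nv; pose B := [set x | exists a, exists2 z, A z & x = a *: v + z].
  apply: (Amax B).
    split; last first.
      move=> BA; apply: nv; exists (0, v); split=> //=; last by rewrite add0r.
      by apply: BA; exists 1, 0 => //; rewrite scale1r addr0.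
    by move=> z Az; exists 0, z => //; rewrite scale0r add0r.
  split=> [a u w [b [z Az ->]] [c [z' Az' ->]]|u [a [z Az ->]] Yu].
    exists (a * b + c), (a *: z + z'); first exact: AZ.
    by rewrite scalerDr scalerA addrACA -scalerDl.
  have a0 : a = 0.
    apply: contrapT => /eqP a0; apply: nv.
    exists (a^-1 *: (a *: v + z), - a^-1 *: z); split=> /=.
    - by rewrite -[_ *: _]addr0; exact: YZ.
    - by rewrite -[_ *: _]addr0; exact: AZ.
    - by rewrite scalerDr scalerA mulVf // scale1r scaleNr addrK.
  by move: Yu; rewrite a0 scale0r add0r; exact: AY.
have uniq y z y' z' : Y y -> A z -> Y y' -> A z' -> y + z = y' + z' -> y = y'.
  move=> Yy Az Yy' Az' e; apply/eqP; rewrite -subr_eq0; apply/eqP.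
  have e' : y - y' = z' - z.
    by apply/eqP; rewrite subr_eq addrAC eq_sym subr_eq addrC -e.
  apply: AY; last by rewrite addrC -scaleN1r; exact: YZ.
  by rewrite e' addrC -scaleN1r; exact: AZ.
have [f hf] := choice dec; exists (fun v => (f v).1); split.
- move=> a u v; have [Yu Au eu] := hf u; have [Yv Av ev] := hf v.
  have [Yw Aw ew] := hf (a *: u + v).
  apply: (uniq _ (f (a *: u + v)).2 _ (a *: (f u).2 + (f v).2)) => //.
  - exact: YZ.
  - exact: AZ.
  - by rewrite -ew [in LHS]eu [in LHS]ev scalerDr addrACA.
- by move=> v; have [] := hf v.
- move=> v Yv; have [Y1 A1 e] := hf v.
  by apply: (uniq _ (f v).2 _ 0) => //; rewrite -e addr0.
Qed.

End LinearProjection.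

Section ClosedSubspace.
Context {R : realType} {k : scalar_kind}.
Local Notation K := (scalar_field R k).
Context {V : completeNormedModType K} {D : set V} (hD : is_subspace D) (cD : closed D).

(** The proofs that [D] is a subspace and is closed are arguments of this predicate and of the type
    below, so that the structures depending on them can be inferred. *)
Definition closed_subspace_pred of is_subspace D : {pred V} := fun x => x \in D.

Lemma closed_subspace_submod : submod_closed (closed_subspace_pred hD).
Proof.
have [D0 DZ] := hD; split=> [|a u v]; first exact: (mem_set D0).
by move=> /set_mem Du /set_mem Dv; exact: (mem_set (DZ _ _ _ Du Dv)).
Qed.

HB.instance Definition _ := GRing.isSubmodClosed.Build K V (closed_subspace_pred hD)
  closed_subspace_submod.

Definition closed_subspace of closed D := {x : V | x \in closed_subspace_pred hD}.
Local Notation U := (closed_subspace cD).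

HB.instance Definition _ := SubChoice.on U.
HB.instance Definition _ := [SubChoice_isSubLmodule of U by <:].

Definition closed_subspace_norm (x : U) : K := `|val x|.

Lemma closed_subspace_normD x y :
  closed_subspace_norm (x + y) <= closed_subspace_norm x + closed_subspace_norm y.
Proof. by rewrite /closed_subspace_norm raddfD ler_normD. Qed.

Lemma closed_subspace_normZ (l : K) x :
  closed_subspace_norm (l *: x) = `|l| * closed_subspace_norm x.
Proof. by rewrite /closed_subspace_norm linearZ normrZ. Qed.

Lemma closed_subspace_norm0_eq0 x : closed_subspace_norm x = 0 -> x = 0.
Proof. by move=> /normr0_eq0 h; apply: val_inj; rewrite h raddf0. Qed.

HB.instance Definition _ := Lmodule_isNormed.Build K U
  closed_subspace_normD closed_subspace_normZ closed_subspace_norm0_eq0.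

Lemma closed_subspace_complete (F : set_system U) :
  ProperFilter F -> cauchy F -> cvg F.
Proof.
move=> FF /cauchyP Fc.
have /cauchy_cvg/cvg_ex[v hv] : cauchy (val @ F).
  apply/cauchyP => e e0; have [x Fx] := Fc e e0; exists (val x).
  apply: filterS Fx => y; rewrite -!ball_normE /ball_ /= => xy.
  exact: xy.
have Dv : D v.
  have Dval (x : U) : D (val x) by apply: set_mem; exact: (valP x).
  by apply: (@closed_cvg _ V F _ val D cD _ v hv); exact: nearW.
pose u : U := exist _ v (mem_set Dv).
apply/cvg_ex; exists u.
have /cvg_nrmP hv' := hv.
suff : id @ F --> u by [].
apply/cvg_nrmP => e e0; apply: filterS (hv' e e0) => x.
by move=> h; exact: h.
Qed.

HB.instance Definition _ := Uniform_isComplete.Build U closed_subspace_complete.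

Lemma closed_subspace_exists : exists (U : completeNormedModType K) (i : U -> V),
  [/\ linear i, forall u, `|i u| = `|u| & range i = D].
Proof.
exists U, val; split=> //.
apply/seteqP; split=> [_ [x _ <-]|x Dx]; first by apply: set_mem; exact: (valP x).
by exists (exist _ x (mem_set Dx)).
Qed.

End ClosedSubspace.

(** * The topological dual and adjoints *)

Section Dual.
Context {R : realType} {k : scalar_kind}.
Local Notation K := (scalar_field R k).
Context {W B : normedModType K} {pairing : B -> W -> K} (hB : is_topological_dual pairing).

Lemma dual_ext y y' : (forall w, pairing y w = pairing y' w) -> y = y'.
Proof.
move=> h; have [y0 [_ uniq]] := dual_onto hB (dual_functional hB y).
by rewrite -(uniq y) // -(uniq y').
Qed.

Lemma dual_exists (f : W -> K^o) : bounded_operator f ->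
  exists y, forall w, pairing y w = f w.
Proof. by move=> /(dual_onto hB)[y [hy _]]; exists y. Qed.

Lemma dual_linear_r y : linear (pairing y : W -> K^o).
Proof. by case: (dual_functional hB y). Qed.

Lemma dual_nrm_ub y w : sabs (pairing y w) <= nrm y * nrm w.
Proof. by rewrite -(@rc_le R k) rcM -sabsE -!nrmE (dual_norm_ub hB). Qed.

Lemma dual_nrm_least y (c : R) : 0 <= c ->
  (forall w, sabs (pairing y w) <= c * nrm w) -> nrm y <= c.
Proof.
move=> c0 h; rewrite -(@rc_le R k) -nrmE; apply: (dual_norm_least hB); first by rewrite rc_ge0.
by move=> w; rewrite sabsE nrmE -rcM rc_le.
Qed.

Lemma adjoint_exists (A : W -> W) : bounded_operator A ->
  exists2 A' : B -> B, bounded_operator A' & forall y w, pairing (A' y) w = pairing y (A w).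
Proof.
move=> bA; have [A' hA'] : exists A' : B -> B, forall y w, pairing (A' y) w = pairing y (A w).
  have /choice[A' hA'] : forall y, exists y', forall w, pairing y' w = pairing y (A w).
    move=> y; apply: (@dual_exists (fun w => pairing y (A w))).
    exact: bounded_operator_comp (dual_functional hB y) bA.
  by exists A'.
exists A' => //; have [M M0 hM] := bounded_operator_bound bA.
apply/bounded_operatorP; split=> [a u v|].
  apply: dual_ext => w; have lw := dual_linear hB w; have lAw := dual_linear hB (A w).
  by rewrite hA' lAw lw !hA'.
exists M => [|y]; first exact: ltW.
apply: dual_nrm_least => [|w]; first by rewrite mulr_ge0 ?nrm_ge0 // ltW.
rewrite hA' (le_trans (dual_nrm_ub _ _)) // [M * _]mulrC -mulrA.
by rewrite ler_wpM2l ?nrm_ge0.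
Qed.

End Dual.

Lemma closure_subspace {R : realType} {k : scalar_kind}
    {V : normedModType (scalar_field R k)} (D : set V) :
  is_subspace D -> is_subspace (closure D).
Proof.
move=> [D0 DZ]; split; first exact: subset_closure.
move=> a u v /closureP hu /closureP hv; apply/closureP => e e0.
have c0 : 0 < sabs a + 1 by rewrite ltr_wpDl // sabs_ge0.
have [u' Du' uu'] := hu _ (divr_gt0 (divr_gt0 e0 (ltr0Sn _ 1)) c0).
have [v' Dv' vv'] := hv _ (divr_gt0 e0 (ltr0Sn _ 1)).
exists (a *: u' + v'); first exact: DZ.
rewrite opprD addrACA -scalerBr (le_lt_trans (nrmD _ _)) // nrmZ.
rewrite ltr_pdivlMr // in uu'; have := nrm_ge0 (u' - u); have := sabs_ge0 a.
nra.
Qed.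

Lemma range_subspace {K : numFieldType} {V W : lmodType K} (A : V -> W) :
  linear A -> is_subspace (range A).
Proof.
move=> lA; split; first by exists 0; rewrite ?(lin0 lA).
by move=> a _ _ [u _ <-] [v _ <-]; exists (a *: u + v); rewrite ?lA.
Qed.

Section ExtendedSpace.
Context {R : realType} {k : scalar_kind}.
Local Notation K := (scalar_field R k).
Context {V W : completeNormedModType K} {incl : W -> V} {Pi1 : V -> W}
  {Pi0 : V -> K} {one : V} (hsp : splitting incl Pi1 Pi0 one) (one0 : one != 0)
  (S : R -> V -> V) (hS : C0_semigroup S) (S_one : forall h, 0 <= h -> S h one = one).
Context {B : completeNormedModType K} {pairing : B -> W -> K}
  (hB : is_topological_dual pairing).
Local Notation T1 := (compression incl Pi1 S).
Local Notation C := [set w | generator_domain S (incl w)].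
Local Notation beta := (@generator_constant R k V W incl Pi0 S).
Local Notation kappa := (@constant_part R k V W incl Pi0 S).

Lemma generator_displacement v g (M h : R) : 0 <= h ->
  (forall s u, 0 <= s -> s <= h -> nrm (S s u) <= M * nrm u) ->
  generator S v g -> nrm (S h v - v) <= h * (M * nrm g).
Proof.
move=> h0 hM hv; rewrite -(sg_integral_generator hS h0 hv).
by apply: sg_integral_bound => // s s0 sh; exact: hM.
Qed.

(** The comparison of the integral with a Riemann sum of one term; two points of the orbit are at
    most [2 * c] apart, by way of [g]. *)
Lemma sg_integral_displacement g (h c : R) : 0 <= h ->
  (forall s, 0 <= s -> s <= h -> nrm (S s g - g) <= c) ->
  nrm (sg_integral S h g - rc k h *: g) <= h * (2 * c).
Proof.
move=> h0 hc; have := @riemann_sum_approx _ _ _ _ hS h (2 * c) 1 g h0.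
rewrite mul1r nrmBC /riemann_sum big_ord1 mul0r (sg0 hS); apply=> s t s0 sh t0 th _.
rewrite (le_trans (nrm_dist g _ _)) // (nrmBC g).
by have := hc s s0 sh; have := hc t t0 th; lra.
Qed.

Lemma dual_semigroup_exists : exists Ts : R -> B -> B, forall h : R, 0 <= h ->
  bounded_operator (Ts h) /\ forall y w, pairing (Ts h y) w = pairing y (T1 h w).
Proof.
suff /choice : forall h : R, exists f : B -> B, 0 <= h -> bounded_operator f /\
   forall y w, pairing (f y) w = pairing y (T1 h w).
  by case=> f hf; exists f.
move=> h; have [h0|_] := boolP (0 <= h); last by exists id.
have [A' bA' hA'] := adjoint_exists hB (sg_bounded (compression_C0 hsp hS S_one) h0).
by exists A'.
Qed.

(* B embeds by the square of the adjoint of the smoothing operator. The square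
   makes beta, which is bounded on C only, a norm limit of the kappa h / h. *)
Lemma extended_space_exists : exists (Bp : completeNormedModType K) (j : B -> Bp)
    (pairp : Bp -> W -> K) (b : Bp) (U : R -> Bp -> Bp),
  [/\ is_extended_space pairing C j pairp,
      extends_dual_semigroup pairing T1 j U,
      forall U', extends_dual_semigroup pairing T1 j U' ->
        forall t y, 0 <= t -> U' t y = U t y &
      forall s w, 0 <= s -> C w -> pairp (U s b) w = beta (T1 s w)].
Proof.
have [l [Q [bQ gQ bbQ QA QT]]] := smoothing_exists hsp hS S_one one0.
have [Qs bQs QsE] := adjoint_exists hB bQ.
have lQs : linear Qs by case: bQs.
have lQ : linear Q by case: bQ.
have [Ts hTs] := dual_semigroup_exists.
have TsE h y w : 0 <= h -> pairing (Ts h y) w = pairing y (T1 h w).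
  by move=> /hTs[_]; apply.
have TsQs h y : 0 <= h -> Ts h (Qs y) = Qs (Ts h y).
  by move=> h0; apply: (dual_ext hB) => w; rewrite TsE // !QsE TsE // QT.
(* By [QA] the range of [Q] contains the dense set [C]. *)
have Qs_inj y : Qs y = 0 -> y = 0.
  move=> y0; apply: (dual_ext hB) => w.
  have b0 := dual_functional hB (0 : B); have by' := dual_functional hB y.
  apply: (bounded_operator_eq_dense by' b0 (compression_domain_dense hsp hS S_one)) => u Cu.
  have lu := dual_linear hB u; have lu' := dual_linear hB (rc k l *: u - Pi1 (generator_value S (incl u))).
  by rewrite -(QA u Cu) -QsE y0 (lin0 lu') (QA u Cu) (lin0 lu).
pose j0 := Qs \o Qs.
have bj0 : bounded_operator j0 by exact: bounded_operator_comp.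
have lj0 : linear j0 by case: bj0.
pose D := closure (range j0).
have Dsub : is_subspace D by apply/closure_subspace/range_subspace.
have [Bp [i [li ni ri]]] := closed_subspace_exists Dsub (@closed_closure _ _).
have nrmi u : nrm (i u) = nrm u by rewrite /nrm ni.
have i_inj u v : i u = i v -> u = v.
  move=> e; apply/eqP; rewrite -subr_eq0; apply/eqP/nrm_eq0.
  by rewrite -nrmi (linB li) e subrr nrm0.
have liftD x : D x -> exists u, i u = x by rewrite -ri => -[u _ <-]; exists u.
have Di u : D (i u) by rewrite -ri; exists u.
have /choice[j hj] : forall y, exists u, i u = j0 y.
  by move=> y; apply: liftD; apply: subset_closure; exists y.
have TsD h x : 0 <= h -> D x -> D (Ts h x).
  move=> h0 /closureP Dx; apply/closureP => e e0.
  have [bT _] := hTs h h0; have [M M0 hM] := bounded_operator_bound bT.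
  have lT : linear (Ts h) by case: bT.
  have [_ [y _ <-] yx] := Dx _ (divr_gt0 e0 M0).
  exists (Ts h (j0 y)); first by exists (Ts h y) => //; rewrite /j0 /= !TsQs.
  by rewrite -(linB lT) (le_lt_trans (hM _)) // mulrC -ltr_pdivlMr.
(* [Bp] is a closed subspace of [B] that the dual semigroup leaves invariant, and [U] is its
   restriction. It extends the dual semigroup along [j] because [Ts] commutes with [Qs]. *)
have [U hU] : exists U : R -> Bp -> Bp, forall h : R, 0 <= h ->
    forall u, i (U h u) = Ts h (i u).
  suff /choice : forall h : R, exists f : Bp -> Bp, 0 <= h ->
    forall u, i (f u) = Ts h (i u).
    by case=> f hf; exists f.
  move=> h; have [h0|_] := boolP (0 <= h); last by exists id.
  have /choice[f hf] : forall u, exists u', i u' = Ts h (i u).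
    by move=> u; apply: liftD; exact: TsD.
  by exists f.
have sgU : bounded_semigroup U.
  split.
  - move=> h h0; have [bT _] := hTs h h0; have lT : linear (Ts h) by case: bT.
    have [M M0 hM] := bounded_operator_bound bT.
    apply/bounded_operatorP; split.
      by move=> a u v; apply: i_inj; rewrite li !hU // li lT.
    by exists M => [|u]; [exact: ltW|rewrite -!nrmi hU].
  - move=> u; apply: i_inj; rewrite hU //; apply: (dual_ext hB) => w.
    by rewrite TsE // (compression0 hsp hS).
  - move=> h t u h0 t0; apply: i_inj; rewrite !hU ?addr_ge0 //.
    apply: (dual_ext hB) => w; rewrite !TsE ?addr_ge0 // addrC.
    by rewrite (compressionD hsp hS S_one).
have extU : extends_dual_semigroup pairing T1 j U.
  split=> // h y y' h0 hy'; apply: i_inj; rewrite hU // !hj /j0 /= !TsQs //.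
  by congr (Qs (Qs _)); apply: (dual_ext hB) => w; rewrite TsE.
have jdense u (e : R) : 0 < e -> exists2 u', range j u' & nrm (u' - u) < e.
  move=> e0; have /closureP/(_ e e0)[_ [y _ <-] yu] := Di u.
  by exists (j y); [exists y|rewrite -nrmi (linB li) hj].
(* [z] represents beta after [Q]. If beta were in [B], then [Qs] would map it to [z], and [j0] would
   map it to [Qs z]; hence the choice of [b]. *)
have [z hz] := dual_exists hB bbQ.
have [b hb] : exists b, i b = Qs z.
  apply: liftD; apply/closureP => e e0.
  have [M M0 hM] := sg_locally_bounded hS 1.
  have [m0 m00 hm0] := bounded_operator_bound (split_Pi0 hsp).
  have [q q0 hq] := bounded_operator_bound bQ.
  have [q' q'0 hq'] := bounded_operator_bound bbQ.
  have lS h : 0 <= h -> linear (S h) by exact: sg_linear.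
  pose G w : V := rc k l *: incl (Q w) - incl w + beta (Q w) *: one.
  pose c1 := `|l| * q + 1 + q' * nrm one.
  have c10 : 0 < c1.
    by rewrite /c1 ltr_wpDr ?mulr_ge0 ?nrm_ge0 ?(ltW q'0) // ltr_wpDl // mulr_ge0 // ltW.
  have G_le w : nrm (G w) <= c1 * nrm w.
    rewrite /G (le_trans (nrmD _ _)) // /c1 2!mulrDl mul1r lerD //.
      rewrite (le_trans (nrmB _ _)) // nrmZ sabs_rc !(split_incl_nrm hsp) lerD //.
      by rewrite -mulrA ler_wpM2l.
    rewrite nrmZ mulrAC ler_wpM2r ?nrm_ge0 //; exact: hq'.
  have disp s w : 0 <= s -> s <= 1 -> nrm (S s (incl (Q w)) - incl (Q w)) <= s * (M * c1 * nrm w).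
    move=> s0 s1; have := @generator_displacement _ _ M s s0 _ (gQ w).
    rewrite -/(G w) => h; rewrite (le_trans (h _)) //; last first.
      by rewrite ler_wpM2l // -mulrA ler_wpM2l ?G_le // ltW.
    by move=> r u r0 rs; apply: hM => //; exact: le_trans s1.
  pose c2 := (`|l| * q + 1) * (M * c1).
  have c20 : 0 < c2 by rewrite !mulr_gt0 // ltr_wpDl // mulr_ge0 // ltW.
  (* [G (Q w)], the generator at [incl (Q (Q w))], combines [incl (Q (Q w))], [incl (Q w)] and
     [one], all of them in the domain. Thus it moves at a rate bounded by [nrm w], which makes the
     convergence uniform. [G w] contains [incl w] and offers no such bound. *)
  have dispG s w : 0 <= s -> s <= 1 -> nrm (S s (G (Q w)) - G (Q w)) <= s * (c2 * nrm w).
    move=> s0 s1; rewrite {1}/G (linD (lS s s0)) (linB (lS s s0)) !(linZ (lS s s0)) S_one //.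
    rewrite /G opprD addrACA subrr addr0 opprD addrACA -scalerBr -opprD.
    rewrite (le_trans (nrmD _ _)) // nrmZ sabs_rc nrmN.
    have d1 := disp s (Q w) s0 s1; have d2 := disp s w s0 s1.
    have : `|l| * nrm (S s (incl (Q (Q w))) - incl (Q (Q w))) <=
        `|l| * (s * (M * c1 * (q * nrm w))).
      rewrite ler_wpM2l // (le_trans d1) // ler_wpM2l // ler_wpM2l //.
      by rewrite mulr_ge0 // ltW.
    rewrite /c2; move: d2; lra.
  pose h := Num.min 1 (e / 2 / (m0 * 2 * c2)).
  have h0 : 0 < h.
    rewrite lt_min ltr01 /=; apply: divr_gt0; first exact: divr_gt0.
    by apply: mulr_gt0 => //; exact: mulr_gt0.
  have h1 : h <= 1 by rewrite ge_min lexx.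
  have h2 : h * (m0 * 2 * c2) <= e / 2.
    have m2c : 0 < m0 * 2 * c2 by apply: mulr_gt0 => //; exact: mulr_gt0.
    by rewrite -ler_pdivlMr // ge_min lexx orbT.
  have [kh hkh] := dual_exists hB (constant_part_bounded hsp hS (ltW h0)).
  exists (j0 (rc k h^-1 *: kh)); first by exists (rc k h^-1 *: kh).
  apply: (@le_lt_trans _ _ (e / 2)); last by lra.
  apply: (dual_nrm_least hB) => [|w]; first by rewrite divr_ge0 // ltW.
  have lw := dual_linear hB w; rewrite (linB lw) /j0 /= !QsE.
  have lqq := dual_linear hB (Q (Q w)); rewrite (linZ lqq) hkh hz.
  have Cq : C (Q (Q w)) by eexists; exact: (gQ (Q w)).
  rewrite (constant_part_integral hsp hS (ltW h0) Cq).
  have betaE : beta (Q (Q w)) = Pi0 (G (Q w)) by rewrite /generator_constant (generator_valueE (gQ (Q w))).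
  rewrite (generator_valueE (gQ (Q w))) -/(G (Q w)) betaE.
  have lPi0 : linear (Pi0 : V -> K^o) by case: (split_Pi0 hsp).
  have -> : (rc k h^-1 *: (Pi0 (sg_integral S h (G (Q w))) : K^o) - Pi0 (G (Q w)) : K) =
      Pi0 (rc k h^-1 *: (sg_integral S h (G (Q w)) - rc k h *: G (Q w))).
    rewrite scalerBr scalerA -rcM mulVf ?gt_eqF // rc1 scale1r (linB lPi0).
    by rewrite (linZ lPi0).
  rewrite (le_trans (hm0 _)) // nrmZ sabs_rc gtr0_norm ?invr_gt0 //.
  have := @sg_integral_displacement (G (Q w)) h (h * (c2 * nrm w)) (ltW h0) _.
  move=> /(_ _)hd.
  apply: (@le_trans _ _ (m0 * (h^-1 * (h * (2 * (h * (c2 * nrm w))))))).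
    rewrite ler_pM2l // ler_pM2l ?invr_gt0 // hd // => s s0 sh.
    rewrite (le_trans (dispG s w s0 (le_trans sh h1))) // ler_wpM2r //.
    by rewrite mulr_ge0 ?nrm_ge0 // ltW.
  rewrite (mulrA h^-1) mulVf ?gt_eqF // mul1r.
  have := nrm_ge0 w; nra.
(* [Y] contains the range of [j] and every [U s b], and on it the inverse of [Qs] is defined. *)
pose Y := [set u | exists y, i u = Qs y].
have Ysub : is_subspace Y.
  split; first by exists 0; rewrite (lin0 li) (lin0 lQs).
  by move=> a u v [y hy] [y' hy']; exists (a *: y + y'); rewrite li hy hy' lQs.
(* In general no pairing with C that makes b and the maps U s b correct is
   continuous in the norm of Bp, whence the algebraic projection. *)
have [p [lp pY pid]] := linear_projection Ysub.
have [zeta hzeta] := choice pY.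
have Qs_inj' y y' : Qs y = Qs y' -> y = y'.
  by move=> e; apply/eqP; rewrite -subr_eq0; apply/eqP/Qs_inj; rewrite (linB lQs) e subrr.
have zetaE u y : i u = Qs y -> zeta u = y.
  by move=> uy; apply: Qs_inj'; rewrite -hzeta pid //; exists y.
have lzeta : linear zeta.
  by move=> a u v; apply: Qs_inj'; rewrite lQs -!hzeta lp li.
(* [Q (A w) = w] on [C] by [QA]. Since [zeta (j y) = Qs y], pairing with [A w] returns
   [pairing y w]; since [zeta (U s b) = Ts s z], it returns beta at [Q (T1 s (A w)) = T1 s w]. *)
pose A w := rc k l *: w - Pi1 (generator_value S (incl w)).
have lPi1 : linear Pi1 by case: (split_Pi1 hsp).
have Alin a u v : C u -> C v -> A (a *: u + v) = a *: A u + A v.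
  move=> /generator_valueP gu /generator_valueP gv.
  have := generator_linear (a := a) (fun h h0 => sg_linear hS h0) gu gv.
  rewrite -(split_incl_linear hsp) /A => /generator_valueE ->.
  rewrite lPi1 scalerDr !scalerBr opprD addrACA !scalerA [rc k l * a]mulrC.
  by [].
exists Bp, j, (fun u w => pairing (zeta u) (A w)), b, U; split.
- split.
  + by move=> a u v; apply: i_inj; rewrite li !hj lj0.
  + move=> y y' e; have := congr1 i e; rewrite !hj => e'.
    exact: (Qs_inj' _ _ (Qs_inj' _ _ e')).
  + by move=> w _ a u v; rewrite lzeta; exact: (dual_linear hB).
  + move=> u a w w' Cw Cw'; rewrite Alin //.
    exact: (dual_linear_r hB).
  + by move=> y w Cw; rewrite (zetaE _ (Qs y)) ?hj // QsE QA.
- exact: extU.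
- move=> U' [[bU' _ _] extU'] t y t0.
  have [bU _ _] := sgU.
  apply: (bounded_operator_eq_dense (bU' t t0) (bU t t0) jdense) => _ [x _ <-].
  by rewrite (extU' t x (Ts t x)) ?(extU.2 t x (Ts t x)) // => w; rewrite TsE.
- move=> s w s0 Cw; rewrite (zetaE _ (Ts s z)); last by rewrite hU // hb TsQs.
  by rewrite TsE // hz -/(A w) QT // QA.
Qed.

End ExtendedSpace.

(** * Everywhere defined generators *)

Section EverywhereDefinedGenerator.
Context {R : realType} {k : scalar_kind}.
Local Notation K := (scalar_field R k).
Context {V : completeNormedModType K} (S : R -> V -> V) (hS : C0_semigroup S)
  (domT : forall v, generator_domain S v).

Let lS h : 0 <= h -> linear (S h). Proof. exact: sg_linear. Qed.

(** The difference quotients at times [1 / n.+1] converge at every vector, so they are pointwise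
    bounded and therefore uniformly bounded. *)
Lemma difference_quotients_bounded : exists2 M : R, 0 <= M &
  forall n v, nrm (S n.+1%:R^-1 v - v) <= n.+1%:R^-1 * (M * nrm v).
Proof.
pose Dn (n : nat) (v : V) := rc k n.+1%:R *: (S n.+1%:R^-1 v - v).
have n0 (n : nat) : 0 < n.+1%:R^-1 :> R by rewrite invr_gt0.
have [||M M0 hM] := @uniform_boundedness R k V V nat Dn.
- move=> n; apply: bounded_operatorZ; apply: bounded_operatorB.
    by apply: sg_bounded => //; exact: ltW.
  exact: bounded_operator_id.
- move=> v; have /generatorP/(_ _ ltr01)[r r0 hr] := generator_valueP (domT v).
  have [N hN] := small_step 1 (divr_gt0 r0 (ltr0Sn R 1)).
  exists (nrm (generator_value S v) + 1 + \sum_(i < N) nrm (Dn i v)) => n.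
  have sum_ge0 : 0 <= \sum_(i < N) nrm (Dn i v).
    by apply: sumr_ge0 => i _; exact: nrm_ge0.
  have [nN|Nn] := ltnP n N.
    rewrite (bigD1 (Ordinal nN)) //= addrCA ler_wpDr //.
    by rewrite !addr_ge0 ?nrm_ge0 // sumr_ge0 // => i _; exact: nrm_ge0.
  rewrite ler_wpDr //.
  have := hr _ (n0 n); have := hN n Nn; rewrite mul1r mulr1 => h1 h2.
  have {}h2 : nrm (S n.+1%:R^-1 v - v - rc k n.+1%:R^-1 *: generator_value S v) <= n.+1%:R^-1.
    by apply: h2; apply: (le_lt_trans h1); lra.
  have -> : Dn n v = rc k n.+1%:R *: (S n.+1%:R^-1 v - v - rc k n.+1%:R^-1 *: generator_value S v) + generator_value S v.
    by rewrite scalerBr scalerA -rcM divff ?pnatr_eq0 // rc1 scale1r subrK.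
  rewrite addrC (le_trans (nrmD _ _)) // lerD2l nrmZ sabs_rc ger0_norm //.
  by rewrite mulrC -ler_pdivlMr // mul1r.
exists M => // n v; rewrite ler_pdivlMl //; have := hM n v.
by rewrite nrmZ sabs_rc ger0_norm.
Qed.

Lemma generator_value_bounded : bounded_operator (generator_value S).
Proof.
have [M M0 hM] := difference_quotients_bounded.
apply/bounded_operatorP; split.
  move=> a u v; apply: generator_valueE.
  by have := generator_linear (a := a) lS (generator_valueP (domT u)) (generator_valueP (domT v)).
exists M => // v; apply/ler_addgt0Pr => e e0.
have /generatorP/(_ _ e0)[r r0 hr] := generator_valueP (domT v).
have [N hN] := small_step 1 (divr_gt0 r0 (ltr0Sn R 1)).
have n0 : 0 < N.+1%:R^-1 :> R by rewrite invr_gt0.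
have := hr _ n0; have := hN N (leqnn N); rewrite mul1r => h1 h2.
have {}h2 : nrm (S N.+1%:R^-1 v - v - rc k N.+1%:R^-1 *: generator_value S v) <= N.+1%:R^-1 * e.
  by apply: h2; apply: (le_lt_trans h1); lra.
have h3 := nrmB (S N.+1%:R^-1 v - v) (S N.+1%:R^-1 v - v - rc k N.+1%:R^-1 *: generator_value S v).
rewrite opprB addrC subrK nrmZ sabs_rc gtr0_norm // in h3.
by rewrite -(ler_pM2l n0) mulrDr (le_trans h3) // lerD.
Qed.

Lemma group_extension_exists : exists G, group_extension S G.
Proof.
have [M M0 hM] := difference_quotients_bounded.
pose n := Num.truncn (2 * M); pose d : R := n.+1%:R^-1.
have d0 : 0 < d by rewrite invr_gt0.
have dM : d * M <= 2^-1.
  rewrite /d ler_pdivrMl // ler_pdivlMr // mulrC ltW //; exact: truncnS_gt.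
have ld := lS (ltW d0).
have lN : linear (fun v => v - S d v).
  by move=> a u v; rewrite ld opprD addrACA -scalerBr.
have [v|Z [bZ Z1 Z2]] := neumann lN.
  by rewrite nrmBC (le_trans (hM n v)) // mulrA ler_wpM2r ?nrm_ge0.
have {}Z1 v : S d (Z v) = v by rewrite -[RHS]Z1 opprB addrC subrK.
have {}Z2 v : Z (S d v) = v by rewrite -[RHS]Z2 opprB addrC subrK.
have md m : 0 <= m%:R * d by rewrite mulr_ge0 // ltW.
have Zm1 m v : S (m%:R * d) (iter m Z v) = v.
  elim: m v => [|m ih] v; first by rewrite mul0r (sg0 hS).
  by rewrite -natr1 mulrDl mul1r (sgD hS) ?(ltW d0) // iterS Z1.
have Zm2 m v : iter m Z (S (m%:R * d) v) = v.
  elim: m v => [|m ih] v; first by rewrite mul0r (sg0 hS).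
  by rewrite -natr1 mulrDl mul1r addrC (sgD hS) ?(ltW d0) // iterSr Z2.
have bZm m : bounded_operator (iter m Z).
  elim: m => [|m ih]; first exact: bounded_operator_id.
  exact: bounded_operator_comp bZ ih.
have big (t : R) : exists m : nat, t <= m%:R * d.
  exists (Num.truncn (t / d)).+1; rewrite -ler_pdivrMr // ltW //; exact: truncnS_gt.
have S_inj t u v : 0 <= t -> S t u = S t v -> u = v.
  move=> t0 e; have [m tm] := big t.
  have E w : S (m%:R * d) w = S (m%:R * d - t) (S t w).
    by rewrite -(sgD hS) ?subr_ge0 // subrK.
  by rewrite -(Zm2 m u) -(Zm2 m v) !E e.
(* A negative time [t] is reached by [m] inverse steps of length [d], overshooting it, followed by
   [S (m%:R * d + t)]. Only the fact that [G t] is then a right inverse of [S (- t)] is retained. *)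
have /choice[G hG] : forall t : R, exists g : V -> V, [/\ bounded_operator g,
    0 <= t -> forall v, g v = S t v & t < 0 -> forall v, S (- t) (g v) = v].
  move=> t; have [t0|t0] := leP 0 t; first by exists (S t); split=> //; exact: sg_bounded.
  have [m tm] := big (- t); have tm' : 0 <= m%:R * d + t by lra.
  exists (fun v => S (m%:R * d + t) (iter m Z v)); split=> //.
    by apply: bounded_operator_comp (bZm m); exact: sg_bounded.
  move=> _ v; rewrite -(sgD hS) ?oppr_ge0 ?(ltW t0) //.
  by rewrite addrCA addNr addr0 Zm1.
have SG c t v : 0 <= c -> 0 <= c + t -> S c (G t v) = S (c + t) v.
  move=> c0 ct; have [_ G1 G2] := hG t; have [t0|t0] := leP 0 t.
    by rewrite G1 // -(sgD hS).
  rewrite -{2}(G2 t0 v) -(sgD hS) ?oppr_ge0 ?(ltW t0) //; by rewrite addrK.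
exists G; split.
- by move=> t; have [] := hG t.
- by move=> v; have [_ -> // _] := hG 0; rewrite (sg0 hS).
(* The group law is checked after applying the injective [S c], with [c] large enough to make all
   times that occur nonnegative. *)
- move=> s t v; have c0 : 0 <= `|s| + `|t| by rewrite addr_ge0.
  have hs := ler_norm (- s); have ht := ler_norm (- t); rewrite !normrN in hs ht.
  have t0 := normr_ge0 t; have s0 := normr_ge0 s.
  set c := `|s| + `|t| in c0.
  have c1 : 0 <= c + s by rewrite /c; lra.
  have c2 : 0 <= c + (s + t) by rewrite /c; lra.
  have c3 : 0 <= c + s + t by rewrite -addrA.
  by apply: (S_inj c _ _ c0); rewrite !SG // addrA.
- by move=> t v t0; have [_ ->] := hG t.
Qed.

End EverywhereDefinedGenerator.

(** * The representation *)

Section ScalarMeasurability.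
Context {R : realType} {k : scalar_kind}.
Local Notation K := (scalar_field R k).
Context {T : pointedType} (G : set (set T)) (hG : sigma_algebra setT G).

(** [G] is read as the measurable sets of [g_sigma_algebraType G], whose measurable functions are
    closed under differences and limits. *)
Lemma smeasurableP (f : T -> K) : smeasurable G f <->
  measurable_fun setT ((fun x => sRe (f x)) : g_sigma_algebraType G -> R) /\
  measurable_fun setT ((fun x => sIm (f x)) : g_sigma_algebraType G -> R).
Proof.
have GE (A : set (g_sigma_algebraType G)) : measurable A <-> G A.
  by rewrite /measurable /= sigma_algebra_id.
split=> [hf|[fR fI] A mA].
  by split=> _ A mA; rewrite setTI; apply/GE; have [] := hf A mA.
by split; apply/GE; rewrite -[X in measurable X]setTI; [exact: fR|exact: fI].
Qed.

Lemma smeasurableB (f g : T -> K) : smeasurable G f -> smeasurable G g ->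
  smeasurable G (fun x => f x - g x).
Proof.
move=> /smeasurableP[fR fI] /smeasurableP[gR gI]; apply/smeasurableP; split.
  under eq_fun do rewrite sReB; exact: measurable_funB.
under eq_fun do rewrite sImB; exact: measurable_funB.
Qed.

Lemma smeasurable_cst (c : K) : smeasurable G (fun=> c).
Proof. by apply/smeasurableP; split; exact: measurable_cst. Qed.

Lemma smeasurable_limit (f : nat -> T -> K) (g : T -> K) :
  (forall n, smeasurable G (f n)) ->
  (forall x, (f n x : K^o) @[n --> \oo] --> (g x : K^o)) -> smeasurable G g.
Proof.
move=> mf fg.
have lim (re : K -> R) x : (forall y z, re (y - z) = re y - re z) ->
    (forall y, `|re y| <= sabs y) -> re (f n x) @[n --> \oo] --> re (g x).
  move=> reB rele; have /cvg_nrmP h := fg x; apply/cvgrPdistC_lt => e e0.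
  by apply: filterS (h e e0) => n hn; rewrite -reB; exact: le_lt_trans (rele _) hn.
apply/smeasurableP; split.
  apply: (@measurable_fun_cvg _ (g_sigma_algebraType G) R setT
    (fun n x => sRe (f n x)) (fun x => sRe (g x))) => [n|x _].
    by have /smeasurableP[] := mf n.
  by apply: lim; [exact: sReB|exact: sRe_le_sabs].
apply: (@measurable_fun_cvg _ (g_sigma_algebraType G) R setT
  (fun n x => sIm (f n x)) (fun x => sIm (g x))) => [n|x _].
  by have /smeasurableP[] := mf n.
by apply: lim; [exact: sImB|exact: sIm_le_sabs].
Qed.

End ScalarMeasurability.

Lemma eq_in_sintegral {R : realType} {k : scalar_kind} {d : measure_display}
    {T : measurableType d} (mu : {measure set T -> \bar R}) (D : set T)
    (f g : T -> scalar_field R k) : (forall x, D x -> f x = g x) ->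
  sintegral mu D f = sintegral mu D g.
Proof.
move=> fg; rewrite /Defs.sintegral; congr mk_scalar; apply: eq_Rintegral => x;
by rewrite inE => /fg ->.
Qed.

Lemma eq_sintegrable {R : realType} {k : scalar_kind} {d : measure_display}
    {T : measurableType d} (mu : {measure set T -> \bar R}) (D : set T)
    (f g : T -> scalar_field R k) : (forall x, D x -> f x = g x) ->
  sintegrable mu D f -> sintegrable mu D g.
Proof.
move=> fg [fR fI fi]; split.
- by apply: eq_measurable_fun fR => x; rewrite inE => /fg ->.
- by apply: eq_measurable_fun fI => x; rewrite inE => /fg ->.
- rewrite (@eq_integral _ _ _ _ _ (fun x => (sabs (f x))%:E)) // => x.
  by rewrite inE => /fg ->.
Qed.

Section Representation.
Context {R : realType} {k : scalar_kind}.
Local Notation K := (scalar_field R k).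
Context {V W : completeNormedModType K} {incl : W -> V} {Pi1 : V -> W}
  {Pi0 : V -> K} {one : V} (hsp : splitting incl Pi1 Pi0 one)
  (S : R -> V -> V) (hS : C0_semigroup S) (S_one : forall h, 0 <= h -> S h one = one).
Context {B : completeNormedModType K} {pairing : B -> W -> K}
  (hB : is_topological_dual pairing).
Context {d : measure_display} {Omega : measurableType d} (P : probability Omega R)
  (F : R -> set (set Omega)) (hF : filtration F) (Z : Omega -> R -> B) (LW : set W).
Local Notation T1 := (compression incl Pi1 S).
Local Notation C := [set w | generator_domain S (incl w)].
Local Notation beta := (@generator_constant R k V W incl Pi0 S).
Local Notation kappa := (@constant_part R k V W incl Pi0 S).
(** What remains of the polynomial process: [Z] stands for the process of evaluations and [LW] for
    the image of [L]. [Z_conditional] is the conditional expectation formula with [T_h l] written as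
    [T1 h l] plus the constant [kappa h l]. *)
Hypothesis LW_dense : forall w (e : R), 0 < e -> exists2 u, LW u & nrm (u - w) < e.
Hypothesis LW_stable : forall h w, 0 <= h -> LW w -> LW (T1 h w).
Hypothesis Z_integrable : forall l t, LW l -> 0 <= t ->
  sintegrable P setT (fun w => pairing (Z w t) l).
Hypothesis Z_adapted : forall l t, LW l -> 0 <= t ->
  smeasurable (F t) (fun w => pairing (Z w t) l).
Hypothesis Z_conditional : forall l t h A, LW l -> 0 <= t -> 0 <= h -> F t A ->
  sintegral P A (fun w => pairing (Z w t) (T1 h l) + kappa h l) =
  sintegral P A (fun w => pairing (Z w (t + h)) l).

Let F_sigma t : 0 <= t -> sigma_algebra setT (F t). Proof. by case: hF => h _ _; exact: h. Qed.

Let F_measurable t A : 0 <= t -> F t A -> measurable A.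
Proof. by case: hF => _ h _; move=> t0; exact: h. Qed.

Lemma Z_adapted_closure l t : 0 <= t -> smeasurable (F t) (fun w => pairing (Z w t) l).
Proof.
move=> t0; have /choice[u hu] : forall n : nat, exists u, LW u /\ nrm (u - l) < n.+1%:R^-1.
  by move=> n; have [|u Lu ul] := @LW_dense l n.+1%:R^-1; [rewrite invr_gt0|exists u].
apply: (@smeasurable_limit _ _ _ _ (F_sigma t0) (fun n w => pairing (Z w t) (u n))).
  by move=> n; apply: Z_adapted => //; have [] := hu n.
move=> w; apply: (bounded_operator_cvg (dual_functional hB (Z w t))).
apply/cvg_nrmP => e e0; have [N hN] := small_step 1 e0; exists N => // n /= Nn.
by rewrite (lt_le_trans (hu n).2) // -[_^-1]mul1r hN.
Qed.

Variables (c : R -> B) (Rm : Omega -> R -> B).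
Hypothesis cE : forall t w, 0 <= t -> pairing (c t) w = kappa t w.
Hypothesis RmE : forall w t l, 0 <= t ->
  pairing (Rm w t) l = pairing (Z w t) l - (pairing (Z w 0) (T1 t l) + kappa t l).

Lemma remainder_integral l t : 0 <= t ->
  LW l \/ weakly_integrable P pairing (fun w => Rm w t) ->
  sintegrable P setT (fun w => pairing (Rm w t) l) /\
  sintegral P setT (fun w => pairing (Rm w t) l) = 0.
Proof.
move=> t0; have caseLW l' : LW l' -> sintegrable P setT (fun w => pairing (Rm w t) l') /\
    sintegral P setT (fun w => pairing (Rm w t) l') = 0.
  move=> Ll; have F0T : F 0 setT.
    by have [h0 hC _] := F_sigma (lexx 0); have := hC _ h0; rewrite setD0.
  have i1 := Z_integrable Ll t0.
  have i2 : sintegrable P setT (fun w => pairing (Z w 0) (T1 t l') + kappa t l').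
    have := sintegrableB measurableT (Z_integrable (LW_stable t0 Ll) (lexx 0))
      (sintegrable_cst P (- kappa t l')).
    by apply: eq_sintegrable => w _; rewrite opprK.
  have e w : setT w -> pairing (Z w t) l' - (pairing (Z w 0) (T1 t l') + kappa t l') =
      pairing (Rm w t) l' by move=> _; rewrite RmE.
  split; first by apply: eq_sintegrable e _; exact: sintegrableB.
  rewrite -(eq_in_sintegral P e) sintegralB // Z_conditional // add0r subrr //.
case=> [/caseLW //|wi]; split; first exact: wi.
apply: sabs_eq0; apply/eqP; rewrite eq_le sabs_ge0 andbT; apply/ler_addgt0Pr => e e0.
rewrite add0r; have [r r0 hr] := weak_integral_continuous (dual_functional hB) wi measurableT l e0.
have [l' Ll' l'l] := LW_dense l r0; have := hr l' l'l.
by rewrite (caseLW l' Ll').2 sub0r sabsN => /ltW.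
Qed.

(** The martingale property of [M] before the inverse group is inserted. For [l] in [LW] let [N] be
    the part of [Rm w t] at [l] that depends on [Z w 0] and [kappa]. By the semigroup law and the
    cocycle identity, both sides are integrals of a term minus [N], and the two terms are those of
    [Z_conditional]. *)
Lemma remainder_conditional s t m A : 0 <= s -> s <= t -> F s A ->
  weakly_integrable P pairing (fun w => Rm w s) ->
  weakly_integrable P pairing (fun w => Rm w t) ->
  sintegral P A (fun w => pairing (Rm w s) (T1 (t - s) m)) =
  sintegral P A (fun w => pairing (Rm w t) m).
Proof.
move=> s0 st FA ws wt; have mA := F_measurable s0 FA.
have t0 : 0 <= t by exact: le_trans st.
have ts : 0 <= t - s by rewrite subr_ge0.
have caseLW l : LW l -> sintegral P A (fun w => pairing (Rm w s) (T1 (t - s) l)) =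
    sintegral P A (fun w => pairing (Rm w t) l).
  move=> Ll; pose N w := pairing (Z w 0) (T1 t l) + kappa t l.
  have iN : sintegrable P setT N.
    have := sintegrableB measurableT (Z_integrable (LW_stable t0 Ll) (lexx 0))
      (sintegrable_cst P (- kappa t l)).
    by apply: eq_sintegrable => w _; rewrite opprK.
  have i2 : sintegrable P setT (fun w => pairing (Z w s) (T1 (t - s) l) + kappa (t - s) l).
    have := sintegrableB measurableT (Z_integrable (LW_stable ts Ll) s0)
      (sintegrable_cst P (- kappa (t - s) l)).
    by apply: eq_sintegrable => w _; rewrite opprK.
  have e1 w : A w -> pairing (Z w s) (T1 (t - s) l) + kappa (t - s) l - N w =
      pairing (Rm w s) (T1 (t - s) l).
    have TE : T1 s (T1 (t - s) l) = T1 t l.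
      by rewrite -(compressionD hsp hS S_one) // addrC subrK.
    have kE : kappa t l = kappa (t - s) l + kappa s (T1 (t - s) l).
      by rewrite -(constant_partD hsp hS S_one) // addrC subrK.
    move=> _; rewrite RmE // /N TE kE.
    set x := pairing _ _; set y := pairing _ _; set u := kappa _ l; set v := kappa s _.
    by rewrite (addrCA y) opprD addrA addrK.
  have e2 w : A w -> pairing (Z w t) l - N w = pairing (Rm w t) l.
    by move=> _; rewrite RmE.
  have iS (f : Omega -> K) : sintegrable P setT f -> sintegrable P A f.
    exact: sintegrableS measurableT mA (@subsetT _ A).
  rewrite -(eq_in_sintegral P e1) -(eq_in_sintegral P e2).
  rewrite (sintegralB mA (iS _ i2) (iS _ iN)).
  rewrite (sintegralB mA (iS _ (Z_integrable Ll t0)) (iS _ iN)).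
  by rewrite Z_conditional // [s + _]addrC subrK.
apply: subr0_eq; apply: sabs_eq0; apply/eqP.
rewrite eq_le sabs_ge0 andbT; apply/ler_addgt0Pr => e e0; rewrite add0r.
have e2 : 0 < e / 2 by rewrite divr_gt0.
have [r1 r10 h1] := weak_integral_continuous (dual_functional hB) ws mA (T1 (t - s) m) e2.
have [r2 r20 h2] := weak_integral_continuous (dual_functional hB) wt mA m e2.
have bT := sg_bounded (compression_C0 hsp hS S_one) ts.
have lT : linear (T1 (t - s)) by case: bT.
have [M M0 hM] := bounded_operator_bound bT.
have [|l Ll lm] := @LW_dense m (Num.min (r1 / M) r2); first by rewrite lt_min divr_gt0.
rewrite lt_min in lm; have /andP[lm1 lm2] := lm.
have := h2 l lm2; have : nrm (T1 (t - s) l - T1 (t - s) m) < r1.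
  by rewrite -(linB lT) (le_lt_trans (hM _)) // mulrC -ltr_pdivlMr.
move=> /h1; rewrite caseLW //; set x := sintegral _ _ _; set y := sintegral _ _ _.
set z := sintegral _ _ _ => a1 a2.
have := sabsD (y - x) (x - z); rewrite addrA subrK => a3.
by move: a1; rewrite -sabsN opprB; lra.
Qed.

End Representation.

Section WeakStarRepresentation.
Context {R : realType} {k : scalar_kind}.
Local Notation K := (scalar_field R k).
Context {V W : completeNormedModType K} {incl : W -> V} {Pi1 : V -> W}
  {Pi0 : V -> K} {one : V} (hsp : splitting incl Pi1 Pi0 one)
  (S : R -> V -> V) (hS : C0_semigroup S) (S_one : forall h, 0 <= h -> S h one = one).
Context {B : completeNormedModType K} {pairing : B -> W -> K}
  (hB : is_topological_dual pairing).
Context {d : measure_display} {Omega : measurableType d} (P : probability Omega R)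
  (F : R -> set (set Omega)) (hF : filtration F) (Z : Omega -> R -> B) (LW : set W).
Local Notation T1 := (compression incl Pi1 S).
Local Notation C := [set w | generator_domain S (incl w)].
Local Notation beta := (@generator_constant R k V W incl Pi0 S).
Local Notation kappa := (@constant_part R k V W incl Pi0 S).
Hypothesis LW_dense : forall w (e : R), 0 < e -> exists2 u, LW u & nrm (u - w) < e.
Hypothesis LW_stable : forall h w, 0 <= h -> LW w -> LW (T1 h w).
Hypothesis Z_integrable : forall l t, LW l -> 0 <= t ->
  sintegrable P setT (fun w => pairing (Z w t) l).
Hypothesis Z_adapted : forall l t, LW l -> 0 <= t ->
  smeasurable (F t) (fun w => pairing (Z w t) l).
Hypothesis Z_conditional : forall l t h A, LW l -> 0 <= t -> 0 <= h -> F t A ->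
  sintegral P A (fun w => pairing (Z w t) (T1 h l) + kappa h l) =
  sintegral P A (fun w => pairing (Z w (t + h)) l).

(** On [C] the integrand is [Pi0] of the orbit of the generator value, whose integral is [kappa].
    Uniqueness holds because [C] is dense. *)
Lemma constant_part_weak_star_integral (Bp : normedModType K) (pairp : Bp -> W -> K)
    (f : R -> Bp) (t : R) (ct : B) : 0 <= t ->
  (forall s w, 0 <= s -> C w -> pairp (f s) w = beta (T1 s w)) ->
  (forall w, pairing ct w = kappa t w) ->
  unique (weak_star_integral pairing C pairp f t) ct.
Proof.
move=> t0 hf hc.
have ct_int : weak_star_integral pairing C pairp f t ct.
  move=> p Cp; have [i1 i2] :=
    sg_scalar_integral hS (generator_value S (incl p)) (split_Pi0 hsp) t0.
  have e (s : R) : 0 <= s <= t -> (Pi0 (S s (generator_value S (incl p))) : K) = pairp (f s) p.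
    by move=> /andP[s0 _]; rewrite hf // (generator_constant_compression hsp hS S_one).
  split; first by apply: eq_sintegrable i1 => s; rewrite /= in_itv /= => /e.
  rewrite hc (constant_part_integral hsp hS) // -i2.
  by apply: eq_in_sintegral => s; rewrite /= in_itv /= => /e.
split=> // c' hc'; apply: (dual_ext hB).
apply: (bounded_operator_eq_dense (dual_functional hB ct) (dual_functional hB c')
  (compression_domain_dense hsp hS S_one)) => p Cp.
by rewrite (ct_int p Cp).2 (hc' p Cp).2.
Qed.

(** As the inverse of [S t], [G (- t)] fixes [one], so compression is multiplicative here too. The
    first identity serves the martingale property, the second at [s = 0] serves [U_t M_t = R_t]. *)
Lemma group_inverse_compression (G : R -> V -> V) (s t : R) w :
  group_extension S G -> 0 <= s -> s <= t ->
  T1 (t - s) (compression incl Pi1 G (- t) w) = compression incl Pi1 G (- s) w /\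
  compression incl Pi1 G (- t) (T1 (t - s) w) = compression incl Pi1 G (- s) w.
Proof.
move=> [Gb G0 GD GS] s0 st; have ts : 0 <= t - s by rewrite subr_ge0.
have t0 : 0 <= t by exact: le_trans st.
have G_one : G (- t) one = one.
  by rewrite -{1}(S_one t0) -GS // -GD addNr G0.
split; rewrite /compression.
  rewrite (compression_mul hsp (G (- t)) w (sg_linear hS ts) (S_one ts)).
  by rewrite -GS // -GD addrAC subrr add0r.
have [lG _] := Gb (- t).
by rewrite (compression_mul hsp (S (t - s)) w lG G_one) -GS // -GD addrA addNr add0r.
Qed.

(** Stated for an arbitrary extended space, since it is applied to the space constructed above and
    also to [B] itself. *)
Lemma weak_star_representation_exists (Bp : completeNormedModType K) (j : B -> Bp)
    (pairp : Bp -> W -> K) (b : Bp) (U : R -> Bp -> Bp) :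
  is_extended_space pairing C j pairp ->
  extends_dual_semigroup pairing T1 j U ->
  (forall U', extends_dual_semigroup pairing T1 j U' ->
     forall t y, 0 <= t -> U' t y = U t y) ->
  (forall s w, 0 <= s -> C w -> pairp (U s b) w = beta (T1 s w)) ->
  weak_star_representation P F S incl Pi1 pairing LW C Z j pairp.
Proof.
move=> hext hU uniqU hb.
have [Ts hTs] := dual_semigroup_exists hsp hS S_one hB.
have TsE h y w : 0 <= h -> pairing (Ts h y) w = pairing y (T1 h w).
  by move=> /hTs[_]; apply.
have /choice[c hc] : forall t : R, exists ct : B, 0 <= t -> forall w, pairing ct w = kappa t w.
  move=> t; have [t0|_] := boolP (0 <= t); last by exists 0.
  by have [y hy] := dual_exists hB (constant_part_bounded hsp hS t0); exists y.
pose Rm w t := Z w t - Ts t (Z w 0) - c t.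
have RmE w t l : 0 <= t ->
    pairing (Rm w t) l = pairing (Z w t) l - (pairing (Z w 0) (T1 t l) + kappa t l).
  move=> t0; have ll := dual_linear hB l.
  by rewrite /Rm !(linB ll) TsE // hc // opprD addrA.
have lj := ext_j_linear hext.
have jZ w t : 0 <= t -> j (Z w t) = U t (j (Z w 0)) + j (c t) + j (Rm w t).
  move=> t0; rewrite (hU.2 t (Z w 0) (Ts t (Z w 0))) //; last by move=> ?; rewrite TsE.
  rewrite -!(linD lj); congr j.
  by rewrite /Rm -[Z w t - _ - _]addrA -opprD [RHS]addrC subrK.
exists b, U, c, Rm; split; first by split.
split; first by move=> t t0; apply: constant_part_weak_star_integral => // w; exact: hc.
split; first exact: jZ.
split.
  move=> t l t0; exact: (remainder_integral hB hF LW_dense LW_stable Z_integrable Z_conditional RmE).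
move=> G hG; have [Gb _ _ _] := hG.
pose G1 := compression incl Pi1 G.
have bG1 t : bounded_operator (G1 t) by exact: (compression_bounded hsp (Gb t)).
have /choice[M0 hM0] : forall wt : Omega * R, exists m : B,
    forall l, pairing m l = pairing (Rm wt.1 wt.2) (G1 (- wt.2) l).
  move=> [w t] /=; apply: (dual_exists hB (f := fun l => pairing (Rm w t) (G1 (- t) l))).
  exact: bounded_operator_comp (dual_functional hB _) (bG1 _).
pose M w t := M0 (w, t).
have ME w t l : pairing (M w t) l = pairing (Rm w t) (G1 (- t) l) by exact: (hM0 (w, t)).
exists M; split; first by move=> w t l _; exact: ME.
split; last first.
  move=> w t t0; rewrite {1}jZ //; congr (_ + _); apply/esym.
  apply: hU.2 => // l; rewrite ME.
  have [_] := group_inverse_compression l hG (lexx 0) t0.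
  rewrite subr0 -/G1 => ->; rewrite oppr0 /G1 /compression.
  by have [_ -> _ _] := hG; rewrite (split_Pi1_incl hsp).
move=> wi l.
have Mi t : 0 <= t -> sintegrable P setT (fun w => pairing (M w t) l).
  by move=> t0; apply: eq_sintegrable (wi t t0 (G1 (- t) l)) => w _; rewrite ME.
have Mm t : 0 <= t -> smeasurable (F t) (fun w => pairing (M w t) l).
  move=> t0; have [Fs _ Fm] := hF.
  rewrite (_ : (fun w => _) = fun w => pairing (Z w t) (G1 (- t) l) -
      pairing (Z w 0) (T1 t (G1 (- t) l)) - kappa t (G1 (- t) l)); last first.
    by apply/funext => w; rewrite ME RmE // opprD addrA.
  apply: (smeasurableB (Fs t t0)); last exact: (smeasurable_cst (Fs t t0)).
  apply: (smeasurableB (Fs t t0)).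
    exact: (Z_adapted_closure hB hF LW_dense Z_adapted).
  move=> A mA; have [h1 h2] := Z_adapted_closure hB hF LW_dense Z_adapted
    (T1 t (G1 (- t) l)) (lexx 0) mA.
  by split; apply: (Fm 0 t).
split=> // s t s0 st; have t0 : 0 <= t by exact: le_trans st.
split; [exact: Mi|exact: Mi|exact: Mm|].
move=> A FA.
have mA : measurable A by case: hF => _ Fm _; exact: (Fm s).
rewrite (eq_in_sintegral P (g := fun w => pairing (Rm w s) (T1 (t - s) (G1 (- t) l)))).
  rewrite (remainder_conditional hsp hS S_one hB hF LW_dense LW_stable Z_integrable
    Z_conditional RmE (G1 (- t) l) s0 st FA (wi s s0) (wi t t0)).
  by apply: eq_in_sintegral => w _; rewrite ME.
move=> w _; rewrite ME; have [e _] := group_inverse_compression l hG s0 st.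
by rewrite -/G1 in e; rewrite e.
Qed.

End WeakStarRepresentation.

(** The degree condition makes the image of 1 a constant, and taking expectations shows that the
    constant is 1. *)
Lemma action_one {R : realType} {k : scalar_kind} {d : measure_display}
    {Omega : measurableType d} {P : probability Omega R} {F : R -> set (set Omega)}
    (hF : filtration F) {E : Type} (hE : inhabited E)
    {Pol : set (E -> scalar_field R k)} {deg : (E -> scalar_field R k) -> nat}
    (hPol : is_polynomial_space Pol deg)
    {T : R -> (E -> scalar_field R k) -> (E -> scalar_field R k)}
    (hT : is_polynomial_action Pol deg T)
    {X : Omega -> R -> E} (hX : is_polynomial_process P F Pol T X) (h : R) :
  0 <= h -> T h (fun=> 1) = fun=> 1.
Proof.
move=> h0; have [_ Pol_cst _ _ deg0] := hPol.
have [c hc] : exists c, T h (fun=> 1) = fun=> c.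
  apply/deg0; first exact: (action_stable hT).
  apply/eqP; rewrite -leqn0 (leq_trans (action_deg hT h0 (Pol_cst 1))) //.
  by rewrite (proj2 (deg0 _ (Pol_cst 1))) //; exists 1.
have F0T : F 0 setT.
  have [Fs _ _] := hF; have [F00 FC _] := Fs 0 (lexx 0).
  by have := FC _ F00; rewrite setD0.
have [_ _ _ /(_ setT F0T)] := process_conditional hX (Pol_cst 1) (lexx 0) h0.
by rewrite hc !sintegral_cst => ->.
Qed.

Theorem theorem6p6 (R : realType) (k : scalar_kind)
    (d : measure_display) (Omega : measurableType d) (P : probability Omega R)
    (F : R -> set (set Omega)) (hF : filtration F)
    (E : Type) (hE : inhabited E)
    (Pol : set (E -> scalar_field R k)) (deg : (E -> scalar_field R k) -> nat)
    (hPol : is_polynomial_space Pol deg)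
    (T : R -> (E -> scalar_field R k) -> (E -> scalar_field R k))
    (hT : is_polynomial_action Pol deg T)
    (X : Omega -> R -> E) (hX : is_polynomial_process P F Pol T X)
    (P1 : normedModType (scalar_field R k)) (ev : P1 -> E -> scalar_field R k)
    (L : set P1) (V : completeNormedModType (scalar_field R k)) (iota : P1 -> V)
    (Tbar : R -> V -> V)
    (hA : assumption_A Pol deg T ev L iota Tbar)
    (W : completeNormedModType (scalar_field R k)) (incl : W -> V) (Pi1 : V -> W)
    (hW : is_Lbar ev L iota incl Pi1)
    (B : completeNormedModType (scalar_field R k)) (pairing : B -> W -> scalar_field R k)
    (hB : is_topological_dual pairing)
    (delta : E -> B) (hdelta : is_delta ev L iota incl pairing delta) :
  let LW : set W := [set w | exists2 p, L p & incl w = iota p] in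
  let C : set W := [set w | generator_domain Tbar (incl w)] in
  let Xt : Omega -> R -> B := fun w t => delta (X w t) in
  [/\ is_subspace C /\ dense C,
      exists (Bp : completeNormedModType (scalar_field R k)) (j : B -> Bp)
        (pairp : Bp -> W -> scalar_field R k),
        is_extended_space pairing C j pairp /\
        weak_star_representation P F Tbar incl Pi1 pairing LW C Xt j pairp &
      C = setT ->
        (exists G, group_extension Tbar G) /\
        weak_star_representation P F Tbar incl Pi1 pairing LW C Xt
          (fun y => y) pairing].
Proof.
move=> LW C Xt.
have hS : C0_semigroup Tbar := A_semigroup hA.
have [p1 hp1] := const_poly hPol hA 1.
have [Pi0 hsp] := splitting_exists hE hA hW hp1.
have one0 : iota p1 != 0.
  have [lPi0 _] := split_Pi0 hsp; apply/eqP => e; have := split_Pi0_one hsp.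
  by rewrite e (lin0 lPi0) => /esym/eqP; rewrite oner_eq0.
have S_one h : 0 <= h -> Tbar h (iota p1) = iota p1.
  by move=> h0; apply: (A_extends hA h0); rewrite hp1 (action_one hF hE hPol hT hX).
have evPol p : Pol (ev p).
  have : range ev (ev p) by exists p.
  by rewrite (A_ev_range hA) => -[].
have LW_dense : forall w (e : R), 0 < e -> exists2 u, LW u & nrm (u - w) < e.
  move=> w e e0; have : range incl (incl w) by exists w.
  rewrite (Lbar_range hW) => /closureP/(_ e e0)[_ [p Lp <-] pw].
  have : range incl (iota p) by rewrite (Lbar_range hW); apply: subset_closure; exists p.
  move=> [u _ up]; exists u; first by exists p.
  by rewrite -(split_incl_nrm hsp) (linB (split_incl_linear hsp)) up.
(* The action on a polynomial in [L], split into a polynomial in [L] and a constant, agrees with the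
   abstract splitting by [compression] and [constant_part]. *)
have step h l p : 0 <= h -> L p -> incl l = iota p ->
    exists2 p', L p' & incl (compression incl Pi1 Tbar h l) = iota p' /\
      T h (ev p) = (fun x => ev p' x + @constant_part R k V W incl Pi0 Tbar h l).
  move=> h0 Lp lp.
  have : polynomials_upto Pol deg 1 (T h (ev p)).
    have : range ev (ev p) by exists p.
    rewrite (A_ev_range hA) => -[Polp dp]; split; first exact: (action_stable hT).
    exact: leq_trans (action_deg hT h0 Polp) dp.
  rewrite -(A_ev_range hA) => -[q _ hq].
  have Tq := A_extends hA h0 hq.
  have [c [p' Lp' qE]] := L_decomposition hA q hp1.
  have [u _ up] : range incl (iota p').
    by rewrite (Lbar_range hW); apply: subset_closure; exists p'.
  have lPi1 : linear Pi1 by case: (split_Pi1 hsp).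
  have [lPi0 _] := split_Pi0 hsp.
  have Te : Tbar h (incl l) = c *: iota p1 + incl u.
    by rewrite lp Tq qE (iota_linear hA) up.
  exists p' => //; split.
    rewrite /compression Te lPi1 (split_Pi1_one hsp) scaler0 add0r.
    by rewrite (split_Pi1_incl hsp).
  rewrite /constant_part Te lPi0 (split_Pi0_one hsp) (split_Pi0_incl hsp) addr0.
  rewrite -hq qE (A_ev_linear hA) hp1; apply/funext => x.
  by rewrite [RHS]addrC.
have pairE x l p : L p -> incl l = iota p -> pairing (delta x) l = ev p x.
  exact: hdelta.
have LW_stable : forall h w, 0 <= h -> LW w -> LW (compression incl Pi1 Tbar h w).
  by move=> h w h0 [p Lp wp]; have [p' Lp' [e _]] := step h w p h0 Lp wp; exists p'.
have Z_integrable : forall l t, LW l -> 0 <= t ->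
    sintegrable P setT (fun w => pairing (Xt w t) l).
  move=> l t [p Lp lp] t0; have := process_integrable hX (evPol p) t0.
  by apply: eq_sintegrable => w _; rewrite (pairE _ _ p).
have Z_adapted : forall l t, LW l -> 0 <= t ->
    smeasurable (F t) (fun w => pairing (Xt w t) l).
  move=> l t [p Lp lp] t0; have := process_adapted hX (evPol p) t0.
  by rewrite (_ : (fun w => pairing _ _) = fun w => ev p (X w t)) //; apply/funext => w; exact: pairE.
have Z_conditional : forall l t h A, LW l -> 0 <= t -> 0 <= h -> F t A ->
    sintegral P A (fun w => pairing (Xt w t) (compression incl Pi1 Tbar h l)
      + @constant_part R k V W incl Pi0 Tbar h l) =
    sintegral P A (fun w => pairing (Xt w (t + h)) l).
  move=> l t h A [p Lp lp] t0 h0 FA.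
  have [p' Lp' [e1 e2]] := step h l p h0 Lp lp.
  have [_ _ _ /(_ A FA) e3] := process_conditional hX (evPol p) t0 h0.
  transitivity (sintegral P A (fun w => T h (ev p) (X w t))).
    by apply: eq_in_sintegral => w _; rewrite e2 (pairE _ _ p').
  by rewrite e3; apply: eq_in_sintegral => w _; rewrite (pairE _ _ p).
have rep := weak_star_representation_exists hsp hS S_one hB hF LW_dense LW_stable
  Z_integrable Z_adapted Z_conditional.
split.
- split; first exact: (compression_domain_subspace hsp hS).
  by apply/denseP => w e; exact: (compression_domain_dense hsp hS S_one).
- have [Bp [j [pairp [b [U [h1 h2 h3 h4]]]]]] :=
    extended_space_exists hsp one0 hS S_one hB.
  by exists Bp, j, pairp; split=> //; exact: (rep Bp j pairp b U).
(* The domain does not depend on the constant part, so it is all of [V] once it contains [Lbar]. *)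
move=> CT; have domT v : generator_domain Tbar v.
  have : C (Pi1 v) by rewrite CT.
  by move=> [g hg]; exists g; apply: (proj2 (generator_split hsp hS S_one _ _)).
split; first exact: group_extension_exists.
have [Ts hTs] := dual_semigroup_exists hsp hS S_one hB.
have bbeta : bounded_operator (@generator_constant R k V W incl Pi0 Tbar : W -> (scalar_field R k)^o).
  apply: bounded_operator_comp (split_Pi0 hsp) _.
  by apply: bounded_operator_comp (bounded_operator_incl hsp); exact: generator_value_bounded.
(* Here beta is bounded and is itself the [b], with the dual semigroup [Ts] as [U]. *)
have [b hb] := dual_exists hB bbeta.
have TsE h y w : 0 <= h -> pairing (Ts h y) w = pairing y (compression incl Pi1 Tbar h w).
  by move=> /hTs[_]; apply.
apply: (rep B (fun y => y) pairing b Ts).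
- split=> //; first by move=> w _; exact: (dual_linear hB).
  move=> y a u v _ _; exact: (dual_linear_r hB).
- split; last first.
    by move=> h y y' h0 hy; apply: (dual_ext hB) => w; rewrite TsE.
  split.
  + by move=> h /hTs[].
  + by move=> y; apply: (dual_ext hB) => w; rewrite TsE // (compression0 hsp hS).
  + move=> h l y h0 l0; apply: (dual_ext hB) => w; rewrite !TsE ?addr_ge0 // addrC.
    by rewrite (compressionD hsp hS S_one).
- move=> U' [_ hU'] t y t0; apply: hU' => // w; exact: TsE.
- by move=> s w s0 _; rewrite TsE // hb.
Qed.
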